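(* There are extensions of AF algebras by AF algebras which are not AF, while extensions of LF algebras by LF algebras are always LF. That is: there is a C*-algebra $A$ with a closed two-sided ideal $I$ such that $I$ and $A/I$ are AF but $A$ is not AF; and whenever $A$ is a C*-algebra with a closed two-sided ideal $I$ such that $I$ and $A/I$ are LF, then $A$ is LF.
   Context: A C*-algebra $A$ is: approximately finite-dimensional (AF) if it has a family of finite-dimensional C*-subalgebras, directed under inclusion, with dense union; locally finite-dimensional (LF) if for every finite $F\subseteq A$ and every $\varepsilon>0$ there is a finite-dimensional C*-subalgebra $B$ of $A$ such that for every $f\in F$ there is $b\in B$ with $\|f-b\|<\varepsilon$. C*-algebras are not assumed separable. The statement is a theorem of ZFC. *)

(* Defs.v *)
From HB Require Import structures.
From mathcomp Require Import all_boot all_order all_algebra.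
From mathcomp Require Import all_classical all_reals topology normedtype.
From mathcomp Require Import complex ring lra.

Set Implicit Arguments.
Unset Strict Implicit.
Unset Printing Implicit Defensive.

Import Order.TTheory GRing.Theory Num.Theory.
Import numFieldNormedType.Exports.

Local Open Scope classical_set_scope.
Local Open Scope ring_scope.

Reserved Notation "a ** b" (at level 40, left associativity).
Reserved Notation "a ^†" (at level 1, format "a ^†").

(* C*-algebras, not necessarily unital: A is a complex Banach space. MathComp
   rings being unital, the product is part of the present structure. *)
HB.mixin Record CompleteNormedModule_isCStarAlgebra (R : realType) A
    & CompleteNormedModule R[i] A := {
  amul : A -> A -> A;
  star : A -> A;
  amulA : associative amul;
  amulDl : left_distributive amul +%R;
  amulDr : right_distributive amul +%R;
  amulZl : forall (k : R[i]) (a b : A), amul (k *: a) b = k *: amul a b;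
  amulZr : forall (k : R[i]) (a b : A), amul a (k *: b) = k *: amul a b;
  ler_amul : forall a b : A, `|amul a b| <= `|a| * `|b|;
  starK : involutive star;
  starD : {morph star : a b / a + b};
  starZ : forall (k : R[i]) (a : A), star (k *: a) = (k^*)%C *: star a;
  starM : forall a b : A, star (amul a b) = amul (star b) (star a);
  normr_star_amul : forall a : A, `|amul (star a) a| = `|a| ^+ 2
}.

#[short(type="cstarAlgType")]
HB.structure Definition CStarAlgebra (R : realType) :=
  {A of CompleteNormedModule R[i] A & CompleteNormedModule_isCStarAlgebra R A}.

Notation "a ** b" := (amul a b) : ring_scope.
Notation "a ^†" := (star a) : ring_scope.

Section RealNorm.
Variables (R : realType) (V : normedModType R[i]).
Implicit Types x y : V.

(* In a normedModType over R[i] the norm takes values in R[i]; nr x is the same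
   nonnegative number in R. *)
Definition nr x : R := complex.Re `|x|.

Lemma ge0_ReE (z : R[i]) : 0 <= z -> z = (complex.Re z)%:C%C.
Proof. by case: z => a b; rewrite lecE /= => /andP[/eqP -> _]. Qed.

Lemma nrE x : `|x| = (nr x)%:C%C.
Proof. exact: ge0_ReE. Qed.

Lemma nr_ge0 x : 0 <= nr x.
Proof. by rewrite -lecR -nrE; exact: normr_ge0. Qed.

Lemma nr0 : nr (0 : V) = 0.
Proof. by rewrite /nr normr0. Qed.

Lemma nr0_eq0 x : nr x = 0 -> x = 0.
Proof. by move=> h; apply: normr0_eq0; rewrite nrE h. Qed.

Lemma nrN x : nr (- x) = nr x.
Proof. by rewrite /nr normrN. Qed.

Lemma nrBC x y : nr (x - y) = nr (y - x).
Proof. by rewrite /nr distrC. Qed.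

Lemma nrD x y : nr (x + y) <= nr x + nr y.
Proof. by rewrite -lecR rmorphD /= -!nrE ler_normD. Qed.

Lemma nrZ (k : R[i]) x : nr (k *: x) = complex.Re `|k| * nr x.
Proof.
apply: complexI; rewrite rmorphM /= -!nrE normrZ.
by congr (_ * _); exact: ge0_ReE.
Qed.

Lemma nr_triangle y x z : nr (x - z) <= nr (x - y) + nr (y - z).
Proof. by rewrite (le_trans _ (nrD _ _))// addrA subrK. Qed.

Lemma nr_ball x (e : R) y : ball x (e%:C%C) y = (nr (x - y) < e) :> Prop.
Proof. by rewrite -ball_normE /ball_/= nrE ltcR. Qed.

End RealNorm.

Section Completeness.
Variable R : realType.
Local Notation half := (2^-1 : R).

Lemma half_gt0 n : 0 < half ^+ n.
Proof. by apply: exprn_gt0; rewrite invr_gt0 ltr0n. Qed.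

Lemma half_ge0 n : 0 <= half ^+ n.
Proof. exact/ltW/half_gt0. Qed.

Lemma half_lt (e : R) : 0 < e -> exists n, half ^+ n < e.
Proof.
move=> e0; exists (Num.truncn e^-1).+1.
rewrite exprVn invf_plt ?posrE ?exprn_gt0//.
apply: (lt_trans (truncnS_gt _)).
by rewrite -natrX ltr_nat ltn_expl.
Qed.

Definition rapid (V : normedModType R[i]) (u : nat -> V) :=
  forall n, nr (u n.+1 - u n) <= half ^+ n.

Lemma rapidP (V : normedModType R[i]) (u : nat -> V) : rapid u ->
  forall n k, nr (u (n + k)%N - u n) <= 2 * half ^+ n.
Proof.
move=> ru n k.
suff: nr (u (n + k)%N - u n) <= 2 * half ^+ n - 2 * half ^+ (n + k).
  by have := half_ge0 (n + k); lra.
elim: k => [|k IH]; first by rewrite addn0 !subrr nr0.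
have := nr_triangle (u (n + k)%N) (u (n + k.+1)%N) (u n).
have := ru (n + k)%N; rewrite addnS exprS.
by move: IH; lra.
Qed.

End Completeness.

Section Completeness.
Variable R : realType.
Local Notation half := (2^-1 : R).
Lemma rapid_limit (V : completeNormedModType R[i]) (u : nat -> V) :
  rapid u -> exists l, forall n, nr (l - u n) <= 4 * half ^+ n.
Proof.
move=> ru.
have cu : cvg (u @ \oo).
  apply: cauchy_cvg; apply: cauchy_exP => e e0.
  have eE := ge0_ReE (ltW e0).
  have Re0 : 0 < complex.Re e by rewrite -ltcR -eE.
  have [|n hn] := @half_lt R (complex.Re e / 4); first by lra.
  exists (u n); exists n => // m /= nm.
  rewrite eE nr_ball nrBC.
  have := rapidP ru n (m - n); rewrite subnKC//.
  by move: hn (half_ge0 R n); lra.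
exists (lim (u @ \oo)) => n.
have hn := half_gt0 R n.
have /cvg_ballP/(_ ((half ^+ n)%:C%C)) : u @ \oo --> lim (u @ \oo) by [].
rewrite ltcR => /(_ hn)[N _ hN].
have := hN (n + N)%N; rewrite /= leq_addl nr_ball => /(_ isT).
have := rapidP ru n N.
have := nr_triangle (u (n + N)%N) (lim (u @ \oo)) (u n).
by lra.
Qed.

Lemma rapid_complete (V : normedModType R[i]) :
  (forall u : nat -> V, rapid u ->
     exists l, forall n, nr (l - u n) <= 8 * half ^+ n) ->
  forall F : set_system V, ProperFilter F -> cauchy F -> cvg F.
Proof.
move=> hV F PF /cauchyP Fc.
have hn n : 0 < half ^+ n / 4 by rewrite divr_gt0// half_gt0.
have /choice[u hu] : forall n, exists x, F (ball x ((half ^+ n / 4)%:C%C)).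
  by move=> n; apply: Fc; rewrite ltcR.
have [|l hl] := hV u.
  move=> n; have [z []] := filter_ex (filterI (hu n) (hu n.+1)).
  rewrite !nr_ball exprS; have := nr_triangle z (u n.+1) (u n).
  rewrite (nrBC z (u n)); have := half_ge0 R n; lra.
apply/cvg_ex; exists l; apply/cvg_ballP => e e0.
have eE := ge0_ReE (ltW e0).
have Re0 : 0 < complex.Re e by rewrite -ltcR -eE.
have [|n hn'] := @half_lt R (complex.Re e / 16); first by lra.
apply: filterS (hu n) => z; rewrite eE !nr_ball.
have := nr_triangle (u n) l z; have := hl n; have := half_ge0 R n; lra.
Qed.

End Completeness.

Section CStarTheory.
Variables (R : realType) (A : cstarAlgType R).
Implicit Types (a b x y : A) (k : R[i]).

Lemma amul0l b : 0 ** b = 0 :> A.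
Proof. by rewrite -(scale0r (0 : A)) amulZl !scale0r. Qed.
Lemma amul0r a : a ** 0 = 0 :> A.
Proof. by rewrite -(scale0r (0 : A)) amulZr !scale0r. Qed.
Lemma amulNl a b : (- a) ** b = - (a ** b).
Proof. by rewrite -(scaleN1r a) -(scaleN1r (a ** b)) amulZl. Qed.
Lemma amulNr a b : a ** (- b) = - (a ** b).
Proof. by rewrite -(scaleN1r b) -(scaleN1r (a ** b)) amulZr. Qed.
Lemma amulBl a b x : (a - b) ** x = a ** x - b ** x.
Proof. by rewrite amulDl amulNl. Qed.
Lemma amulBr a b x : x ** (a - b) = x ** a - x ** b.
Proof. by rewrite amulDr amulNr. Qed.
Lemma star0 : (0 : A)^† = 0.
Proof. by rewrite -(scale0r (0 : A)) starZ rmorph0 !scale0r. Qed.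
Lemma starN a : (- a)^† = - a^†.
Proof. by rewrite -(scaleN1r a) -(scaleN1r a^†) starZ rmorphN1. Qed.
Lemma starB a b : (a - b)^† = a^† - b^†.
Proof. by rewrite starD starN. Qed.

Lemma nrM a b : nr (a ** b) <= nr a * nr b.
Proof. by rewrite -lecR rmorphM /= -!nrE ler_amul. Qed.

Lemma nr_star_amul a : nr (a^† ** a) = nr a ^+ 2.
Proof. by apply: complexI; rewrite rmorphXn /= -!nrE normr_star_amul. Qed.

Lemma nr_star a : nr a^† = nr a.
Proof.
have le b : nr b <= nr b^†.
  have := nrM b^† b; rewrite nr_star_amul expr2.
  have := nr_ge0 b; rewrite le0r => /orP[/eqP -> _|b0]; first exact: nr_ge0.
  by rewrite ler_pM2r.
by apply/eqP; rewrite eq_le (le a) andbT -{2}(starK a) le.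
Qed.

Lemma isometry p y : p + p^† + p^† ** p = 0 -> nr (y + p ** y) = nr y.
Proof.
move=> p0; apply/eqP; rewrite -(@eqrXn2 _ 2) ?nr_ge0// -!nr_star_amul.
apply/eqP; congr nr; rewrite starD starM amulDl !amulDr.
rewrite -(amulA y^† p^† y).
have -> : y^† ** p^† ** (p ** y) = y^† ** (p^† ** p ** y) by rewrite !amulA.
rewrite -[RHS]addr0 -!addrA; congr (_ + _).
by rewrite -!amulDr -!amulDl addrA p0 amul0l amul0r.
Qed.

(* g is such that 1 + g = (1 + t^2)^-1, hence 1 + 2g is the real part of the
   Cayley transform of t, a unitary. *)
Lemma contraction_cayley t g y :
  t^† = t -> g^† = g -> g ** t = t ** g -> g + t ** t + t ** t ** g = 0 ->
  nr (y + (g + g) ** y) <= nr y.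
Proof.
move=> ts gs gt g0.
pose c0 := t + t ** g; pose c := c0 + c0; pose X := g + g; pose Y := 'i%C *: c.
have c0s : c0^† = c0 by rewrite starD starM ts gs gt.
have gc0 : g ** c0 = c0 ** g by rewrite amulDr amulDl amulA !gt.
have hE : t ** t + t ** t ** g = - g.
  by apply/eqP; rewrite -subr_eq0 opprK addrC addrA g0.
have c00 : c0 ** c0 = - (g + g ** g).
  have -> : c0 ** c0 = (t ** t + t ** t ** g) + (t ** t + t ** t ** g) ** g.
    by rewrite !amulDl !amulDr !amulA -(amulA t g t) gt amulA.
  by rewrite hE amulNl opprD.
clearbody c0.
have Xs : X^† = X by rewrite starD gs.
have cs : c^† = c by rewrite starD c0s.
have iJ : (('i%C : R[i])^*)%C = - 'i%C by apply/eqP; rewrite eq_complex /= oppr0 !eqxx.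
have Ys : Y^† = - Y by rewrite starZ cs iJ scaleNr.
have XY : X ** Y = Y ** X.
  by rewrite amulZr amulZl; congr (_ *: _); rewrite !(amulDl, amulDr) gc0.
have YY : Y ** Y = - (c ** c).
  have ii : 'i%C * 'i%C = -1 :> R[i].
    by rewrite -expr2 sqr_i.
  by rewrite amulZl amulZr scalerA ii scaleN1r.
have P0 : X + X + (X ** X - Y ** Y) = 0.
  rewrite YY opprK !amulDl !amulDr c00 /X.
  rewrite -!mulr2n -!mulrnDl addrA subrr.
  by rewrite !mul0rn.
rewrite -/X; clear c00 hE g0 gc0 YY cs; clearbody Y X.
have D1 : (X - Y) ** (X + Y) = X ** X - Y ** Y.
  by rewrite amulBl !amulDr XY opprD addrA addrK.
have D2 : (X + Y) ** (X - Y) = X ** X - Y ** Y.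
  by rewrite amulDl !amulBr XY addrA subrK.
have iso1 : nr (y + (X + Y) ** y) = nr y.
  apply: isometry; rewrite starD Xs Ys.
  by rewrite D1 [_ + _ + (X - Y)]addrACA subrr addr0.
have iso2 : nr (y + (X - Y) ** y) = nr y.
  apply: isometry; rewrite starB Xs Ys opprK.
  by rewrite D2 [_ - _ + (X + Y)]addrACA [- Y + Y]addrC subrr addr0.
have E : y + X ** y = (2^-1 : R[i]) *: ((y + (X + Y) ** y) + (y + (X - Y) ** y)).
  rewrite addrACA -amulDl addrACA subrr addr0 amulDl addrACA scalerDr -scalerDl.
  have -> : (2^-1 + 2^-1 = 1 :> R[i]) by rewrite [RHS]splitr !mul1r.
  by rewrite scale1r.
rewrite E nrZ.
have -> : complex.Re `|2^-1 : R[i]| = 2^-1.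
  by rewrite normfV normr_nat -[2]/(2%:R) -(rmorph_nat (real_complex R)) -fmorphV.
have := nrD (y + (X + Y) ** y) (y + (X - Y) ** y); rewrite iso1 iso2; lra.
Qed.

End CStarTheory.

(* Self-adjointness is not assumed: it is proved in ideal_star. *)
Record closedIdeal (R : realType) (A : cstarAlgType R) := ClosedIdeal {
  ideal_set :> set A;
  ideal0 : ideal_set 0;
  idealD : forall x y, ideal_set x -> ideal_set y -> ideal_set (x + y);
  idealZ : forall (k : R[i]) x, ideal_set x -> ideal_set (k *: x);
  ideal_amull : forall a x, ideal_set x -> ideal_set (a ** x);
  ideal_amulr : forall a x, ideal_set x -> ideal_set (x ** a);
  ideal_closed : closed ideal_set
}.

Section ClosedIdeal.
Variables (R : realType) (A : cstarAlgType R) (J : closedIdeal A).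
Implicit Types (a b x y : A) (k : R[i]).
Local Notation half := (2^-1 : R).
Local Notation I := (ideal_set J).

Lemma idealN x : I x -> I (- x).
Proof. by rewrite -scaleN1r; exact: idealZ. Qed.

Lemma idealB x y : I x -> I y -> I (x - y).
Proof. by move=> ? ?; apply: idealD => //; exact: idealN. Qed.

Lemma ideal_lim x : (forall e : R, 0 < e -> exists2 y, I y & nr (x - y) < e) ->
  I x.
Proof.
move=> h; apply: (@ideal_closed _ _ J) => B /nbhs_ballP[e /= e0 sB].
have eE := ge0_ReE (ltW e0).
have /h[y Iy xy] : 0 < complex.Re e by rewrite -ltcR -eE.
by exists y; split => //; apply: sB; rewrite eE nr_ball.
Qed.

Lemma le0_half (x C : R) : (forall n, x <= C * half ^+ n) -> 0 <= C -> x <= 0.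
Proof.
move=> h C0; rewrite leNgt; apply/negP => x0.
have [|n hn] := @half_lt R (x / (C + 1)); first by rewrite divr_gt0// ltr_wpDl.
move: hn; rewrite ltr_pdivlMr ?ltr_wpDl// => hn.
by have := h n; have := half_gt0 R n; lra.
Qed.

(* 1 + g = (1 + x)^-1, written without a unit. *)
Lemma neumann x : I x -> nr x <= half ->
  exists g, [/\ I g, g + x + x ** g = 0,
    (x^† = x -> g^† = g) & forall t, t ** x = x ** t -> g ** t = t ** g].
Proof.
move=> Ix nx.
pose u := fix u n : A := if n is n'.+1 then - x - x ** u n' else 0.
have uS n : u n.+1 = - x - x ** u n by [].
have mx a : nr (x ** a) <= half * nr a.
  by rewrite (le_trans (nrM _ _))// ler_wpM2r// nr_ge0.
have [|l hl] := @rapid_limit R A u.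
  elim=> [|n IH]; first by rewrite /= amul0r !subr0 nrN expr0; lra.
  have -> : u n.+2 - u n.+1 = - (x ** (u n.+1 - u n)).
    transitivity ((- x - x ** u n.+1) - (- x - x ** u n)) => //.
    by rewrite amulBr [RHS]opprB opprD !opprK addrACA addNr add0r addrC.
  rewrite nrN exprS (le_trans (mx _))// ler_wpM2l// invr_ge0 ler0n//.
have E : l + x + x ** l = 0.
  apply: nr0_eq0; apply/eqP; rewrite eq_le nr_ge0 andbT.
  apply: (@le0_half _ 8) => // n.
  have -> : l + x + x ** l = (l - u n.+1) + x ** (l - u n).
    by rewrite uS amulBr opprB opprK [x ** u n + x]addrC [x ** l - _]addrC !addrA addrK.
  rewrite (le_trans (nrD _ _))//.
  have := hl n.+1; have := mx (l - u n); have := hl n; rewrite exprS.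
  by have := half_gt0 R n; lra.
have El : l = - x - x ** l.
  by apply/eqP; rewrite -subr_eq0 opprB opprK [_ + x]addrC addrA E.
have uniq z : z = - (x ** z) -> z = 0.
  move=> zE; apply: nr0_eq0; have := mx z; rewrite -(nrN (x ** z)) -zE.
  by have := nr_ge0 z; lra.
have uniqr z : z = - (z ** x) -> z = 0.
  move=> zE; apply: nr0_eq0; have := nrM z x; rewrite -(nrN (z ** x)) -zE.
  have := ler_wpM2l (nr_ge0 z) nx; have := nr_ge0 z; lra.
have comm t : t ** x = x ** t -> l ** t = t ** l.
  move=> tx; apply/eqP; rewrite -subr_eq0; apply/eqP; apply: uniq.
  have e1 : l ** t = - (x ** t) - x ** (l ** t).
    by rewrite {1}El amulBl amulNl -amulA.
  have e2 : t ** l = - (x ** t) - x ** (t ** l).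
    by rewrite {1}El amulBr amulNr tx amulA tx -amulA.
  rewrite {1}e1 {1}e2 amulBr [RHS]opprB opprD !opprK addrACA addNr add0r.
  by rewrite addrC.
exists l; split => //.
- by rewrite El; apply: idealB; [exact: idealN|exact: ideal_amulr].
- move=> xs; have lx := comm x erefl.
  apply/eqP; rewrite -subr_eq0; apply/eqP; apply: uniqr.
  have e1 : l^† = - x - l^† ** x by rewrite {1}El starB starN starM xs.
  have e2 : l = - x - l ** x by rewrite {1}El lx.
  transitivity ((- x - l^† ** x) - (- x - l ** x)); first by rewrite -e1 -e2.
  rewrite amulBl [RHS]opprB opprD !opprK addrACA addNr add0r.
  by rewrite addrC.
Qed.

(* One-element approximate unit: 1 - e is the average of the first N powers of
   the contraction 1 + 2g. *)
Lemma almost_unit x (d : R) : I x -> 0 < d ->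
  exists e, [/\ I e, e^† = e, (forall y, nr (y - e ** y) <= nr y) &
    nr (x - x ** e) < d].
Proof.
move=> Ix d0.
pose c : R := half / (nr x ^+ 2 + 1).
have nx0 : 0 <= nr x ^+ 2 by exact: exprn_ge0 (nr_ge0 x).
have c0 : 0 < c by rewrite divr_gt0//; [rewrite invr_gt0|lra].
have nrc a : nr (c%:C%C *: a) = c * nr a.
  by rewrite nrZ ger0_norm// lecR ltW.
pose k := x^† ** x; pose t := c%:C%C *: k.
have ks : k^† = k by rewrite starM starK.
have cJ : ((c%:C)^*)%C = c%:C%C :> R[i] by rewrite /= oppr0.
have ts : t^† = t by rewrite starZ ks cJ.
have It : I t by apply: idealZ; exact: ideal_amull.
have nt : nr t <= half.
  rewrite nrc nr_star_amul /c mulrAC ler_pdivrMr; last lra.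
  by rewrite ler_wpM2l ?invr_ge0//; lra.
pose h := t ** t.
have nh : nr h <= half.
  rewrite (le_trans (nrM _ _))//; have := nr_ge0 t; nra.
have hs : h^† = h by rewrite starM ts.
have [g [Ig gE /(_ hs) gs gc]] := @neumann h (ideal_amull _ It) nh.
have gt : g ** t = t ** g by apply: gc; rewrite amulA.
have gh : g ** h = h ** g by exact: gc.
have [q qE] : exists q, q = g + g by exists (g + g).
have qc y : nr (y + q ** y) <= nr y by rewrite qE; exact: contraction_cayley gE.
have qs : q^† = q by rewrite qE starD gs.
have Iq : I q by rewrite qE; exact: idealD.
pose s := fix s n : A := if n is n'.+1 then s n' + (q + q ** s n') else 0.
have sS n : s n.+1 = s n + (q + q ** s n) by [].
have sc n y : nr (y + s n ** y) <= nr y.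
  elim: n => [|n IH]; first by rewrite amul0l addr0.
  have -> : y + s n.+1 ** y = (y + s n ** y) + q ** (y + s n ** y).
    by rewrite sS 2!amulDl amulDr amulA addrA.
  exact: le_trans (qc _) IH.
have sq n : s n ** q = q ** s n.
  elim: n => [|n IH]; first by rewrite amul0l amul0r.
  by rewrite sS !amulDl !amulDr IH -amulA IH.
have ss n : (s n)^† = s n.
  elim: n => [|n IH]; first exact: star0.
  by rewrite sS !starD starM IH qs sq.
have Is n : I (s n).
  elim: n => [|n IH]; first exact: ideal0.
  by rewrite sS; do 2 apply: idealD => //; exact: ideal_amull.
have s2 n : nr (s n) <= 2.
  have : nr (s n) ^+ 2 <= 2 * nr (s n).
    rewrite -nr_star_amul ss.
    have := sc n (s n); have := nrD (s n + s n ** s n) (- s n).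
    by rewrite nrN [_ - _]addrAC subrr add0r; lra.
  have := nr_ge0 (s n); rewrite le0r => /orP[/eqP -> _|n0]; first by [].
  by rewrite expr2 ler_pM2r.
pose S := fix S n : A := if n is n'.+1 then S n' + s n' else 0.
have SS n : S n.+1 = S n + s n by [].
have Ss n : (S n)^† = S n.
  by elim: n => [|n IH]; [exact: star0|rewrite SS starD ss IH].
have IS n : I (S n).
  by elim: n => [|n IH]; [exact: ideal0|rewrite SS; apply: idealD].
have Sc n y : nr (y *+ n + S n ** y) <= n%:R * nr y.
  elim: n => [|n IH]; first by rewrite amul0l mulr0n addr0 nr0 mul0r.
  rewrite SS amulDl mulrS [y + _]addrC addrACA (le_trans (nrD _ _))//.
  by rewrite -natr1 mulrDl mul1r lerD.
have Sq n : q *+ n + q ** S n = s n.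
  elim: n => [|n IH]; first by rewrite amul0r mulr0n addr0.
  by rewrite SS amulDr mulrS [q + _]addrC addrACA IH.
pose N := (Num.truncn (2 / (c * d ^+ 2) ^+ 2)).+1.
have N0 : 0 < N%:R :> R by rewrite ltr0n.
have hN : 2 / N%:R < (c * d ^+ 2) ^+ 2.
  have cd0 : 0 < (c * d ^+ 2) ^+ 2.
    by apply: exprn_gt0; apply: mulr_gt0 => //; apply: exprn_gt0.
  by rewrite ltr_pdivrMr// mulrC -ltr_pdivrMr// truncnS_gt.
pose r : R[i] := (N%:R^-1 : R)%:C%C.
have nrr a : nr (r *: a) = N%:R^-1 * nr a.
  by rewrite nrZ ger0_norm// lecR invr_ge0 ler0n.
have rN a : r *: (a *+ N) = a.
  rewrite -scaler_nat scalerA -[N%:R](rmorph_nat (real_complex R)) -rmorphM /=.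
  by rewrite mulVf ?lt0r_neq0// scale1r.
pose e := - (r *: S N).
have es : e^† = e.
  by rewrite starN starZ Ss /r /= oppr0.
have ec y : nr (y - e ** y) <= nr y.
  have -> : y - e ** y = r *: (y *+ N + S N ** y).
    by rewrite scalerDr rN amulNl opprK amulZl.
  by rewrite nrr ler_pdivrMl// Sc.
have eq : nr (q - q ** e) <= N%:R^-1 * 2.
  have -> : q - q ** e = r *: (q *+ N + q ** S N).
    by rewrite scalerDr rN amulNr opprK amulZr.
  by rewrite nrr Sq ler_wpM2l// invr_ge0 ler0n.
have eg : nr (g - g ** e) <= N%:R^-1.
  have E : q - q ** e = (2 : R[i]) *: (g - g ** e).
    by rewrite qE scaler_nat mulr2n amulDl opprD addrACA.
  move: eq; rewrite E nrZ normr_nat -(rmorph_nat (real_complex R)) /=; lra.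
have eh : nr (h - h ** e) <= 2 / N%:R.
  have hE : h = - (g + h ** g).
    by apply/eqP; rewrite -subr_eq0 opprK addrCA addrA gE.
  have -> : h - h ** e = - ((g - g ** e) + h ** (g - g ** e)).
    have E2 : h ** e = - ((g + h ** g) ** e) by rewrite {1}hE amulNl.
    rewrite E2 {1}hE opprK amulDl amulBr amulA.
    by rewrite [in RHS]addrACA -opprD [RHS]opprB [LHS]addrC.
  rewrite nrN (le_trans (nrD _ _))//.
  have := nrM h (g - g ** e); have := nr_ge0 (g - g ** e); move: nh eg.
  by move: (nr _) (nr _) (nr _) => ? ? ?; nra.
have SQ z : nr (z - z ** e) ^+ 2 <= nr (z^† ** z - z^† ** z ** e).
  rewrite -nr_star_amul starB starM es.
  have -> : (z^† - e ** z^†) ** (z - z ** e) =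
    (z^† ** z - z^† ** z ** e) - e ** (z^† ** z - z^† ** z ** e).
    by rewrite amulBl !amulBr !amulA.
  exact: ec.
exists e; split => //; first by apply: idealN; exact: idealZ.
have := SQ t; rewrite ts -/h => SQt; have := SQ x; rewrite -/k => SQx.
have tk : nr (t - t ** e) = c * nr (k - k ** e).
  by rewrite -nrc scalerBr amulZl.
rewrite ltNge; apply/negP => dx.
have dk : d ^+ 2 <= nr (k - k ** e).
  by rewrite (le_trans _ SQx)// ler_sqr ?nnegrE ?nr_ge0 ?(ltW d0).
move: hN; apply/negP; rewrite -leNgt (le_trans _ (le_trans SQt eh))//.
rewrite tk ler_sqr ?nnegrE; first by rewrite ler_wpM2l// ltW.
  by rewrite mulr_ge0 ?ltW// exprn_gt0.
by rewrite mulr_ge0 ?nr_ge0 ?ltW.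
Qed.

Lemma ideal_star x : I x -> I (x^†).
Proof.
move=> Ix; apply: ideal_lim => d d0.
have [e [Ie es _ xe]] := almost_unit Ix d0.
by exists (e ** x^†); [exact: ideal_amulr|rewrite -nr_star starB starM starK es].
Qed.
End ClosedIdeal.

Section IdealPredicate.
Variables (R : realType) (A : cstarAlgType R) (J : closedIdeal A).

Definition ideal_pred : {pred A} := fun x => `[< ideal_set J x >].

Lemma ideal_predE x : (x \in ideal_pred) = `[< ideal_set J x >].
Proof. by []. Qed.

Lemma ideal_predP x : reflect (ideal_set J x) (x \in ideal_pred).
Proof. exact: asboolP. Qed.

Fact ideal_submod_closed : submod_closed ideal_pred.
Proof.
split; first exact/ideal_predP/ideal0.
move=> k x y /ideal_predP Jx /ideal_predP Jy; apply/ideal_predP.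
by apply: idealD => //; exact: idealZ.
Qed.

HB.instance Definition _ := GRing.isSubmodClosed.Build R[i] A ideal_pred
  ideal_submod_closed.

End IdealPredicate.

Section IdealAlgebra.
Variables (R : realType) (A : cstarAlgType R) (J : closedIdeal A).
Local Notation half := (2^-1 : R).

Definition idealAlg : Type := {x : A | x \in ideal_pred J}.

HB.instance Definition _ := SubChoice.on idealAlg.
HB.instance Definition _ := [SubChoice_isSubLmodule of idealAlg by <:].

Implicit Types (x y : idealAlg) (k : R[i]).

Lemma idealAlgP x : ideal_set J (val x).
Proof. exact/ideal_predP/(valP x). Qed.

Definition toIdeal (a : A) (Ja : ideal_set J a) : idealAlg :=
  exist (fun b : A => b \in ideal_pred J) a (introT (ideal_predP J a) Ja).

Fact idealAlg_ler_normD x y : `|val (x + y)| <= `|val x| + `|val y|.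
Proof. by rewrite raddfD ler_normD. Qed.

Fact idealAlg_normrZ k x : `|val (k *: x)| = `|k| * `|val x|.
Proof. by rewrite linearZ normrZ. Qed.

Fact idealAlg_normr0_eq0 x : `|val x| = 0 -> x = 0.
Proof. by move/normr0_eq0 => x0; apply: val_inj; rewrite x0 raddf0. Qed.

HB.instance Definition _ := Lmodule_isNormed.Build R[i] idealAlg
  idealAlg_ler_normD idealAlg_normrZ idealAlg_normr0_eq0.

Fact idealAlg_complete (F : set_system idealAlg) :
  ProperFilter F -> cauchy F -> cvg F.
Proof.
have nrI x : nr x = nr (val x) by [].
apply: rapid_complete => u ru.
have [|l hl] := @rapid_limit R A (val \o u).
  move=> n; rewrite -[X in nr X]/(val (u n.+1) - val (u n)) -raddfB -nrI.
  exact: ru.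
have Jl : ideal_set J l.
  apply: ideal_lim => e e0.
  have [|n hn] := @half_lt R (e / 4); first by rewrite divr_gt0.
  exists (val (u n)); first exact: idealAlgP.
  by have := hl n => /=; lra.
exists (toIdeal Jl) => n; have -> : nr (toIdeal Jl - u n) = nr (l - val (u n)).
  by rewrite nrI raddfB.
by have := hl n; have := half_gt0 R n => /=; lra.
Qed.

HB.instance Definition _ := Uniform_isComplete.Build idealAlg idealAlg_complete.

Definition idealAlg_mul x y : idealAlg :=
  toIdeal (ideal_amull (val x) (idealAlgP y)).

Definition idealAlg_star x : idealAlg := toIdeal (ideal_star (idealAlgP x)).

Fact idealAlg_mulA : associative idealAlg_mul.
Proof. by move=> x y z; apply: val_inj; rewrite /= amulA. Qed.
Fact idealAlg_mulDl : left_distributive idealAlg_mul +%R.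
Proof. by move=> x y z; apply: val_inj; rewrite /= amulDl. Qed.
Fact idealAlg_mulDr : right_distributive idealAlg_mul +%R.
Proof. by move=> x y z; apply: val_inj; rewrite /= amulDr. Qed.
Fact idealAlg_mulZl k x y : idealAlg_mul (k *: x) y = k *: idealAlg_mul x y.
Proof. by apply: val_inj; rewrite /= amulZl. Qed.
Fact idealAlg_mulZr k x y : idealAlg_mul x (k *: y) = k *: idealAlg_mul x y.
Proof. by apply: val_inj; rewrite /= amulZr. Qed.
Fact idealAlg_ler_mul x y : `|idealAlg_mul x y| <= `|x| * `|y|.
Proof. exact: ler_amul. Qed.
Fact idealAlg_starK : involutive idealAlg_star.
Proof. by move=> x; apply: val_inj; rewrite /= starK. Qed.
Fact idealAlg_starD : {morph idealAlg_star : x y / x + y}.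
Proof. by move=> x y; apply: val_inj; rewrite /= starD. Qed.
Fact idealAlg_starZ k x : idealAlg_star (k *: x) = (k^*)%C *: idealAlg_star x.
Proof. by apply: val_inj; rewrite /= starZ. Qed.
Fact idealAlg_starM x y :
  idealAlg_star (idealAlg_mul x y) =
  idealAlg_mul (idealAlg_star y) (idealAlg_star x).
Proof. by apply: val_inj; rewrite /= starM. Qed.
Fact idealAlg_normr_star x : `|idealAlg_mul (idealAlg_star x) x| = `|x| ^+ 2.
Proof. exact: normr_star_amul. Qed.

HB.instance Definition _ :=
  CompleteNormedModule_isCStarAlgebra.Build R idealAlg
    idealAlg_mulA idealAlg_mulDl idealAlg_mulDr idealAlg_mulZl idealAlg_mulZr
    idealAlg_ler_mul idealAlg_starK idealAlg_starD idealAlg_starZ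
    idealAlg_starM idealAlg_normr_star.

End IdealAlgebra.

Section QuotientAlgebra.
Variables (R : realType) (A : cstarAlgType R) (J : closedIdeal A).
Local Notation half := (2^-1 : R).
Local Notation I := (ideal_set J).
Implicit Types (a b : A) (k : R[i]).

Definition quotAlg : Type := Quotient.quot (ideal_pred J).

HB.instance Definition _ := GRing.Zmodule.on quotAlg.

Definition quot_pi : A -> quotAlg := \pi_(Quotient.quot (ideal_pred J))%qT.

Implicit Types (p q r : quotAlg).

Lemma quot_piP a b : I (a - b) <-> quot_pi a = quot_pi b.
Proof.
split=> [/ideal_predP|/eqP].
  by rewrite Quotient.idealrBE => /eqP.
by rewrite -Quotient.idealrBE => /ideal_predP.
Qed.

Lemma quot_pi_repr q : quot_pi (repr q) = q.
Proof. exact: reprK. Qed.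

Lemma quot_piD a b : quot_pi (a + b) = quot_pi a + quot_pi b.
Proof. exact: raddfD. Qed.

Lemma quot_piB a b : quot_pi (a - b) = quot_pi a - quot_pi b.
Proof. exact: raddfB. Qed.

Lemma quot_pi0 : quot_pi 0 = 0.
Proof. exact: raddf0. Qed.

Lemma quot_ind (P : quotAlg -> Prop) : (forall a, P (quot_pi a)) -> forall q, P q.
Proof. by move=> h q; rewrite -(quot_pi_repr q). Qed.

Lemma repr_quot_pi a : I (repr (quot_pi a) - a).
Proof. by apply/quot_piP; rewrite quot_pi_repr. Qed.

Definition quot_scale k q : quotAlg := quot_pi (k *: repr q).
Definition quot_mul p q : quotAlg := quot_pi (repr p ** repr q).
Definition quot_star q : quotAlg := quot_pi (repr q)^†.

Lemma quot_piZ k a : quot_scale k (quot_pi a) = quot_pi (k *: a).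
Proof. by apply/quot_piP; rewrite -scalerBr; apply/idealZ/repr_quot_pi. Qed.

Lemma quot_piM a b : quot_mul (quot_pi a) (quot_pi b) = quot_pi (a ** b).
Proof.
apply/quot_piP; set x := repr _; set y := repr _.
have -> : x ** y - a ** b = (x - a) ** y + a ** (y - b).
  by rewrite amulBl amulBr addrA subrK.
apply: idealD; first by apply: ideal_amulr; exact: repr_quot_pi.
by apply: ideal_amull; exact: repr_quot_pi.
Qed.

Lemma quot_pi_star a : quot_star (quot_pi a) = quot_pi a^†.
Proof. by apply/quot_piP; rewrite -starB; apply/ideal_star/repr_quot_pi. Qed.

Fact quot_scaleA k l q : quot_scale k (quot_scale l q) = quot_scale (k * l) q.
Proof. by elim/quot_ind: q => a; rewrite !quot_piZ scalerA. Qed.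
Fact quot_scale1 : left_id 1 quot_scale.
Proof. by elim/quot_ind => a; rewrite quot_piZ scale1r. Qed.
Fact quot_scaleDr : right_distributive quot_scale +%R.
Proof.
move=> k; elim/quot_ind => a; elim/quot_ind => b.
by rewrite -quot_piD !quot_piZ scalerDr quot_piD.
Qed.
Fact quot_scaleDl q : {morph quot_scale^~ q : k l / k + l}.
Proof. by elim/quot_ind: q => a k l; rewrite !quot_piZ scalerDl quot_piD. Qed.

HB.instance Definition _ := GRing.Zmodule_isLmodule.Build R[i] quotAlg
  quot_scaleA quot_scale1 quot_scaleDr quot_scaleDl.

Definition quot_norm q : R := inf [set nr a | a in [set a | quot_pi a = q]].

Lemma quot_norm_has_inf q : has_inf [set nr a | a in [set a | quot_pi a = q]].
Proof.
split; first by exists (nr (repr q)), (repr q) => //; exact: quot_pi_repr.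
by exists 0 => _ [a _ <-]; exact: nr_ge0.
Qed.

Lemma quot_norm_le a : quot_norm (quot_pi a) <= nr a.
Proof. by apply: ge_inf; [case: (quot_norm_has_inf (quot_pi a))|exists a]. Qed.

Lemma quot_norm_lt q (e : R) : 0 < e ->
  exists2 a, quot_pi a = q & nr a < quot_norm q + e.
Proof.
move=> e0.
by have [_ [a aq <-] ae] := inf_adherent e0 (quot_norm_has_inf q); exists a.
Qed.

Lemma le_quot_norm q (c : R) :
  (forall a, quot_pi a = q -> c <= nr a) -> c <= quot_norm q.
Proof.
move=> h; apply: lb_le_inf; first by case: (quot_norm_has_inf q).
by move=> _ [a aq <-]; exact: h.
Qed.

Lemma quot_norm_ge0 q : 0 <= quot_norm q.
Proof. by apply: le_quot_norm => a _; exact: nr_ge0. Qed.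

Lemma quot_normD p q : quot_norm (p + q) <= quot_norm p + quot_norm q.
Proof.
apply/ler_addgt0Pr => e e0; have e2 : 0 < e / 2 by rewrite divr_gt0.
have [a <- ha] := quot_norm_lt p e2; have [b <- hb] := quot_norm_lt q e2.
by have := quot_norm_le (a + b); have := nrD a b; rewrite quot_piD; lra.
Qed.

Lemma quot_normM p q : quot_norm (quot_mul p q) <= quot_norm p * quot_norm q.
Proof.
apply/ler_addgt0Pr => e e0.
pose P := quot_norm p; pose Q := quot_norm q.
have P0 : 0 <= P := quot_norm_ge0 p; have Q0 : 0 <= Q := quot_norm_ge0 q.
pose d := Num.min 1 (e / (P + Q + 1)).
have d0 : 0 < d by rewrite lt_min ltr01 divr_gt0//; lra.
have d1 : d <= 1 by rewrite ge_min lexx.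
have de : d * (P + Q + 1) <= e.
  by rewrite -ler_pdivlMr ?ge_min ?lexx ?orbT//; lra.
have [a ap ha] := quot_norm_lt p d0; have [b bq hb] := quot_norm_lt q d0.
rewrite -/P in ha; rewrite -/Q in hb; rewrite -{1}ap -{1}bq quot_piM -/P -/Q.
rewrite (le_trans (quot_norm_le _))// (le_trans (nrM _ _))//.
rewrite (@le_trans _ _ ((P + d) * (Q + d)))//.
  by rewrite ler_pM ?nr_ge0 ?(ltW ha) ?(ltW hb).
nra.
Qed.

Lemma quot_normZ_le k q : quot_norm (k *: q) <= complex.Re `|k| * quot_norm q.
Proof.
have [k0|k0] := eqVneq k 0.
  rewrite k0 scale0r normr0 mul0r -quot_pi0.
  by rewrite (le_trans (quot_norm_le _))// nr0.
have K0 : 0 < complex.Re `|k|.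
  by rewrite -ltcR -ge0_ReE// normr_gt0.
rewrite mulrC -ler_pdivrMr//; apply: le_quot_norm => a <-.
rewrite ler_pdivrMr// mulrC -nrZ -[_ *: _]/(quot_scale k _) quot_piZ.
exact: quot_norm_le.
Qed.

Lemma quot_normZ k q : quot_norm (k *: q) = complex.Re `|k| * quot_norm q.
Proof.
apply/eqP; rewrite eq_le quot_normZ_le andTb.
have [->|k0] := eqVneq k 0; first by rewrite normr0 mul0r quot_norm_ge0.
have K0 : 0 < complex.Re `|k| by rewrite -ltcR -ge0_ReE// normr_gt0.
have := quot_normZ_le k^-1 (k *: q); rewrite scalerA mulVf// scale1r.
have -> : complex.Re `|k^-1| = (complex.Re `|k|)^-1.
  by rewrite normfV (@ge0_ReE _ `|k|)// -fmorphV.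
by rewrite ler_pdivlMl.
Qed.

Lemma quot_norm0_eq0 q : quot_norm q = 0 -> q = 0.
Proof.
elim/quot_ind: q => a a0; rewrite -quot_pi0; apply/quot_piP; rewrite subr0.
apply: ideal_lim => e e0.
have [b ba] := quot_norm_lt (quot_pi a) e0; rewrite a0 add0r => be.
exists (a - b); first exact/quot_piP.
by rewrite opprB addrC subrK.
Qed.

Lemma quot_norm_star_mul q : quot_norm (quot_mul (quot_star q) q) = quot_norm q ^+ 2.
Proof.
have star_le r : quot_norm (quot_star r) <= quot_norm r.
  apply: le_quot_norm => a <-; rewrite quot_pi_star -nr_star.
  exact: quot_norm_le.
apply/eqP; rewrite eq_le; apply/andP; split.
  rewrite (le_trans (quot_normM _ _))// expr2 ler_wpM2r// quot_norm_ge0//.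
apply/ler_addgt0Pr => d d0; have d2 : 0 < d / 2 by rewrite divr_gt0.
elim/quot_ind: q => a.
rewrite quot_pi_star quot_piM.
have [b ba hb] := quot_norm_lt (quot_pi (a^† ** a)) d2.
pose x := b - a^† ** a.
have Ix : I x by exact/quot_piP.
have [e [Ie es ec xe]] := almost_unit Ix d2.
have aE : quot_pi (a - a ** e) = quot_pi a.
  apply/quot_piP; rewrite addrAC subrr add0r.
  exact/idealN/ideal_amull.
have na : quot_norm (quot_pi a) <= nr (a - a ** e) by rewrite -{1}aE quot_norm_le.
have ce y : nr (y - y ** e) <= nr y.
  by rewrite -nr_star starB starM es -[leRHS]nr_star; exact: ec.
have : nr (a - a ** e) ^+ 2 <= nr (b - b ** e) + nr (x - x ** e).
  rewrite -nr_star_amul starB starM es.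
  have -> : (a^† - e ** a^†) ** (a - a ** e) =
    (a^† ** a - a^† ** a ** e) - e ** (a^† ** a - a^† ** a ** e).
    by rewrite amulBl !amulBr !amulA.
  rewrite (le_trans (ec _))//.
  have -> : a^† ** a - a^† ** a ** e = (b - b ** e) - (x - x ** e).
    have -> : x - x ** e = (b - b ** e) - (a^† ** a - a^† ** a ** e).
      by rewrite /x amulBl opprD addrACA -opprD.
    by rewrite opprB [RHS]addrC subrK.
  by rewrite (le_trans (nrD _ _))// nrN.
have : quot_norm (quot_pi a) ^+ 2 <= nr (a - a ** e) ^+ 2.
  by rewrite ler_sqr ?nnegrE ?nr_ge0 ?quot_norm_ge0.
have := ce b; lra.
Qed.

Fact quotAlg_ler_normD p q :
  (quot_norm (p + q))%:C%C <= (quot_norm p)%:C%C + (quot_norm q)%:C%C.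
Proof. by rewrite -rmorphD lecR quot_normD. Qed.

Fact quotAlg_normrZ k q : (quot_norm (k *: q))%:C%C = `|k| * (quot_norm q)%:C%C.
Proof. by rewrite quot_normZ rmorphM; congr (_ * _); apply/esym/ge0_ReE. Qed.

Fact quotAlg_normr0_eq0 q : (quot_norm q)%:C%C = 0 -> q = 0.
Proof. by move=> [/quot_norm0_eq0]. Qed.

HB.instance Definition _ := Lmodule_isNormed.Build R[i] quotAlg
  quotAlg_ler_normD quotAlg_normrZ quotAlg_normr0_eq0.

Fact quotAlg_complete (F : set_system quotAlg) :
  ProperFilter F -> cauchy F -> cvg F.
Proof.
have nrQ q : nr q = quot_norm q by [].
apply: rapid_complete => u ru.
have lift (a : A) n : exists b, quot_pi a = u n ->
    quot_pi b = u n.+1 /\ nr (b - a) <= 2 * half ^+ n.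
  have [x xq hx] := quot_norm_lt (u n.+1 - u n) (half_gt0 R n).
  exists (a + x) => au; rewrite quot_piD xq au subrKC; split => //.
  by have := ru n; rewrite nrQ [a + x]addrC addrK; lra.
have [f hf] := choice (fun an : A * nat => lift an.1 an.2).
pose v := fix v n : A := if n is n'.+1 then f (v n', n') else repr (u 0).
have vu n : quot_pi (v n) = u n.
  by elim: n => [|n IH]; [exact: quot_pi_repr|case: (hf (v n, n) IH)].
have rv : rapid (fun n => (2^-1 : R)%:C%C *: v n).
  move=> n; rewrite -scalerBr nrZ ger0_norm ?lecR ?invr_ge0 ?ler0n//=.
  by have [_ /=] := hf (v n, n) (vu n); lra.
have [l hl] := rapid_limit rv.
exists (quot_pi (2 *: l)) => n; rewrite nrQ -vu -quot_piB.
rewrite (le_trans (quot_norm_le _))//.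
have -> : 2 *: l - v n = 2 *: (l - (2^-1 : R)%:C%C *: v n).
  rewrite scalerBr scalerA -(rmorph_nat (real_complex R)) -rmorphM /= mulfV ?pnatr_eq0//.
  by rewrite scale1r.
rewrite nrZ normr_nat -(rmorph_nat (real_complex R)) /=.
by have := hl n; lra.
Qed.

HB.instance Definition _ := Uniform_isComplete.Build quotAlg quotAlg_complete.

Fact quotAlg_mulA : associative quot_mul.
Proof.
elim/quot_ind => a; elim/quot_ind => b; elim/quot_ind => c.
by rewrite !quot_piM amulA.
Qed.
Fact quotAlg_mulDl : left_distributive quot_mul +%R.
Proof.
elim/quot_ind => a; elim/quot_ind => b; elim/quot_ind => c.
by rewrite -quot_piD !quot_piM amulDl quot_piD.
Qed.
Fact quotAlg_mulDr : right_distributive quot_mul +%R.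
Proof.
elim/quot_ind => a; elim/quot_ind => b; elim/quot_ind => c.
by rewrite -quot_piD !quot_piM amulDr quot_piD.
Qed.
Fact quotAlg_mulZl k p q : quot_mul (k *: p) q = k *: quot_mul p q.
Proof.
rewrite -![_ *: _]/(quot_scale _ _).
elim/quot_ind: p => a; elim/quot_ind: q => b.
by rewrite quot_piZ !quot_piM quot_piZ amulZl.
Qed.
Fact quotAlg_mulZr k p q : quot_mul p (k *: q) = k *: quot_mul p q.
Proof.
rewrite -![_ *: _]/(quot_scale _ _).
elim/quot_ind: p => a; elim/quot_ind: q => b.
by rewrite quot_piZ !quot_piM quot_piZ amulZr.
Qed.
Fact quotAlg_ler_mul p q : `|quot_mul p q| <= `|p| * `|q|.
Proof.
rewrite -[`|quot_mul p q|]/((quot_norm _)%:C%C) -[`|p|]/((quot_norm _)%:C%C).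
by rewrite -[`|q|]/((quot_norm _)%:C%C) -rmorphM lecR quot_normM.
Qed.
Fact quotAlg_starK : involutive quot_star.
Proof. by elim/quot_ind => a; rewrite !quot_pi_star starK. Qed.
Fact quotAlg_starD : {morph quot_star : p q / p + q}.
Proof.
elim/quot_ind => a; elim/quot_ind => b.
by rewrite -quot_piD !quot_pi_star starD quot_piD.
Qed.
Fact quotAlg_starZ k q : quot_star (k *: q) = (k^*)%C *: quot_star q.
Proof.
rewrite -![_ *: _]/(quot_scale _ _).
by elim/quot_ind: q => a; rewrite quot_piZ !quot_pi_star quot_piZ starZ.
Qed.
Fact quotAlg_starM p q :
  quot_star (quot_mul p q) = quot_mul (quot_star q) (quot_star p).
Proof.
elim/quot_ind: p => a; elim/quot_ind: q => b.
by rewrite !(quot_pi_star, quot_piM) starM.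
Qed.
Fact quotAlg_normr_star q : `|quot_mul (quot_star q) q| = `|q| ^+ 2.
Proof.
rewrite -[LHS]/((quot_norm _)%:C%C) -[`|q|]/((quot_norm _)%:C%C).
by rewrite quot_norm_star_mul rmorphXn.
Qed.

HB.instance Definition _ :=
  CompleteNormedModule_isCStarAlgebra.Build R quotAlg
    quotAlg_mulA quotAlg_mulDl quotAlg_mulDr quotAlg_mulZl quotAlg_mulZr
    quotAlg_ler_mul quotAlg_starK quotAlg_starD quotAlg_starZ
    quotAlg_starM quotAlg_normr_star.

End QuotientAlgebra.

Section ApproximatelyFiniteDimensional.
Variables (R : realType) (A : cstarAlgType R).

Record cstar_subalgebra (B : set A) : Prop := CStarSubalgebra {
  subalg0 : B 0;
  subalgD : forall x y, B x -> B y -> B (x + y);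
  subalgZ : forall (k : R[i]) x, B x -> B (k *: x);
  subalgM : forall x y, B x -> B y -> B (x ** y);
  subalg_star : forall x, B x -> B x^†;
  subalg_closed : closed B
}.

Definition finite_dim (B : set A) : Prop :=
  exists (n : nat) (b : 'I_n -> A),
    B = [set x | exists c : 'I_n -> R[i], x = \sum_(i < n) c i *: b i].

(* The empty family is excluded by the density requirement. *)
Definition AF : Prop :=
  exists D : set (set A),
    [/\ forall B, D B -> cstar_subalgebra B /\ finite_dim B,
        forall B1 B2, D B1 -> D B2 ->
          exists B3, [/\ D B3, B1 `<=` B3 & B2 `<=` B3]
      & dense (\bigcup_(B in D) B)].

Definition LF : Prop :=
  forall (F : set A) (eps : R), finite_set F -> 0 < eps ->
    exists B : set A, [/\ cstar_subalgebra B, finite_dim B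
      & forall f, F f -> exists2 b, B b & `|f - b| < eps%:C%C].

End ApproximatelyFiniteDimensional.

(* Main.v *)
(* Extensions of LF algebras by LF algebras. By induction on the dimension, the
   preimage in A of every finite-dimensional *-subalgebra C of A / I is LF. Split
   off from C a full matrix block, with minimal projection e and matrix units
   x_i x_j^*, and let J be the preimage of the complementary summand, which is LF
   by induction. A projection lifts modulo an LF ideal: the obstruction is the
   logarithm of a unitary in 1 + J, and such a unitary is close to one in a
   finite-dimensional algebra, where square roots exist. The x_i then lift to exact
   partial isometries after removing from e a projection of J, and the lifted block
   is glued to a finite-dimensional subalgebra of a corner of J.

   A non-AF extension of AF algebras. Let K1 be uncountable and K2 of larger
   cardinality than K1, and let v, w_n be projections of M_2(C) with v w_n <> 0 and
   v w_n --> 0. Take the functions on K1 * K2 * nat with values in M_2(C) that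
   differ from l(a) v + m(b) w_n by a function vanishing at infinity, where l and m
   vanish at infinity; the ideal is l = m = 0. Were this algebra AF, finite-dimensional
   subalgebras would contain elements f_a and g_b with l the indicator of a and m
   the indicator of b; by directedness f_a g_b would lie in a finite-dimensional
   subalgebra of the ideal, hence have finite support. But f_a g_b is close to
   v w_n at (a, b, n) unless b lies in a finite set depending on a, n or a in a
   finite set depending on b, n, and by cardinality some pair (a, b) avoids all of
   these. *)

(* Only finite-dimensional subalgebras have a functional calculus here; elsewhere inverses and polar
   parts come from Neumann series, a Cayley transform and Newton's iteration. The sign function that
   would lift a projection is discontinuous, so it has to be evaluated inside a finite-dimensional
   subalgebra of the ideal and compared with elements outside it. For this reason the constructions
   by limits also state which closed sets contain their output.

   All ideals and intermediate algebras of an extension are subsets of one unital algebra, the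
   unitization, so that 1 - p always makes sense and no quotient is formed during the induction.

   The counterexample must be nonseparable, as separable LF algebras are AF. That v w_n tends to 0
   makes the cross terms l(a) m(b) v w_n vanish at infinity, so that the functions form an algebra;
   that v w_n is nonzero separates f_a g_b from 0. As |v w_n| is not bounded below, closeness up to
   a fraction of it leaves a finite exceptional set for each n only, not for all n at once. *)
From HB Require Import structures.
From mathcomp Require Import all_boot all_order all_algebra.
From mathcomp Require Import all_classical all_reals topology normedtype.
From mathcomp Require Import complex ring lra.
Require Import Defs.

Set Implicit Arguments.
Unset Strict Implicit.
Unset Printing Implicit Defensive.

Import Order.TTheory GRing.Theory Num.Theory.
Import numFieldNormedType.Exports.

Local Open Scope classical_set_scope.
Local Open Scope ring_scope.

(** * Normalisation in noncommutative algebras *)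

Section NoncommutativeRing.
Variables (K : comNzRingType) (A : algType K).

(** Syntax for a decision procedure by reflection. In a normal form, a word is a list of indices
    into [env] and carries a scalar coefficient. *)
Inductive ncexp :=
  | NVar of nat | NZero | NOne | NAdd of ncexp & ncexp | NOpp of ncexp
  | NMul of ncexp & ncexp | NScale of K & ncexp | NMuln of ncexp & nat
  | NExp of ncexp & nat.

Variable env : seq A.

Fixpoint nceval (e : ncexp) : A :=
  match e with
  | NVar n => nth 0 env n
  | NZero => 0
  | NOne => 1
  | NAdd a b => nceval a + nceval b
  | NOpp a => - nceval a
  | NMul a b => nceval a * nceval b
  | NScale k a => k *: nceval a
  | NMuln a n => nceval a *+ n
  | NExp a n => nceval a ^+ n
  end.

Definition ncmono (m : seq nat) : A := foldr (fun n x => nth 0 env n * x) 1 m.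
Definition ncsum (p : seq (K * seq nat)) : A :=
  foldr (fun t x => t.1 *: ncmono t.2 + x) 0 p.

Fixpoint ncins (k : K) (m : seq nat) (p : seq (K * seq nat)) :=
  match p with
  | [::] => [:: (k, m)]
  | (l, m') :: q => if eqseq m m' then (l + k, m') :: q else (l, m') :: ncins k m q
  end.
Definition ncaddp p q := foldr (fun t r => ncins t.1 t.2 r) q p.
Definition ncscalep (k : K) (p : seq (K * seq nat)) :=
  map (fun t => (k * t.1, t.2)) p.
Definition ncmulp (p q : seq (K * seq nat)) :=
  foldr (fun t r => ncaddp (map (fun u => (t.1 * u.1, t.2 ++ u.2)) q) r) [::] p.
Fixpoint ncexpp (p : seq (K * seq nat)) n :=
  if n is n'.+1 then ncmulp p (ncexpp p n') else [:: (1, [::])].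

Fixpoint ncnorm (e : ncexp) : seq (K * seq nat) :=
  match e with
  | NVar n => [:: (1, [:: n])]
  | NZero => [::]
  | NOne => [:: (1, [::])]
  | NAdd a b => ncaddp (ncnorm a) (ncnorm b)
  | NOpp a => ncscalep (-1) (ncnorm a)
  | NMul a b => ncmulp (ncnorm a) (ncnorm b)
  | NScale k a => ncscalep k (ncnorm a)
  | NMuln a n => ncscalep n%:R (ncnorm a)
  | NExp a n => ncexpp (ncnorm a) n
  end.

Lemma ncins_sum k m p : ncsum (ncins k m p) = k *: ncmono m + ncsum p.
Proof.
elim: p => [|[l m'] q IH] //=; case: ifP => [/(@eqP (seq nat)) ->|_] /=.
  by rewrite scalerDl addrAC addrC.
by rewrite IH addrCA.
Qed.

Lemma ncaddp_sum p q : ncsum (ncaddp p q) = ncsum p + ncsum q.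
Proof. by elim: p => [|t p IH] /=; rewrite ?add0r// ncins_sum IH addrA. Qed.

Lemma ncscalep_sum k p : ncsum (ncscalep k p) = k *: ncsum p.
Proof.
elim: p => [|t p IH] /=; first by rewrite scaler0.
by rewrite -/(ncscalep k p) IH scalerDr scalerA.
Qed.

Lemma ncmono_cat m n : ncmono (m ++ n) = ncmono m * ncmono n.
Proof. by elim: m => [|i m IH] /=; rewrite ?mul1r// IH mulrA. Qed.

Lemma ncmulp_sum p q : ncsum (ncmulp p q) = ncsum p * ncsum q.
Proof.
elim: p => [|t p IH] /=; first by rewrite mul0r.
rewrite ncaddp_sum IH mulrDl; congr (_ + _).
elim: q {IH} => [|u q IH] /=; first by rewrite mulr0.
rewrite IH mulrDr; congr (_ + _).
by rewrite -scalerAl -scalerAr scalerA ncmono_cat.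
Qed.

Lemma ncnorm_sum e : ncsum (ncnorm e) = nceval e.
Proof.
elim: e => /=.
- by move=> n; rewrite addr0 scale1r mulr1.
- by [].
- by rewrite addr0 scale1r.
- by move=> a <- b <-; rewrite ncaddp_sum.
- by move=> a <-; rewrite ncscalep_sum scaleN1r.
- by move=> a <- b <-; rewrite ncmulp_sum.
- by move=> k a <-; rewrite ncscalep_sum.
- by move=> a <- n; rewrite ncscalep_sum scaler_nat.
- move=> a <- n; elim: n => [|n IH] /=; first by rewrite addr0 scale1r expr0.
  by rewrite ncmulp_sum IH exprS.
Qed.

Fixpoint nczero (p : seq (K * seq nat)) : Prop :=
  if p is t :: q then t.1 = 0 /\ nczero q else True.

(** The difference is normalised: an identity between noncommutative polynomials becomes the
    vanishing of the collected coefficients, which commute and are left to [ring] or [field]. *)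
Lemma ncring_correct e f : nczero (ncnorm (NAdd e (NOpp f))) -> nceval e = nceval f.
Proof.
move=> h; apply/eqP; rewrite -subr_eq0; apply/eqP.
rewrite -[LHS]/(nceval (NAdd e (NOpp f))) -ncnorm_sum.
by elim: (ncnorm _) h => [|t p IH] //= [-> /IH ->]; rewrite scale0r addr0.
Qed.

End NoncommutativeRing.

Ltac nc_mem x l :=
  lazymatch l with
  | nil => constr:(false)
  | cons x _ => constr:(true)
  | cons _ ?l' => nc_mem x l'
  end.
Ltac nc_index x l :=
  lazymatch l with
  | cons x _ => constr:(O)
  | cons _ ?l' => let n := nc_index x l' in constr:(S n)
  end.
Ltac nc_vars t l :=
  lazymatch t with
  | @GRing.zero _ => l
  | @GRing.one _ => l
  | @GRing.add _ ?a ?b => let l1 := nc_vars a l in nc_vars b l1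
  | @GRing.opp _ ?a => nc_vars a l
  | @GRing.mul _ ?a ?b => let l1 := nc_vars a l in nc_vars b l1
  | @GRing.scale _ _ ?k ?a => nc_vars a l
  | @GRing.natmul _ ?a ?n => nc_vars a l
  | @GRing.exp _ ?a ?n => nc_vars a l
  | _ => let m := nc_mem t l in
         lazymatch m with true => l | false => constr:(cons t l) end
  end.
Ltac nc_reify K t l :=
  lazymatch t with
  | @GRing.zero _ => constr:(@NZero K)
  | @GRing.one _ => constr:(@NOne K)
  | @GRing.add _ ?a ?b => let x := nc_reify K a l in let y := nc_reify K b l in
      constr:(NAdd x y)
  | @GRing.opp _ ?a => let x := nc_reify K a l in constr:(NOpp x)
  | @GRing.mul _ ?a ?b => let x := nc_reify K a l in let y := nc_reify K b l in
      constr:(NMul x y)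
  | @GRing.scale _ _ ?k ?a => let x := nc_reify K a l in constr:(@NScale K k x)
  | @GRing.natmul _ ?a ?n => let x := nc_reify K a l in constr:(NMuln x n)
  | @GRing.exp _ ?a ?n => let x := nc_reify K a l in constr:(NExp x n)
  | _ => let n := nc_index t l in constr:(@NVar K n)
  end.

Ltac ncring0 K A :=
  lazymatch goal with
  | |- @eq ?T ?a ?b =>
    let l0 := nc_vars a (@nil T) in
    let l := nc_vars b l0 in
    let x := nc_reify K a l in
    let y := nc_reify K b l in
    refine (@ncring_correct K A l x y _);
    cbv [ncnorm ncaddp ncscalep ncmulp ncexpp ncins nczero foldr map cat eqseq
         eqn eq_op fst snd andb];
    repeat split
  end.

(* The norm is real-valued and completeness is stated for rapidly converging
   sequences only, so that no topology is carried along. *)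
HB.mixin Record Algebra_isUCStar (R : realType) A & GRing.Algebra R[i] A := {
  adj : A -> A;
  un : A -> R;
  un0_eq0 : forall x, un x = 0 -> x = 0;
  unD : forall x y, un (x + y) <= un x + un y;
  unZ : forall (k : R[i]) x, un (k *: x) = complex.Re `|k| * un x;
  unM : forall x y, un (x * y) <= un x * un y;
  adjK : involutive adj;
  adjD : {morph adj : x y / x + y};
  adjZ : forall (k : R[i]) x, adj (k *: x) = (k^*)%C *: adj x;
  adjM : forall x y, adj (x * y) = adj y * adj x;
  un_adjM : forall x, un (adj x * x) = un x ^+ 2;
  un_complete : forall u : nat -> A,
    (forall n, un (u n.+1 - u n) <= 2^-1 ^+ n) ->
    exists l, forall n, un (l - u n) <= 16 * 2^-1 ^+ n
}.

#[short(type="ucstarAlgType")]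
HB.structure Definition UCStar (R : realType) :=
  {A of GRing.Algebra R[i] A & Algebra_isUCStar R A}.

Ltac nc_scalar := first [ring | by field; rewrite ?pnatr_eq0].
Ltac ncring :=
  lazymatch goal with
  | |- @eq ?T _ _ =>
    let R := open_constr:(_ : realType) in
    let A := open_constr:(_ : ucstarAlgType R) in
    unify T (@UCStar.sort R A);
    ncring0 (R[i] : comNzRingType) (A : algType R[i]); nc_scalar
  end.

(** * Finite-dimensional subalgebras *)

Section LinearSpan.
Variables (K : fieldType) (V : lmodType K).
Implicit Types (S : set V) (x y : V).

Record linset S : Prop := Linset {
  lin0 : S 0;
  linD : forall x y, S x -> S y -> S (x + y);
  linZ : forall k x, S x -> S (k *: x) }.

Lemma linN S x : linset S -> S x -> S (- x).
Proof. by move=> lS Sx; rewrite -scaleN1r; exact: linZ. Qed.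

Lemma linB S x y : linset S -> S x -> S y -> S (x - y).
Proof. by move=> lS Sx Sy; apply: linD => //; exact: linN. Qed.

Lemma lin_sum S (I : Type) (r : seq I) (P : pred I) (F : I -> V) :
  linset S -> (forall i, P i -> S (F i)) -> S (\sum_(i <- r | P i) F i).
Proof. by move=> lS SF; apply: big_ind => //; [exact: lin0|exact: linD]. Qed.

Definition span n (b : 'I_n -> V) : set V :=
  [set x | exists c : 'I_n -> K, x = \sum_(i < n) c i *: b i].

Definition indep n (b : 'I_n -> V) : Prop :=
  forall c : 'I_n -> K, \sum_(i < n) c i *: b i = 0 -> forall i, c i = 0.

(** A bound on independent families instead of a chosen basis: it passes to subsets at once and
    makes sense for sets not yet known to be spans. *)
Definition dimle n S : Prop :=
  forall m (b : 'I_m -> V), (forall i, S (b i)) -> indep b -> (m <= n)%N.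

Lemma span_linset n (b : 'I_n -> V) : linset (span b).
Proof.
split.
- by exists (fun=> 0); rewrite big1// => i _; rewrite scale0r.
- move=> _ _ [c ->] [d ->]; exists (fun i => c i + d i).
  by rewrite -big_split; apply: eq_bigr => i _; rewrite scalerDl.
- move=> k _ [c ->]; exists (fun i => k * c i).
  by rewrite scaler_sumr; apply: eq_bigr => i _; rewrite scalerA.
Qed.

Lemma span_mem n (b : 'I_n -> V) i : span b (b i).
Proof.
exists (fun j => (j == i)%:R); rewrite (bigD1 i)//= eqxx scale1r big1 ?addr0//.
by move=> j /negPf ->; rewrite scale0r.
Qed.

Lemma span_sub n (b : 'I_n -> V) S :
  linset S -> (forall i, S (b i)) -> span b `<=` S.
Proof.
by move=> lS Sb _ [c ->]; apply: lin_sum => // i _; apply: linZ.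
Qed.

(** If m > n, the m by n matrix of coefficients has a nonzero left kernel vector, which is a linear
    relation between the m vectors. *)
Lemma span_dimle n (b : 'I_n -> V) : dimle n (span b).
Proof.
move=> m b' /choice[C hC] ib'; rewrite leqNgt; apply/negP => nm.
pose M := \matrix_(i < m, j < n) C i j.
have : kermx M != 0.
  rewrite -mxrank_eq0 mxrank_ker subn_eq0 -ltnNge.
  exact: leq_ltn_trans (rank_leq_col M) nm.
case/rowV0Pn => v /sub_kermxP vM /negP; apply; apply/eqP/rowP => i.
rewrite mxE; apply: (ib' (fun i => v 0 i)) i => //=.
under eq_bigr do rewrite hC scaler_sumr.
rewrite exchange_big big1// => j _.
under eq_bigr do rewrite scalerA.
rewrite -scaler_suml; move/rowP: vM => /(_ j); rewrite !mxE.
by under eq_bigr do rewrite mxE; move=> ->; rewrite scale0r.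
Qed.

Definition consf n x (b : 'I_n -> V) (i : 'I_n.+1) : V :=
  if unlift ord0 i is Some j then b j else x.

Lemma sum_consf n x (b : 'I_n -> V) (c : 'I_n.+1 -> K) :
  \sum_(i < n.+1) c i *: consf x b i =
  c ord0 *: x + \sum_(i < n) c (lift ord0 i) *: b i.
Proof.
rewrite big_ord_recl /consf unlift_none; congr (_ + _).
by apply: eq_bigr => i _; rewrite liftK.
Qed.

Lemma consf_ind n x (b : 'I_n -> V) (P : V -> Prop) :
  P x -> (forall i, P (b i)) -> forall i, P (consf x b i).
Proof. by move=> Px Pb i; rewrite /consf; case: unliftP. Qed.

Lemma span_consf n x (b : 'I_n -> V) y :
  span (consf x b) y <-> exists k, span b (y - k *: x).
Proof.
split=> [[c ->]|[k [c yE]]].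
  exists (c ord0), (fun i => c (lift ord0 i)).
  by rewrite sum_consf addrAC subrr add0r.
exists (fun i => if unlift ord0 i is Some j then c j else k).
rewrite sum_consf unlift_none -[y](subrK (k *: x)) yE addrC; congr (_ + _).
by apply: eq_bigr => i _; rewrite liftK.
Qed.

Lemma indep_consf n x (b : 'I_n -> V) :
  indep b -> ~ span b x -> indep (consf x b).
Proof.
move=> ib nx c; rewrite sum_consf => c0.
have k0 : c ord0 = 0.
  apply/eqP; apply/negP => /negP k0; apply: nx.
  have -> : x = - (c ord0)^-1 *: \sum_(i < n) c (lift ord0 i) *: b i.
    have -> : \sum_(i < n) c (lift ord0 i) *: b i = - (c ord0 *: x).
      by apply/eqP; rewrite -addr_eq0 addrC c0.
    by rewrite scalerN scaleNr opprK scalerA mulVf// scale1r.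
  apply: (linZ (span_linset b)).
  by exists (fun i => c (lift ord0 i)).
move: c0; rewrite k0 scale0r add0r => /ib c0 i.
by case: (unliftP ord0 i) => [j ->|->].
Qed.

Lemma dimle_span n S : linset S -> dimle n S ->
  exists m (b : 'I_m -> V), indep b /\ S = span b.
Proof.
move=> lS dS.
pose P m := `[< exists b : 'I_m -> V, (forall i, S (b i)) /\ indep b >].
have exP : exists m, P m.
  exists 0%N; apply/asboolP; exists (fun=> 0); split=> [i|c _ []//].
  exact: lin0.
have Pn m : P m -> (m <= n)%N by move=> /asboolP[b [Sb ib]]; exact: (dS _ b).
case: (ex_maxnP exP Pn) => m /asboolP[b [Sb ib]] mm.
exists m, b; split=> //; apply/seteqP; split; last exact: span_sub.
move=> x Sx; apply: contrapT => nx.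
have : P m.+1.
  apply/asboolP; exists (consf x b); split; last exact: indep_consf.
  exact: consf_ind.
by move=> /mm; rewrite ltnn.
Qed.

Lemma dimle0 S x : dimle 0 S -> S x -> x = 0.
Proof.
move=> d0 Sx; apply: contrapT => x0.
have : (1 <= 0)%N by apply: (d0 _ (fun=> x)) => // c; rewrite big_ord1 => /eqP;
  rewrite scaler_eq0 => /orP[/eqP c0 i|/eqP//]; rewrite ord1.
by [].
Qed.

(** An independent family of S' stays independent when x is added. This drop of the bound drives the
    inductions for units, minimal projections and the splitting of blocks. *)
Lemma dimle_proper n S S' x : linset S' -> S' `<=` S -> S x -> ~ S' x ->
  dimle n.+1 S -> dimle n S'.
Proof.
move=> lS' sS Sx nx dS m b S'b ib.
rewrite -ltnS; apply: (dS _ (consf x b)).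
  by apply: consf_ind => // i; exact: sS.
by apply: indep_consf => // bx; apply: nx; exact: span_sub bx.
Qed.

Lemma dimle_sub n S S' : S' `<=` S -> dimle n S -> dimle n S'.
Proof. by move=> sS dS m b S'b; apply: dS => i; exact: sS. Qed.

End LinearSpan.

(** * Norm, adjoint and projections in a unital C*-algebra *)

Section UCBasics.
Variables (R : realType) (A : ucstarAlgType R).
Implicit Types (a b x y z p : A) (k : R[i]) (P Q : set A).
Local Notation half := (2^-1 : R).

Lemma un0 : un (0 : A) = 0.
Proof. by rewrite -(scale0r (0 : A)) unZ normr0 mul0r. Qed.

Lemma unN x : un (- x) = un x.
Proof. by rewrite -scaleN1r unZ normrN1 /= mul1r. Qed.

Lemma un_ge0 x : 0 <= un x.
Proof. by have := unD x (- x); rewrite subrr un0 unN; lra. Qed.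

Lemma unB x y : un (x - y) <= un x + un y.
Proof. by rewrite -(unN y) unD. Qed.

Lemma unBC x y : un (x - y) = un (y - x).
Proof. by rewrite -unN opprB. Qed.

Lemma un_tri y x z : un (x - z) <= un (x - y) + un (y - z).
Proof. by rewrite (le_trans _ (unD _ _))// addrA subrK. Qed.

Lemma un_triB x y : un x <= un y + un (x - y).
Proof. by rewrite (le_trans _ (unD _ _))// addrC subrK. Qed.

Lemma unZR (k : R) x : 0 <= k -> un (k%:C%C *: x) = k * un x.
Proof. by move=> k0; rewrite unZ ger0_norm// lecR. Qed.

Lemma Re_norm_ge0 k : 0 <= complex.Re `|k|.
Proof. by rewrite -lecR -ge0_ReE normr_ge0. Qed.

Lemma Re_normM k l : complex.Re `|k * l| = complex.Re `|k| * complex.Re `|l|.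
Proof.
have E (z : R[i]) : `|z| = (complex.Re `|z|)%:C%C by apply: ge0_ReE; exact: normr_ge0.
apply: complexI; rewrite -E normrM E [in X in _ * X]E.
by rewrite -(rmorphM (real_complex R)).
Qed.

Lemma adj0 : adj 0 = 0 :> A.
Proof. by rewrite -(scale0r (0 : A)) adjZ rmorph0 !scale0r. Qed.
Lemma adjN x : adj (- x) = - adj x.
Proof. by rewrite -(scaleN1r x) -(scaleN1r (adj x)) adjZ rmorphN1. Qed.
Lemma adjB x y : adj (x - y) = adj x - adj y.
Proof. by rewrite adjD adjN. Qed.
Lemma adj1 : adj 1 = 1 :> A.
Proof. by rewrite -[LHS]mulr1 -{2}(adjK 1) -adjM mulr1 adjK. Qed.
Lemma adjZR (k : R) x : adj (k%:C%C *: x) = k%:C%C *: adj x.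
Proof. by rewrite adjZ /= oppr0. Qed.
Lemma adjZn (n : nat) x : adj (n%:R *: x) = n%:R *: adj x.
Proof. by rewrite -(rmorph_nat (real_complex R)) adjZR. Qed.
Lemma adjX x n : adj (x ^+ n) = adj x ^+ n.
Proof. by elim: n => [|n IH]; [exact: adj1|rewrite exprS exprSr adjM IH]. Qed.
Lemma adj_sum (I : Type) (r : seq I) (P : pred I) (F : I -> A) :
  adj (\sum_(i <- r | P i) F i) = \sum_(i <- r | P i) adj (F i).
Proof. by apply: (big_morph adj adjD adj0). Qed.

Lemma un_adj x : un (adj x) = un x.
Proof.
have le (b : A) : un b <= un (adj b).
  have := unM (adj b) b; rewrite un_adjM expr2.
  have := un_ge0 b; rewrite le0r => /orP[/eqP -> _|b0]; first exact: un_ge0.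
  by rewrite ler_pM2r.
by apply/eqP; rewrite eq_le (le x) andbT -{2}(adjK x) le.
Qed.

Lemma un1 : un (1 : A) = 1.
Proof.
have := un_adjM (1 : A); rewrite adj1 mulr1 expr2 => e.
have n0 : un (1 : A) != 0.
  by apply/eqP => /un0_eq0/eqP; rewrite oner_eq0.
by apply: (mulfI n0); rewrite mulr1.
Qed.

Lemma un_sum (I : Type) (r : seq I) (P : pred I) (F : I -> A) :
  un (\sum_(i <- r | P i) F i) <= \sum_(i <- r | P i) un (F i).
Proof.
elim/big_ind2: _ => [|x a y b xa yb|//]; first by rewrite un0.
by rewrite (le_trans (unD _ _))// lerD.
Qed.

Lemma unM_le x y (a b : R) : un x <= a -> un y <= b -> un (x * y) <= a * b.
Proof. by move=> xa yb; rewrite (le_trans (unM _ _))// ler_pM// un_ge0. Qed.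

Lemma le0_un x : un x <= 0 -> x = 0.
Proof. by move=> x0; apply: un0_eq0; apply/eqP; rewrite eq_le x0 un_ge0. Qed.

Definition isproj p := adj p = p /\ p * p = p.

Lemma isproj_le1 p : isproj p -> un p <= 1.
Proof.
move=> [ps pp]; have := un_adjM p; rewrite ps pp expr2.
have := un_ge0 p; rewrite le0r => /orP[/eqP -> _|p0]; first exact: ler01.
by move=> e; have -> : un p = 1 by apply: (mulfI (lt0r_neq0 p0)); rewrite mulr1 -e.
Qed.

Lemma isproj_ge1 p : isproj p -> p <> 0 -> 1 <= un p.
Proof.
move=> [ps pp] p0; have := un_adjM p; rewrite ps pp expr2.
have : 0 < un p.
  by rewrite lt0r un_ge0 andbT; apply/eqP => /un0_eq0.
by move=> p1 e; have -> : un p = 1 by apply: (mulfI (lt0r_neq0 p1)); rewrite mulr1 -e.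
Qed.

Lemma isprojC p : isproj p -> isproj (1 - p).
Proof.
move=> [ps pp]; split; first by rewrite adjB adj1 ps.
by rewrite mulrBl mul1r mulrBr mulr1 pp subrr subr0.
Qed.

Lemma isprojM p e : isproj p -> isproj e -> p * e = e -> isproj (p - e).
Proof.
move=> [ps pp] [es ee] pe; have ep : e * p = e by rewrite -es -ps -adjM pe es.
split; first by rewrite adjB ps es.
by rewrite mulrBl !mulrBr pp pe ep ee subrr subr0.
Qed.

Lemma isproj_adjl p x : isproj p -> p * x = x -> adj x * p = adj x.
Proof. by move=> [ps _] px; rewrite -{1}ps -adjM px. Qed.

Lemma isproj_adjr p x : isproj p -> x * p = x -> p * adj x = adj x.
Proof. by move=> [ps _] px; rewrite -{1}ps -adjM px. Qed.

Lemma un_normal_sq x : adj x * x = x * adj x -> un (x * x) = un x ^+ 2.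
Proof.
move=> nx; apply/eqP; rewrite -(@eqrXn2 _ 2) ?un_ge0 ?exprn_ge0 ?un_ge0//.
have e : adj (x * x) * (x * x) = adj (adj x * x) * (adj x * x).
  rewrite !adjM adjK -!mulrA; congr (_ * _).
  by rewrite [RHS]mulrA -nx !mulrA nx.
by rewrite -(un_adjM (x * x)) e !un_adjM.
Qed.

(** Replaces the spectral radius formula: it makes normal nilpotents vanish and removes
    multiplicative constants from norm bounds. *)
Lemma un_normal_pow2 x (k : nat) : adj x * x = x * adj x ->
  un (x ^+ (2 ^ k)%N) = un x ^+ (2 ^ k)%N.
Proof.
move=> nx; elim: k => [|k IH]; first by rewrite !expr1.
rewrite expnS mulnC !exprM -IH [in LHS]expr2 un_normal_sq//.
have cx : GRing.comm (adj x) x by [].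
by rewrite adjX; apply: commrX; apply/commr_sym/commrX/commr_sym.
Qed.

Lemma normal_nilp x n : adj x * x = x * adj x -> x ^+ n = 0 -> x = 0.
Proof.
move=> nx xn; have := un_normal_pow2 n nx.
have -> : x ^+ (2 ^ n)%N = 0.
  have n2 : (n <= 2 ^ n)%N by rewrite ltnW// ltn_expl.
  by rewrite -(subnK n2) exprD xn mulr0.
by rewrite un0 => /esym/eqP; rewrite expf_eq0 => /andP[_ /eqP /un0_eq0].
Qed.

Definition uclosed P : Prop :=
  forall x, (forall e : R, 0 < e -> exists2 y, P y & un (x - y) < e) -> P x.

Lemma uclosedI P Q : uclosed P -> uclosed Q -> uclosed (P `&` Q).
Proof.
move=> cP cQ x h; split; [apply: cP|apply: cQ] => e /h[y [? ?] ?]; by exists y.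
Qed.

Lemma uclosed_shift P a : uclosed P -> uclosed [set z | P (z - a)].
Proof.
move=> cP x h; apply: cP => e /h[y Py xy]; exists (y - a) => //.
by rewrite opprB addrA subrK.
Qed.

Lemma uclosed_eq (f g : A -> A) (c : R) :
  (forall x y, un (f x - g x - (f y - g y)) <= c * un (x - y)) ->
  uclosed [set z | f z = g z].
Proof.
move=> hc x h; apply/eqP; rewrite -subr_eq0; apply/eqP.
apply: le0_un; apply/ler_addgt0Pr => e e0.
have c0 : 0 < `|c| + 1 by rewrite ltr_wpDl.
have [|y /= fg xy] := h (e / (`|c| + 1)); first by rewrite divr_gt0.
have := hc x y; rewrite fg subrr subr0 add0r => /le_trans; apply.
move: xy; rewrite ltr_pdivlMr//; have := un_ge0 (x - y); have := ler_norm c.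
nra.
Qed.

Lemma uclosed_mull a b : uclosed [set z : A | a * z = b * z].
Proof.
apply: (@uclosed_eq _ _ (un (a - b))) => x y.
by rewrite -!mulrBl -mulrBr unM.
Qed.

Lemma uclosed_mulr a b : uclosed [set z : A | z * a = z * b].
Proof.
apply: (@uclosed_eq _ _ (un (a - b))) => x y.
by rewrite -!mulrBr -mulrBl mulrC unM.
Qed.

Lemma uclosed_adj : uclosed [set z : A | adj z = z].
Proof.
apply: (@uclosed_eq _ _ 2) => x y.
have -> : adj x - x - (adj y - y) = adj (x - y) - (x - y).
  by rewrite adjB; ncring.
by rewrite (le_trans (unB _ _))// un_adj; lra.
Qed.

Lemma half_limit (x c : R) : (forall n, x <= c + 16 * half ^+ n) -> x <= c.
Proof.
move=> h; apply/ler_addgt0Pr => e e0.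
have [|n hn] := @half_lt R (e / 16); first by rewrite divr_gt0.
by have := h n; lra.
Qed.

End UCBasics.

(** * Polar decomposition of almost partial isometries *)

Section Newton.
Variables (R : realType) (A : ucstarAlgType R).
Implicit Types (x y z E : A) (P : set A).
Local Notation half := (2^-1 : R).

(* Newton's iteration for the polar decomposition. *)
Definition nstep z : A := half%:C%C *: (z *+ 3 - z * adj z * z).

Lemma nstep_adj z : adj z = z -> adj (nstep z) = nstep z.
Proof.
move=> zs; rewrite adjZR; congr (_ *: _).
rewrite adjB !adjM !zs mulrA; congr (_ - _).
by rewrite -[z *+ 3]scaler_nat adjZn zs.
Qed.

(** The error c = adj u * u - E of an iterate u becomes - 3/4 c^2 + 1/4 c^3 at the next one, so it
    at least halves as long as |c| <= 1/2. The last conclusion stands in for a functional calculus: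
    it locates the polar part x in every closed set that contains y and is stable under [nstep]. *)
Lemma newton y E : isproj E -> y * E = y -> un (adj y * y - E) <= half ->
  exists x, [/\ adj x * x = E, un (x - y) <= 2 * un (adj y * y - E) &
    forall P, uclosed P -> P y -> (forall z, P z -> P (nstep z)) -> P x].
Proof.
move=> pE yE y2; have [Es EE] := pE.
pose u n := iter n nstep y.
pose c n := adj (u n) * u n - E.
have uS n : u n.+1 = nstep (u n) by [].
have uE n : u n * E = u n.
  elim: n => [|n IH] //; rewrite uS /nstep -scalerAl; congr (_ *: _).
  by rewrite mulrBl mulrnAl -(mulrA _ (u n) E) !IH.
have cE n : c n * E = c n by rewrite mulrBl -mulrA uE EE.
have Ec n : E * c n = c n by rewrite mulrBr mulrA -{1}Es -adjM uE EE.
have uc n : u n.+1 - u n = - (half%:C%C *: (u n * c n)).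
  rewrite uS /nstep mulrBr uE mulrA.
  ncring.
have cs n : c n.+1 = - ((3 / 4 : R)%:C%C *: (c n * c n)) +
    (1 / 4 : R)%:C%C *: (c n * c n * c n).
  have e1 : u n.+1 = u n * (1 - half%:C%C *: c n).
    rewrite -[u n.+1](subrK (u n)) uc; ncring.
  have css : adj (c n) = c n by rewrite adjB adjM adjK Es.
  rewrite /c e1 adjM adjB adj1 adjZR -/(c n) css.
  have -> : (1 - half%:C%C *: c n) * adj (u n) * (u n * (1 - half%:C%C *: c n)) =
    (1 - half%:C%C *: c n) * (c n + E) * (1 - half%:C%C *: c n).
    by rewrite /c subrK !mulrA.
  transitivity ((1 - half%:C%C *: c n) * c n * (1 - half%:C%C *: c n) +
    (- (half%:C%C *: (c n * E)) - half%:C%C *: (E * c n) +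
      (half * half)%:C%C *: (c n * E * c n))).
    ncring.
  rewrite cE Ec; ncring.
have h0 n := half_ge0 R n.
pose c0 := un (c 0%N).
have c00 : 0 <= c0 := un_ge0 _.
have cn n : un (c n) <= half ^+ n * c0 /\ un (c n) <= half.
  elim: n => [|n [IH1 IH2]]; first by rewrite expr0 mul1r.
  suff h : un (c n.+1) <= half * un (c n).
    by split; [rewrite exprS -mulrA (le_trans h)// ler_wpM2l// invr_ge0|lra].
  rewrite cs (le_trans (unD _ _))// unN !unZR ?divr_ge0//.
  have h1 := unM (c n) (c n); have h2 := unM (c n * c n) (c n).
  have := un_ge0 (c n); move: h1 h2 IH2; move: (un (c n)) (un (c n * c n)).
  move: (un _) => a b d h1 h2 b2 b0.
  have hd : d * b <= b * b * b by apply: ler_wpM2r.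
  nra.
(* |u_n|^2 = |c_n + E| <= 3/2 < (5/4)^2. *)
have un54 n : un (u n) <= 5 / 4.
  rewrite -(@ler_pXn2r _ 2) ?nnegrE ?un_ge0 ?divr_ge0//.
  rewrite -un_adjM -[adj _ * _](subrK E) -/(c n) (le_trans (unD _ _))//.
  by have [_] := cn n; have := isproj_le1 pE; lra.
have ud n : un (u n.+1 - u n) <= (5 / 8) * (half ^+ n * c0).
  rewrite uc unN unZR ?invr_ge0//.
  have [h1 _] := cn n; have := unM_le (un54 n) h1; lra.
have c01 : c0 <= half by have [] := cn 0%N.
have [|x hx] := @un_complete _ A u.
  by move=> n; rewrite (le_trans (ud n))//; have := h0 n; nra.
have uy n : un (u n - y) <= (5 / 4) * c0 * (1 - half ^+ n).
  elim: n => [|n IH]; first by rewrite subrr un0 expr0 subrr mulr0.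
  by rewrite (le_trans (un_tri (u n) _ _))// exprS; have := ud n; lra.
have xy : un (x - y) <= 2 * c0.
  apply: half_limit => n; rewrite (le_trans (un_tri (u n) _ _))//.
  have := hx n; have := uy n; have := h0 n; nra.
exists x; split => //; last first.
  move=> P cP Py PS; apply: cP => e e0.
  have [|n hn] := @half_lt R (e / 16); first by rewrite divr_gt0.
  exists (u n); first by elim: n {hn} => [|n IH] //; exact: PS.
  by have := hx n; lra.
apply/eqP; rewrite -subr_eq0; apply/eqP; apply: le0_un.
have x3 : un x <= 3.
  by have := un_triB x y; have := un54 0%N; rewrite -/c0 in xy *; move: xy c01; rewrite /=; lra.
apply: (@le0_half _ _ 80) => // n.
have -> : adj x * x - E = adj (x - u n) * x + adj (u n) * (x - u n) + c n.
  by rewrite /c adjB; ncring.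
rewrite (le_trans (unD _ _))// (le_trans (lerD (unD _ _) (lexx _)))//.
have h1 : un (adj (x - u n) * x) <= (16 * half ^+ n) * 3.
  by apply: unM_le; rewrite ?un_adj.
have h2 : un (adj (u n) * (x - u n)) <= (5 / 4) * (16 * half ^+ n).
  by apply: unM_le; rewrite ?un_adj.
have [h3 _] := cn n; have := h0 n; nra.
Qed.

End Newton.

(** * Spectral decomposition in finite-dimensional subalgebras *)

Section FdAlgebra.
Variables (R : realType) (A : ucstarAlgType R).
Implicit Types (B : set A) (b x y : A).

Record starsub B : Prop := Starsub {
  ss_lin :> linset B;
  ssM : forall x y, B x -> B y -> B (x * y);
  ss_adj : forall x, B x -> B (adj x) }.

Definition fdalg B := starsub B /\ exists n, dimle n B.

(** The projections sum to the unit of A, which B need not contain; hence the one at the eigenvalue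
    0 is not asked to lie in B. *)
Record specdec B b (s : seq R[i]) (P : R[i] -> A) : Prop := Specdec {
  sd_uniq : uniq s;
  sd_proj : forall z, z \in s -> isproj (P z);
  sd_neq0 : forall z, z \in s -> P z != 0;
  sd_orth : forall z w, z \in s -> w \in s -> z != w -> P z * P w = 0;
  sd_sum1 : \sum_(z <- s) P z = 1;
  sd_id : b = \sum_(z <- s) z *: P z;
  sd_mem : forall z, z \in s -> z != 0 -> B (P z) }.

Lemma normal_idem_adj x : adj x * x = x * adj x -> x * x = x -> adj x = x.
Proof.
move=> nx xx.
have e : adj (x - adj x * x) * (x - adj x * x) = 0.
  have h : x * (adj x * x) = adj x * x by rewrite nx mulrA xx.
  have h2 : adj x * x * x = adj x * x by rewrite -mulrA xx.
  have h3 : adj x * adj x = adj x by rewrite -adjM xx.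
  rewrite adjB adjM adjK mulrBl !mulrBr h2.
  have -> : adj x * (adj x * x) = adj x * x by rewrite mulrA h3.
  have -> : adj x * x * (adj x * x) = adj x * x by rewrite -mulrA h mulrA h3.
  by rewrite !subrr.
have : un (x - adj x * x) ^+ 2 = 0 by rewrite -un_adjM e un0.
move/eqP; rewrite expf_eq0 => /andP[_ /eqP /un0_eq0 /eqP].
by rewrite subr_eq0 => /eqP ->; rewrite adjM adjK.
Qed.

Lemma comm_horner_alg x b q : GRing.comm x b -> GRing.comm x (horner_alg b q).
Proof.
move=> xb; elim/poly_ind: q => [|q c IH]; first by rewrite rmorph0; exact: commr0.
rewrite rmorphD rmorphM /= horner_algX horner_algC.
apply: commrD; first exact: commrM.
by rewrite /GRing.comm -scalerAr -scalerAl mulr1 mul1r.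
Qed.

Lemma comm_adj x y : GRing.comm x y -> GRing.comm (adj x) (adj y).
Proof. by move=> xy; rewrite /GRing.comm -!adjM xy. Qed.

Lemma normal_horner_alg b q : adj b * b = b * adj b ->
  adj (horner_alg b q) * horner_alg b q = horner_alg b q * adj (horner_alg b q).
Proof.
move=> nb; apply: comm_horner_alg; apply/commr_sym; rewrite -{1}(adjK b).
exact/comm_adj/comm_horner_alg.
Qed.

Lemma horner_algX_mem B b q : starsub B -> B b -> B (horner_alg b (q * 'X)).
Proof.
move=> sB Bb; elim/poly_ind: q => [|q c IH].
  by rewrite mul0r rmorph0; exact: lin0 sB.
rewrite mulrDl rmorphD rmorphM (rmorphM _ (c%:P)) /= horner_algX horner_algC.
apply: (linD sB); first exact: ssM.
by rewrite -scalerAl mul1r; exact: linZ sB _ _ Bb.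
Qed.

Lemma fdalg_annihilator B b : fdalg B -> B b ->
  exists2 q : {poly R[i]}, q != 0 & horner_alg b q = 0.
Proof.
move=> [sB [n dB]] Bb.
(* The powers start at b itself, since 1 need not lie in B. *)
have bB i : B (b ^+ i.+1).
  by elim: i => [|i IH]; rewrite ?expr1// exprS; exact: ssM.
have : ~ indep (fun i : 'I_n.+1 => b ^+ i.+1).
  by move=> ib; have := dB _ _ (fun i => bB (val i)) ib; rewrite ltnn.
move=> /existsNP[c] /not_implyP[c0 /existsNP[i /eqP ci]].
pose q := \sum_(j < n.+1) c j *: 'X^(j.+1).
exists q.
  apply: contraNneq ci => q0; have := coef0 R[i] i.+1; rewrite -q0 coef_sum.
  rewrite (bigD1 i)//= big1 ?addr0; last first.
    move=> j ji; rewrite coefZ coefXn eqSS eq_sym.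
    by rewrite (inj_eq val_inj) (negPf ji) mulr0.
  by rewrite coefZ coefXn eqxx mulr1 => ->.
rewrite raddf_sum /= -[RHS]c0; apply: eq_bigr => j _.
by rewrite linearZ /= rmorphXn /= horner_algX mulr_algl.
Qed.

(** The squarefree part of an annihilating polynomial, evaluated at b, is normal and nilpotent,
    hence 0. The root 0 is added by hand: interpolation polynomials at the other points then are
    divisible by X, which puts their values at b in B. *)
Lemma normal_uniq_annihilator B b : fdalg B -> B b -> adj b * b = b * adj b ->
  exists s : seq R[i], [/\ uniq s, 0 \in s &
    horner_alg b (\prod_(z <- s) ('X - z%:P)) = 0].
Proof.
move=> fB Bb nb; have [q q0 qb] := fdalg_annihilator fB Bb.
have [r rE] := closed_field_poly_normal q.
pose s := undup (0 :: r); pose m := \prod_(z <- s) ('X - z%:P).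
exists s; split; [exact: undup_uniq|by rewrite mem_undup mem_head|].
apply: (normal_nilp (n := size r)); first exact: normal_horner_alg.
rewrite -rmorphXn /=.
have dv r' : {subset r' <= s} -> \prod_(z <- r') ('X - z%:P) %| m ^+ size r'.
  elim: r' => [|z r' IH] sr; first by rewrite big_nil expr0 dvdpp.
  rewrite big_cons exprS dvdp_mul//; last first.
    by apply: IH => w wr; apply: sr; rewrite in_cons wr orbT.
  by rewrite dvdp_XsubCl root_prod_XsubC; apply: sr; rewrite mem_head.
have : \prod_(z <- r) ('X - z%:P) %| m ^+ size r.
  by apply: dv => z zr; rewrite mem_undup in_cons zr orbT.
move/dvdpP => [h ->]; rewrite rmorphM /=.
have -> : \prod_(z <- r) ('X - z%:P) = (lead_coef q)^-1 *: q.
  by rewrite {2}rE scalerA mulVf ?scale1r// lead_coef_eq0.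
by rewrite linearZ /= qb !mulr0.
Qed.

Lemma specdec_exists B b : fdalg B -> B b -> adj b * b = b * adj b ->
  exists s P, specdec B b s P.
Proof.
move=> fB Bb nb; have [s [us s0 ms]] := normal_uniq_annihilator fB Bb nb.
(* Lagrange interpolation: [L z] is 1 at z and 0 at the other points of s. *)
pose L z : {poly R[i]} := \prod_(w <- s | w != z) ((z - w)^-1 *: ('X - w%:P)).
have LE z w : w \in s -> (L z).[w] = (w == z)%:R.
  move=> ws; rewrite /L horner_prod.
  have [->|wz] := eqVneq w z.
    rewrite big1// => u uz; rewrite hornerZ hornerXsubC mulVf//.
    by rewrite subr_eq0 eq_sym.
  rewrite (big_rem w)//= wz.
  by rewrite hornerZ hornerXsubC subrr mulr0 mul0r.
pose P z := horner_alg b (L z).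
have PE f : horner_alg b f = \sum_(z <- s) f.[z] *: P z.
  suff : horner_alg b (f - \sum_(z <- s) f.[z] *: L z) = 0.
    move=> /eqP; rewrite rmorphB /= subr_eq0 => /eqP ->; rewrite raddf_sum /=.
    by apply: eq_bigr => z _; rewrite linearZ /= mulr_algl.
  have /dvdpP[h ->] : \prod_(z <- s) ('X - z%:P) %|
      f - \sum_(z <- s) f.[z] *: L z.
    apply: uniq_roots_dvdp; last by rewrite uniq_rootsE.
    apply/allP => w ws; rewrite /root hornerD hornerN horner_sum.
    rewrite (bigD1_seq w)//= hornerZ LE// eqxx mulr1 big1 ?addr0 ?subrr//.
    by move=> z zw; rewrite hornerZ LE// eq_sym (negPf zw) mulr0.
  by rewrite rmorphM /= ms mulr0.
have PP z w : z \in s -> w \in s -> P z * P w = (w == z)%:R *: P z.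
  move=> zs ws; rewrite [in LHS]/P -rmorphM /= PE (bigD1_seq z)//= big_seq_cond big1 ?addr0.
    by rewrite hornerM !LE// eqxx mul1r eq_sym.
  move=> u /andP[us' uz]; rewrite hornerM (LE z)// (negPf uz) mul0r.
  by rewrite scale0r.
have Pproj z : z \in s -> isproj (P z).
  move=> zs; have e : P z * P z = P z by rewrite PP// eqxx scale1r.
  by split=> //; apply: normal_idem_adj => //; exact: normal_horner_alg.
(* Points of s that are not eigenvalues have projection 0 and are dropped. *)
have fil (F : R[i] -> R[i]) : \sum_(z <- [seq z <- s | P z != 0]) F z *: P z =
    \sum_(z <- s) F z *: P z.
  rewrite big_filter [RHS](bigID (fun z => P z != 0))/= [X in _ + X]big1 ?addr0//.
  by move=> z /negPn/eqP ->; rewrite scaler0.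
exists [seq z <- s | P z != 0], P; split.
- exact: filter_uniq.
- by move=> z; rewrite mem_filter => /andP[_]; exact: Pproj.
- by move=> z; rewrite mem_filter => /andP[].
- move=> z w; rewrite !mem_filter => /andP[_ zs] /andP[_ ws] zw.
  by rewrite PP// eq_sym (negPf zw) scale0r.
- have := fil (fun=> 1); under eq_bigr do rewrite scale1r; move=> ->.
  have <- : horner_alg b 1 = 1 by rewrite rmorph1.
  rewrite PE; apply: eq_bigr => z _.
  by rewrite hornerC.
- rewrite (fil id) -[LHS](horner_algX b) PE; apply: eq_bigr => z _.
  by rewrite hornerX.
- move=> z; rewrite mem_filter => /andP[_ zs] z0.
  rewrite /P; have /factor_theorem[h ->] : root (L z) 0.
    by rewrite /root LE// [0 == z]eq_sym (negPf z0).
  by rewrite subr0; apply: horner_algX_mem => //; case: fB.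
Qed.
End FdAlgebra.

Section FunctionalCalculus.
Variables (R : realType) (A : ucstarAlgType R).
Implicit Types (B : set A) (b x y : A) (phi psi : R[i] -> R[i]).

Definition fc (s : seq R[i]) (P : R[i] -> A) phi : A := \sum_(z <- s) phi z *: P z.

(** If y > c > 0, the powers of y / c outgrow K, by Bernoulli's inequality. *)
Lemma expr_pow2_le (y c K : R) : 0 <= y -> 0 <= c ->
  (forall k : nat, y ^+ (2 ^ k)%N <= K * c ^+ (2 ^ k)%N) -> y <= c.
Proof.
move=> y0 c0 h; rewrite leNgt; apply/negP => cy.
have K0 : 0 <= K.
  rewrite leNgt; apply/negP => K0; have := h 0%N; rewrite !expr1; nra.
have [c00|c00] := eqVneq c 0.
  by have := h 0%N; rewrite !expr1 c00 mulr0; lra.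
have cp : 0 < c by rewrite lt0r c00.
pose t := y / c - 1.
have t0 : 0 < t by rewrite subr_gt0 ltr_pdivlMr// mul1r.
have bern n : 1 + n%:R * t <= (1 + t) ^+ n.
  elim: n => [|n IH]; first by rewrite mul0r addr0 expr0.
  rewrite exprS -natr1; have n0 : 0 <= n%:R :> R by rewrite ler0n.
  have : (1 + t) * (1 + n%:R * t) <= (1 + t) * (1 + t) ^+ n by rewrite ler_wpM2l//; lra.
  nra.
pose k := (Num.truncn (K / t)).+1.
have kt : K < k%:R * t by rewrite -ltr_pdivrMr// truncnS_gt.
have := h k; rewrite leNgt => /negP; apply.
have -> : y = (1 + t) * c by rewrite /t addrC subrK divfK.
rewrite exprMn ltr_pM2r ?exprn_gt0//.
apply: (lt_le_trans _ (bern _)); apply: (lt_le_trans kt).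
have : k%:R <= (2 ^ k)%N%:R :> R by rewrite ler_nat ltnW// ltn_expl.
nra.
Qed.

Section Calculus.
Variables (B : set A) (b : A) (s : seq R[i]) (P : R[i] -> A).
Hypothesis h : specdec B b s P.
Local Notation F := (fc s P).

Lemma fc_proj phi z : z \in s -> F phi * P z = phi z *: P z.
Proof.
move=> zs; rewrite /fc mulr_suml (bigD1_seq z) ?(sd_uniq h)//=.
rewrite -scalerAl (proj2 (sd_proj h zs)) big_seq_cond big1 ?addr0//.
by move=> w /andP[ws wz]; rewrite -scalerAl (sd_orth h)// scaler0.
Qed.

Lemma fc_projl phi z : z \in s -> P z * F phi = phi z *: P z.
Proof.
move=> zs; rewrite /fc mulr_sumr (bigD1_seq z) ?(sd_uniq h)//=.
rewrite -scalerAr (proj2 (sd_proj h zs)) big_seq_cond big1 ?addr0//.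
by move=> w /andP[ws wz]; rewrite -scalerAr (sd_orth h)// ?scaler0// eq_sym.
Qed.

Lemma fcM phi psi : F phi * F psi = F (fun z => phi z * psi z).
Proof.
rewrite {2}/fc mulr_sumr; apply: eq_big_seq => z zs.
by rewrite -scalerAr fc_proj// scalerA mulrC.
Qed.

Lemma fcD phi psi : F phi + F psi = F (fun z => phi z + psi z).
Proof.
by rewrite /fc -big_split; apply: eq_bigr => z _; rewrite scalerDl.
Qed.

Lemma fcZ k phi : k *: F phi = F (fun z => k * phi z).
Proof.
by rewrite /fc scaler_sumr; apply: eq_bigr => z _; rewrite scalerA.
Qed.

Lemma fcN phi : - F phi = F (fun z => - phi z).
Proof. by rewrite -scaleN1r fcZ; apply: eq_bigr => z _; rewrite mulN1r. Qed.

Lemma fcB phi psi : F phi - F psi = F (fun z => phi z - psi z).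
Proof. by rewrite fcN fcD. Qed.

Lemma fc1 : F (fun=> 1) = 1.
Proof. by rewrite -(sd_sum1 h); apply: eq_bigr => z _; rewrite scale1r. Qed.

Lemma fcid : F id = b.
Proof. by rewrite [RHS](sd_id h). Qed.

Lemma fc_adj phi : adj (F phi) = F (fun z => (phi z)^*%C).
Proof.
rewrite /fc adj_sum; apply: eq_big_seq => z zs.
by rewrite adjZ (proj1 (sd_proj h zs)).
Qed.

Lemma fc_ext phi psi : (forall z, z \in s -> phi z = psi z) -> F phi = F psi.
Proof. by move=> e; apply: eq_big_seq => z zs; rewrite e. Qed.

Lemma fc_mem phi : starsub B -> (forall z, z \in s -> z = 0 -> phi z = 0) ->
  B (F phi).
Proof.
move=> sB h0; rewrite /fc big_seq; apply: (lin_sum _ sB) => z zs.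
have [z0|z0] := eqVneq z 0; first by rewrite h0// scale0r; exact: lin0 sB.
by apply: (linZ sB); exact: (sd_mem h).
Qed.

Lemma fc_ge phi z : z \in s -> complex.Re `|phi z| <= un (F phi).
Proof.
move=> zs; have := unM (F phi) (P z); rewrite fc_proj// unZ.
have p1 : un (P z) = 1.
  apply/eqP; rewrite eq_le isproj_le1 ?isproj_ge1//; try exact: (sd_proj h).
  by apply/eqP; exact: (sd_neq0 h).
by rewrite p1 !mulr1.
Qed.

Lemma fcX phi n : F phi ^+ n = F (fun z => phi z ^+ n).
Proof.
elim: n => [|n IH]; first by rewrite expr0 -fc1; apply: fc_ext => z _.
by rewrite exprS IH fcM; apply: fc_ext => z _; rewrite exprS.
Qed.

(** The triangle inequality over the spectrum loses a factor [size s]. Applied to powers of exponent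
    2^k, whose norms are the powers of the norm, it loses nothing in the limit. *)
Lemma fc_le phi (c : R) : 0 <= c ->
  (forall z, z \in s -> complex.Re `|phi z| <= c) -> un (F phi) <= c.
Proof.
move=> c0 hc; apply: (@expr_pow2_le _ _ (size s)%:R) => // [|k]; first exact: un_ge0.
rewrite -un_normal_pow2; last first.
  by rewrite fc_adj !fcM; apply: fc_ext => z _; rewrite mulrC.
rewrite fcX (le_trans (un_sum _ _ _))//.
have -> : (size s)%:R * c ^+ (2 ^ k) = \sum_(z <- s) c ^+ (2 ^ k).
  by rewrite big_const_seq count_predT iter_addr addr0 mulr_natl.
rewrite big_seq [leRHS]big_seq; apply: ler_sum => z zs; rewrite unZ.
have e : complex.Re `|phi z ^+ (2 ^ k)| = complex.Re `|phi z| ^+ (2 ^ k).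
  elim: (2 ^ k)%N => [|n IH]; first by rewrite !expr0 normr1.
  by rewrite !exprS Re_normM IH.
rewrite e -[leRHS]mulr1 ler_pM ?isproj_le1 ?un_ge0 ?exprn_ge0 ?Re_norm_ge0//.
  by rewrite ler_pXn2r ?nnegrE ?Re_norm_ge0 ?hc// expn_gt0.
exact: (sd_proj h).
Qed.

Lemma sd_real z : adj b = b -> z \in s -> z = (complex.Re z)%:C%C.
Proof.
move=> bs zs.
have : complex.Re `|z - z^*%C| <= un (F (fun z => z - z^*%C)).
  exact: (@fc_ge (fun z => z - z^*%C)).
have -> : F (fun z => z - z^*%C) = 0.
  by rewrite -fcB -fc_adj fcid bs subrr.
rewrite un0 => h0; have {}h0 : `|z - z^*%C| = 0.
  rewrite [LHS]ge0_ReE ?normr_ge0//.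
  by congr (_%:C%C); apply/eqP; rewrite eq_le h0 Re_norm_ge0.
move/normr0_eq0: h0; case: z {zs} => u v /= [_ vv].
by congr (_ +i* _)%C; lra.
Qed.

End Calculus.

(** q is the spectral projection of b for the eigenvalues at least 1/2; these exclude 0, so q stays
    in B. The factors c and d invert b under q and 1 - b under 1 - q: through them estimates on b
    and 1 - b become estimates on q and 1 - q, at the cost of a factor 2. *)
Lemma spectral_cut B b : fdalg B -> B b -> adj b = b ->
  exists q c d, [/\ isproj q, B q, q = b * c /\ un c <= 2
    & 1 - q = (1 - b) * d /\ un d <= 2].
Proof.
move=> fB Bb bs; have [|s [P h]] := specdec_exists fB Bb; first by rewrite bs.
pose t (z : R[i]) := 2^-1 <= complex.Re z.
have n2 : 0 <= 2 :> R by [].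
exists (fc s P (fun z => (t z)%:R)), (fc s P (fun z => if t z then z^-1 else 0)),
  (fc s P (fun z => if t z then 0 else (1 - z)^-1)).
have rl z : z \in s -> z = (complex.Re z)%:C%C by exact: (sd_real h bs).
have nE (u : R) : 0 <= u -> complex.Re `|(u%:C%C)^-1| = u^-1.
  by move=> u0; rewrite normfV ger0_norm ?lecR// -fmorphV.
split.
- split; last by rewrite (fcM h); apply: fc_ext => z _; case: (t z); rewrite ?mulr1 ?mulr0.
  by rewrite (fc_adj h); apply: fc_ext => z _; case: (t z); rewrite ?rmorph1 ?rmorph0.
- apply: (fc_mem h); first by case: fB.
  by move=> z _ ->; rewrite /t/= leNgt invr_gt0 ltr0n.
- split.
    rewrite -{1}(fcid h) (fcM h); apply: fc_ext => z zs; case: ifP => tz; last by rewrite mulr0.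
    rewrite mulfV//; apply/eqP => z0; move: tz.
    by rewrite z0 /t/= leNgt invr_gt0 ltr0n.
  apply: (fc_le h) => // z zs; case: ifP => tz; last by rewrite normr0.
  have z0 : 0 < complex.Re z by apply: lt_le_trans tz; rewrite invr_gt0.
  rewrite (rl z zs) nE ?(ltW z0)//.
  by rewrite -[leRHS]invrK lef_pV2// posrE invr_gt0.
- split.
    rewrite -{1}(fc1 h) -{1}(fcid h) -{1}(fc1 h) !fcB (fcM h).
    apply: fc_ext => z zs; case: ifP => tz; first by rewrite mulr0 subrr.
    rewrite mulfV ?subr0//; apply/eqP => z0; move: tz.
    have -> : z = 1 by apply/esym/eqP; rewrite -subr_eq0 z0.
    by rewrite /t/= invf_le1//; rewrite ler1n.
  apply: (fc_le h) => // z zs; case: ifP => tz; first by rewrite normr0.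
  have z0 : 2^-1 <= 1 - complex.Re z by move/negbT: tz; rewrite /t -ltNge; lra.
  have -> : 1 - z = (1 - complex.Re z)%:C%C by rewrite {1}(rl z zs) rmorphB.
  have z1 : 0 < 1 - complex.Re z by apply: lt_le_trans z0; rewrite invr_gt0.
  by rewrite nE ?(ltW z1)// -[leRHS]invrK lef_pV2// posrE invr_gt0.
Qed.

(** f is a spectral projection of x * adj x at a nonzero eigenvalue. The factorization f = x * c
    makes f inherit the left annihilators of x. *)
Lemma fdalg_isproj B x : fdalg B -> B x -> x <> 0 ->
  exists f c, [/\ isproj f, B f, f <> 0 & f = x * c].
Proof.
move=> fB Bx x0; have [sB _] := fB.
have hs : adj (x * adj x) = x * adj x by rewrite adjM adjK.
have Bh : B (x * adj x) by apply: ssM => //; exact: ss_adj.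
have [|s [P h]] := specdec_exists fB Bh; first by rewrite hs.
have [z zs z0] : exists2 z, z \in s & z != 0.
  apply: contrapT => hn; apply: x0; apply/un0_eq0/eqP.
  have xx : x * adj x = 0.
    rewrite (sd_id h) big_seq big1// => z zs; have [->|z0] := eqVneq z 0.
      by rewrite scale0r.
    by case: hn; exists z.
  by have := un_adjM (adj x); rewrite adjK xx un0 un_adj => /esym/eqP; rewrite expf_eq0.
exists (P z), (adj x * (z^-1 *: P z)); split.
- exact: (sd_proj h).
- exact: (sd_mem h).
- by apply/eqP; exact: (sd_neq0 h).
- by rewrite mulrA -(fcid h) -scalerAr (fc_proj h)// scalerA mulVf// scale1r.
Qed.

(** As long as some x has r * x <> x, a projection that factors through x - r * x is orthogonal to r
    and is added to it; the subspace of B killed by r on the left gets smaller each time. *)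
Lemma fdalg_unit B : fdalg B -> exists r, [/\ isproj r, B r & forall x, B x -> r * x = x].
Proof.
move=> fB; have [sB [n dB]] := fB.
suff : forall n r, isproj r -> B r -> dimle n [set x | B x /\ r * x = 0] ->
    exists r, [/\ isproj r, B r & forall x, B x -> r * x = x].
  apply; [|exact: (lin0 sB)|apply: dimle_sub dB => x []//].
  by split; rewrite ?adj0 ?mulr0.
elim=> [|m IH] r pr Br dr.
  exists r; split=> // x Bx; apply/eqP; rewrite eq_sym -subr_eq0; apply/eqP.
  apply: (dimle0 dr); split; first by apply: (linB sB) => //; exact: ssM.
  by rewrite mulrBr mulrA (proj2 pr) subrr.
have [hx|] := pselect (forall x, B x -> r * x = x); first by exists r.
move=> /existsNP[x /not_implyP[Bx rx]].
have [|x0|f [c [pf Bf f0 fE]]] := @fdalg_isproj B (x - r * x) fB.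
- by apply: (linB sB) => //; exact: ssM.
- by apply: rx; apply/esym/eqP; rewrite -subr_eq0 x0.
have rf : r * f = 0 by rewrite fE mulrA mulrBr mulrA (proj2 pr) subrr mul0r.
have fr : f * r = 0 by rewrite -[LHS]adjK adjM (proj1 pr) (proj1 pf) rf adj0.
apply: (IH (r + f)).
- split; first by rewrite adjD (proj1 pr) (proj1 pf).
  by rewrite mulrDl !mulrDr rf fr (proj2 pr) (proj2 pf) addr0 add0r.
- exact: (linD sB).
- apply: (dimle_proper (x := f)) dr => //=.
  + split=> [|u v [Bu ru] [Bv rv]|k u [Bu ru]].
    * by split; [exact: (lin0 sB)|rewrite mulr0].
    * by split; [exact: (linD sB)|rewrite mulrDr ru rv addr0].
    * by split; [exact: (linZ sB)|rewrite -scalerAr ru scaler0].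
  + move=> u /= [Bu ru]; split=> //.
    have : r * ((r + f) * u) = 0 by rewrite ru mulr0.
    by rewrite mulrA mulrDr (proj2 pr) rf addr0.
  + by move=> [_]; rewrite mulrDl rf add0r (proj2 pf).
Qed.

End FunctionalCalculus.

Section ComplexLimits.
Variable R : realType.
Local Notation half := (2^-1 : R).
Implicit Types (z w : R[i]).

Definition cn z : R := complex.Re `|z|.

Lemma cnE z : `|z| = (cn z)%:C%C.
Proof. by apply: ge0_ReE; exact: normr_ge0. Qed.

Lemma cn_Re z : `|complex.Re z| <= cn z.
Proof. by rewrite -lecR -cnE normc_ge_Re. Qed.

Lemma normci : `|'i%C : R[i]| = 1.
Proof. by rewrite normc_def /= expr0n expr1n add0r sqrtr1. Qed.

Lemma cn_Im z : `|complex.Im z| <= cn z.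
Proof.
have -> : cn z = cn ('i%C * z).
  by apply: complexI; rewrite -!cnE normrM normci mul1r.
have -> : `|complex.Im z| = `|complex.Re ('i%C * z)|.
  by case: z => a b /=; rewrite mul0r mul1r sub0r normrN.
exact: cn_Re.
Qed.

Lemma cnR (u : R) : cn (u%:C%C) = `|u|.
Proof.
have [u0|u0] := leP 0 u; first by rewrite /cn ger0_norm ?lecR// ger0_norm.
by rewrite /cn ltr0_norm ?ltcR//= ltr0_norm.
Qed.

Lemma cnM z w : cn (z * w) = cn z * cn w.
Proof. exact: Re_normM. Qed.

Lemma cn_ge0 z : 0 <= cn z.
Proof. exact: Re_norm_ge0. Qed.

Lemma cnD z w : cn (z + w) <= cn z + cn w.
Proof. by rewrite -lecR rmorphD /= -!cnE ler_normD. Qed.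

Lemma cn_le_ReIm z : cn z <= `|complex.Re z| + `|complex.Im z|.
Proof.
rewrite {1}(complexE z) (le_trans (cnD _ _))// cnM !cnR lerD2l.
by rewrite /cn normci mul1r.
Qed.

Lemma cn_eq0 z : cn z = 0 -> z = 0.
Proof. by move=> z0; apply: normr0_eq0; rewrite cnE z0. Qed.

Lemma conj_mul z w : ((z * w)^*)%C = (z^*)%C * (w^*)%C.
Proof. exact: rmorphM. Qed.

Lemma conj_nat n : ((n%:R : R[i])^*)%C = n%:R.
Proof. exact: rmorph_nat. Qed.

Lemma conj_i : (('i%C : R[i])^*)%C = - 'i%C.
Proof. by apply/eqP; rewrite eq_complex /= oppr0 !eqxx. Qed.

(** Nested intervals: u_n - 2 / 2^n increases and u_n + 2 / 2^n decreases. *)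
Lemma real_rapid (u : nat -> R) : (forall n, `|u n.+1 - u n| <= half ^+ n) ->
  exists l, forall n, `|l - u n| <= 2 * half ^+ n.
Proof.
move=> ru.
pose v n := u n - 2 * half ^+ n.
have mono n k : v n <= v (n + k)%N.
  elim: k => [|k IH]; first by rewrite addn0.
  rewrite (le_trans IH)// addnS /v exprS; have := ru (n + k)%N.
  by rewrite ler_norml => /andP[h _]; lra.
have mono2 n k : u (n + k)%N + 2 * half ^+ (n + k) <= u n + 2 * half ^+ n.
  elim: k => [|k IH]; first by rewrite addn0.
  apply: le_trans IH; rewrite addnS exprS; have := ru (n + k)%N.
  by rewrite ler_norml => /andP[_ h]; lra.
have vw m n : v m <= u n + 2 * half ^+ n.
  apply: (le_trans (mono m n)); rewrite addnC; apply: le_trans (mono2 n m).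
  by rewrite /v; have := half_ge0 R (n + m); lra.
exists (sup (range v)) => n.
have h1 : v n <= sup (range v).
  apply: ub_le_sup; last by exists n.
  by exists (u 0%N + 2 * half ^+ 0) => _ [m _ <-].
have h2 : sup (range v) <= u n + 2 * half ^+ n.
  by apply: ge_sup => [|_ [m _ <-]//]; exists (v 0%N), 0%N.
by rewrite ler_norml; apply/andP; move: h1; rewrite /v; split; lra.
Qed.

Lemma complex_rapid (u : nat -> R[i]) :
  (forall n, cn (u n.+1 - u n) <= half ^+ n) ->
  exists l, forall n, cn (l - u n) <= 4 * half ^+ n.
Proof.
move=> ru.
have [|a ha] := @real_rapid (fun n => complex.Re (u n)).
  by move=> n; rewrite -raddfB (le_trans (cn_Re _)).
have [|b hb] := @real_rapid (fun n => complex.Im (u n)).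
  by move=> n; rewrite -raddfB (le_trans (cn_Im _)).
exists (a +i* b)%C => n; rewrite (le_trans (cn_le_ReIm _))// !raddfB /=.
by have := ha n; have := hb n; lra.
Qed.

End ComplexLimits.

(** * Finite-dimensional subspaces are closed *)

Section FdClosed.
Variables (R : realType) (A : ucstarAlgType R).
Implicit Types (B S : set A) (b x y : A).
Local Notation half := (2^-1 : R).

(** Induction on the family: its first vector b0 is at a positive distance d from the span of the
    others, so the coefficients of b0 in approximants of x form a Cauchy sequence; subtracting the
    limit multiple of b0 from x leads to the smaller span. *)
Lemma indep_span_uclosed n (b : 'I_n -> A) : indep b -> uclosed (span b).
Proof.
elim: n b => [|n IH] b ib x hx.
  exists (fun=> 0); rewrite big_ord0; apply: le0_un; apply/ler_addgt0Pr => e e0.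
  have [_ [c ->]] := hx e e0; rewrite big_ord0 subr0 add0r; exact: ltW.
pose b' := fun i => b (lift ord0 i); pose b0 := b ord0.
have bE : b = consf b0 b'.
  by apply/funext => i; rewrite /consf; case: unliftP => [j ->|->].
have ib' : indep b'.
  move=> c c0 i; have := ib (fun i => if unlift ord0 i is Some j then c j else 0).
  rewrite bE sum_consf unlift_none scale0r add0r.
  under eq_bigr do rewrite liftK.
  by move=> /(_ c0 (lift ord0 i)); rewrite liftK.
have nb : ~ span b' b0.
  move=> [c b0E]; have := ib (fun i => if unlift ord0 i is Some j then c j else -1).
  rewrite bE sum_consf unlift_none.
  under eq_bigr do rewrite liftK.
  rewrite -b0E scaleN1r addNr => /(_ erefl ord0); rewrite unlift_none => /eqP.
  by rewrite oppr_eq0 oner_eq0.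
have [d d0 hd] : exists2 d : R, 0 < d & forall v, span b' v -> d <= un (b0 - v).
  apply: contrapT => hn; apply: nb; apply: (IH _ ib') => e e0.
  apply: contrapT => hn2; apply: hn; exists e => // v bv.
  by rewrite leNgt; apply/negP => ve; apply: hn2; exists v.
(* The factor d / 4 makes consecutive coefficients of b0 differ by at most 2^-k. *)
have /choice[y hy] : forall k : nat, exists y, span b y /\ un (x - y) < half ^+ k * (d / 4).
  move=> k; have [|y] := hx (half ^+ k * (d / 4)); last by exists y.
  by apply: mulr_gt0; [exact: half_gt0|lra].
have /choice[c hc] : forall k, exists c, span b' (y k - c *: b0).
  by move=> k; apply/span_consf; rewrite -bE; case: (hy k).
have key (k : R[i]) v : span b' v -> cn k * d <= un (k *: b0 - v).
  move=> bv; have [->|k0] := eqVneq k 0; first by rewrite /cn normr0 mul0r un_ge0.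
  have -> : k *: b0 - v = k *: (b0 - k^-1 *: v).
    by rewrite scalerBr scalerA mulfV// scale1r.
  rewrite unZ ler_wpM2l ?cn_ge0//; apply: hd; exact: linZ (span_linset b') _ _ bv.
have [|l hl] := @complex_rapid R c.
  move=> n'; rewrite -(ler_pM2r d0).
  have /(key (c n'.+1 - c n')) : span b' (- ((y n'.+1 - c n'.+1 *: b0) - (y n' - c n' *: b0))).
    by apply: (linN (span_linset b')); apply: (linB (span_linset b')); exact: hc.
  move/le_trans; apply.
  have -> : (c n'.+1 - c n') *: b0 - - (y n'.+1 - c n'.+1 *: b0 - (y n' - c n' *: b0)) =
    (y n'.+1 - x) + (x - y n') by ncring.
  rewrite (le_trans (unD _ _))// (unBC _ x).
  by have [_] := hy n'; have [_] := hy n'.+1; rewrite exprS; have := half_gt0 R n'; nra.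
suff : span b' (x - l *: b0) by rewrite bE => h; apply/span_consf; exists l.
apply: (IH _ ib') => e e0.
have K0 : 0 < d / 4 + 4 * (un b0 + 1) by have := un_ge0 b0; lra.
have [|k hk] := @half_lt R (e / (d / 4 + 4 * (un b0 + 1))); first by rewrite divr_gt0.
exists (y k - c k *: b0) => //.
have -> : x - l *: b0 - (y k - c k *: b0) = (x - y k) - (l - c k) *: b0 by ncring.
rewrite (le_lt_trans (unB _ _))// unZ.
move: hk; rewrite ltr_pdivlMr//; have [_] := hy k; have := hl k.
have := un_ge0 b0; have := half_gt0 R k; rewrite /cn; move: (complex.Re _) (un b0) (un _).
by move=> a u w; nra.
Qed.

Lemma dimle_uclosed n S : linset S -> dimle n S -> uclosed S.
Proof.
by move=> lS /(dimle_span lS)[m [b [ib ->]]]; exact: indep_span_uclosed.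
Qed.

Lemma fdalg_uclosed B : fdalg B -> uclosed B.
Proof. by move=> [sB [n dB]]; exact: dimle_uclosed (ss_lin sB) dB. Qed.

End FdClosed.

(** * Positivity expressed by norms *)

Section Positivity.
Variables (R : realType) (A : ucstarAlgType R).
Implicit Types (B S : set A) (b x y p : A).

(** For selfadjoint x, |c - x| <= c says that the spectrum of x lies in [0, 2 c]; this form of
    positivity needs no spectrum. *)
Definition upos x := adj x = x /\ exists2 c : R, 0 <= c & un (c%:C%C *: 1 - x) <= c.

(** Compressed by p, y1^2 - y2^2 becomes l (l p + 2 p y2 p), which is at least l^2 p. Positivity of
    y2 enters through 2 p (c - y2) p: it has norm at most 2 c and completes the bracket to (2 c + l)
    p. *)
Lemma sqrt_close_proj y1 y2 p (l : R) : isproj p -> p <> 0 ->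
  (y1 - y2) * p = l%:C%C *: p -> p * (y1 - y2) = l%:C%C *: p -> 0 < l ->
  upos y2 -> l * l <= un (y1 * y1 - y2 * y2).
Proof.
move=> pp p0 dp pd l0 [_ [c c0 hc]].
have p1 := isproj_le1 pp; have [ps pp2] := pp.
have e1 : p * (y1 * y1 - y2 * y2) * p = l%:C%C *: (l%:C%C *: p + (p * y2 * p) *+ 2).
  transitivity ((p * (y1 - y2)) * ((y1 - y2) * p) + (p * (y1 - y2)) * y2 * p
    + p * y2 * ((y1 - y2) * p)); first by ncring.
  rewrite dp pd.
  transitivity (l%:C%C *: (l%:C%C *: (p * p) + (p * y2 * p) + (p * y2 * p))); first by ncring.
  by rewrite pp2 -addrA mulr2n.
have e2 : (c *+ 2 + l)%:C%C *: p = (l%:C%C *: p + (p * y2 * p) *+ 2) +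
    (p * (c%:C%C *: 1 - y2) * p) *+ 2.
  transitivity (l%:C%C *: p + (c *+ 2)%:C%C *: (p * p)); first by rewrite pp2; ncring.
  ncring.
have h1 : un (p * (y1 * y1 - y2 * y2) * p) <= un (y1 * y1 - y2 * y2).
  rewrite -[leRHS]mulr1; apply: unM_le => //.
  by rewrite -[leRHS]mul1r; apply: unM_le.
have h2 : un (p * (c%:C%C *: 1 - y2) * p) <= c.
  by rewrite -[leRHS]mulr1; apply: unM_le => //; rewrite -[leRHS]mul1r; apply: unM_le.
move: h1; rewrite e1 unZR ?(ltW l0)// => /(le_trans _); apply.
rewrite ler_pM2l//.
have := isproj_ge1 pp p0; have : un ((c *+ 2 + l)%:C%C *: p) <=
  un (l%:C%C *: p + (p * y2 * p) *+ 2) + c * 2.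
  rewrite e2 (le_trans (unD _ _))// lerD2l mulr2n (le_trans (unD _ _))//; lra.
rewrite unZR; last by rewrite mulr2n; lra.
rewrite mulr2n; nra.
Qed.

(** The continuity estimate for square roots. Each eigenvalue of y1 - y2 is bounded by means of its
    eigenprojection; a negative one exchanges the roles of y1 and y2. *)
Lemma sqrt_close B y1 y2 (e : R) : fdalg B -> B (y1 - y2) -> upos y1 -> upos y2 ->
  0 <= e -> un (y1 * y1 - y2 * y2) <= e ^+ 2 -> un (y1 - y2) <= e.
Proof.
move=> fB Bd p1 p2 e0 he; pose d := y1 - y2.
have ds : adj d = d by rewrite adjB (proj1 p1) (proj1 p2).
have [|s [P h]] := specdec_exists fB Bd; first by rewrite -/d ds.
have dE : d = fc s P id by rewrite (fcid h).
rewrite -/d dE; apply: (fc_le h) => // z zs.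
have zr := sd_real h ds zs; rewrite -[complex.Re _]/(cn z) zr cnR.
set l := complex.Re z in zr *.
have pp := sd_proj h zs; have /eqP p0 := sd_neq0 h zs.
have dp : d * P z = l%:C%C *: P z by rewrite -zr dE (fc_proj h).
have pd : P z * d = l%:C%C *: P z by rewrite -zr dE (fc_projl h).
rewrite -(@ler_pXn2r _ 2) ?nnegrE//; apply: le_trans he.
have [l0|l0|<-] := ltgtP 0 l; last by rewrite normr0 expr0n un_ge0.
  by rewrite (gtr0_norm l0) expr2; apply: (sqrt_close_proj pp p0 dp pd).
rewrite (ltr0_norm l0) expr2 unBC.
apply: (@sqrt_close_proj _ _ (P z)) => //; last by rewrite oppr_gt0.
  by rewrite -opprB -/d mulNr dp rmorphN scaleNr.
by rewrite -opprB -/d mulrN pd rmorphN scaleNr.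
Qed.

Lemma sq_pos B a (c : R) : fdalg B -> B a -> adj a = a -> un a ^+ 2 <= c ->
  un (c%:C%C *: 1 - a * a) <= c.
Proof.
move=> fB Ba as_ ac; have [|s [P h]] := specdec_exists fB Ba; first by rewrite as_.
have c0 : 0 <= c by apply: le_trans ac; exact/exprn_ge0/un_ge0.
rewrite -{1 2}(fcid h) -{1}(fc1 h) (fcM h) fcZ fcB.
apply: (fc_le h) => // z zs.
rewrite -[complex.Re _]/(cn (c%:C%C * 1 - z * z)) (sd_real h as_ zs).
rewrite mulr1 -rmorphM -rmorphB cnR; set l := complex.Re z.
have : l ^+ 2 <= un a ^+ 2.
  rewrite -real_normK ?num_real// ler_pXn2r ?nnegrE ?un_ge0//.
  rewrite (le_trans (cn_Re _))//; have := @fc_ge _ _ _ _ _ _ h id z zs.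
  by rewrite (fcid h).
by move=> l2; rewrite ger0_norm; nra.
Qed.

(** Write w = a + i b with a and b selfadjoint; a^2 + b^2 is half of adj w * w + w * adj w. If m = -
    l were positive, w * adj w would be l times a projection f, so - (m / 2) (e + f) would be a sum
    of two squares. Multiplying the resulting norm bound by e gives N + m / 2 <= N. *)
Lemma adjM_neg B w e (l : R) : fdalg B -> B w -> isproj e -> e <> 0 ->
  w * e = w -> adj w * w = l%:C%C *: e -> 0 <= l.
Proof.
move=> fB Bw pe e0 we wE; rewrite leNgt; apply/negP => l0.
have [sB _] := fB; have [es ee] := pe.
pose m := - l; have m0 : 0 < m by rewrite oppr_gt0.
pose f := - (m^-1%:C%C *: (w * adj w)).
have pf : isproj f.
  split; first by rewrite adjN adjZR adjM adjK.
  rewrite /f mulrNN -scalerAl -scalerAr !mulrA -(mulrA w) wE.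
  rewrite -scalerAr we -scalerAl !scalerA -scaleNr; congr (_ *: _).
  rewrite -!rmorphM -rmorphN; congr (_%:C%C).
  by rewrite /m; field; rewrite lt_eqF.
pose a := 2^-1 *: (w + adj w); pose b := (- 'i%C / 2) *: (w - adj w).
have Ba : B a by apply: (linZ sB); apply: (linD sB) => //; exact: ss_adj.
have Bb : B b by apply: (linZ sB); apply: (linB sB) => //; exact: ss_adj.
have half_conj : ((2^-1 : R[i])^*)%C = 2^-1.
  by rewrite -(rmorph_nat (real_complex R)) -fmorphV /= oppr0.
have as_ : adj a = a by rewrite adjZ adjD adjK half_conj addrC.
have bs : adj b = b.
  have -> : adj b = ((- 'i%C / 2 : R[i])^*)%C *: (adj w - w).
    by rewrite adjZ adjB adjK.
  have -> : ((- 'i%C / 2 : R[i])^*)%C = 'i%C / 2.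
    have -> : (- 'i%C / 2 : R[i]) = (0 +i* (- 2^-1))%C.
      apply: (mulIf (_ : 2 != 0)); first by rewrite pnatr_eq0.
      rewrite divfK ?pnatr_eq0// -(rmorph_nat (real_complex R)); apply/eqP.
      by rewrite eq_complex /= ?(mulr0, mul0r, subr0, addr0, add0r, opprK, mulNr, mulVf, oppr0) ?pnatr_eq0 ?eqxx.
    apply: (mulIf (_ : 2 != 0)); first by rewrite pnatr_eq0.
    rewrite divfK ?pnatr_eq0// -(rmorph_nat (real_complex R)); apply/eqP.
    by rewrite eq_complex /= ?(mulr0, mul0r, subr0, addr0, add0r, opprK, mulNr, mulVf, oppr0) ?pnatr_eq0 ?eqxx.
  by rewrite -[adj w - w]opprB scalerN -scaleNr -mulNr.
have ii : 'i%C * 'i%C = -1 :> R[i] by rewrite -expr2 sqr_i.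
have ab : a * a + b * b = - ((m / 2)%:C%C *: (e + f)).
  have -> : a * a + b * b = 2^-1 *: (adj w * w + w * adj w).
    have -> : b * b = (('i%C * 'i%C) / 4) *: ((w - adj w) * (w - adj w)).
      by rewrite -scalerAl -scalerAr scalerA; congr (_ *: _); field.
    rewrite ii /a; ncring.
  have -> : w * adj w = - (m%:C%C *: f).
    by rewrite /f scalerN opprK scalerA -rmorphM mulfV ?scale1r// gt_eqF.
  rewrite wE -[l]opprK -/m; ncring.
pose K := un a ^+ 2; pose L := un b ^+ 2.
have hK := sq_pos fB Ba as_ (lexx K); have hL := sq_pos fB Bb bs (lexx L).
have hf : un ((m / 2)%:C%C *: (1 - f)) <= m / 2.
  rewrite unZR ?divr_ge0 ?(ltW m0)//.
  have := isproj_le1 (isprojC pf); nra.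
pose N := K + L + m / 2.
have : un (N%:C%C *: 1 + (m / 2)%:C%C *: e) <= N.
  have -> : N%:C%C *: 1 + (m / 2)%:C%C *: e =
    (K%:C%C *: 1 - a * a) + (L%:C%C *: 1 - b * b) + (m / 2)%:C%C *: (1 - f).
    transitivity (K%:C%C *: 1 + L%:C%C *: 1 + (m / 2)%:C%C *: (1 - f) - (a * a + b * b)).
      rewrite ab /N; ncring.
    ncring.
  by rewrite (le_trans (unD _ _))// lerD// (le_trans (unD _ _))// lerD.
have : un ((N%:C%C *: 1 + (m / 2)%:C%C *: e) * e) <= un (N%:C%C *: 1 + (m / 2)%:C%C *: e).
  by rewrite -[leRHS]mulr1; apply: unM_le => //; exact: isproj_le1.
have -> : (N%:C%C *: 1 + (m / 2)%:C%C *: e) * e = (N + m / 2)%:C%C *: e.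
  by rewrite mulrDl -!scalerAl mul1r ee -scalerDl -rmorphD.
have N0 : 0 <= N by rewrite !addr_ge0 ?exprn_ge0 ?un_ge0 ?divr_ge0// ltW.
rewrite unZR; last by rewrite addr_ge0// divr_ge0// ltW.
have := isproj_ge1 pe e0; nra.
Qed.

End Positivity.

(** * Locally finite-dimensional ideals *)

Section DimleImage.
Variables (K : fieldType) (V W : lmodType K).

Lemma dimle_image n (S : set V) (f : V -> W) :
  (forall k x y, f (k *: x + y) = k *: f x + f y) -> dimle n S -> dimle n (f @` S).
Proof.
move=> fl dS m b fb ib.
have f0 : f 0 = 0.
  by have := fl (-1) 0 0; rewrite scaleN1r addNr scaleN1r addNr.
have fs (c : 'I_m -> K) (u : 'I_m -> V) :
    f (\sum_i c i *: u i) = \sum_i c i *: f (u i).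
  elim/big_rec2: _ => [//|i y z _ <-]; exact: fl.
have /choice[u hu] : forall i, exists x, S x /\ f x = b i.
  by move=> i; have [x Sx fx] := fb i; exists x.
apply: (dS _ u) => [i|c c0]; first by case: (hu i).
apply: ib; rewrite -[RHS]f0 -c0 fs; apply: eq_bigr => i _.
by have [_ ->] := hu i.
Qed.

End DimleImage.

Section LocallyFinite.
Variables (R : realType) (A : ucstarAlgType R).
Implicit Types (B J P : set A) (b x y z T : A) (F : seq A).
Local Notation half := (2^-1 : R).

Definition LFset J := forall F (e : R), (forall x, x \in F -> J x) -> 0 < e ->
  exists B, [/\ fdalg B, B `<=` J & forall x, x \in F -> exists2 b, B b & un (x - b) < e].

(** The largest subalgebra of A in which J is an ideal; M inside [idealizer J] replaces the
    statement that J is an ideal of M. *)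
Definition idealizer J : set A := [set a | forall j, J j -> J (a * j) /\ J (j * a)].

(** 2 y - 1 is close to a selfadjoint unitary x, which Newton's iteration reaches, and q = (x + 1) /
    2. In terms of w = (u + 1) / 2, a step on u is the map w -> 3 w^2 - 2 w^3. *)
Lemma near_proj y : adj y = y -> un (y * y - y) <= 8^-1 ->
  exists q, [/\ isproj q, un (q - y) <= 4 * un (y * y - y) &
    forall P, uclosed P -> P y ->
      (forall w, adj w = w -> P w -> P ((w * w) *+ 3 - (w * w * w) *+ 2)) -> P q].
Proof.
move=> ys hy; pose z := y *+ 2 - 1.
have zs : adj z = z by rewrite adjB adj1 mulr2n adjD ys.
have zz : adj z * z - 1 = 4 *: (y * y - y) by rewrite zs /z; ncring.
have z4 : un (adj z * z - 1) = 4 * un (y * y - y).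
  by rewrite zz -(rmorph_nat (real_complex R)) unZR.
have [|||x [xx xz hP]] := @newton _ _ z 1.
- by split; [exact: adj1|rewrite mulr1].
- by rewrite mulr1.
- by rewrite z4; move: hy; lra.
have xs : adj x = x.
    apply: (hP [set u | adj u = u]) => //; first exact: uclosed_adj.
    by move=> u; exact: nstep_adj.
  pose q : A := 2^-1 *: (x + 1).
  have h2 : 2^-1 = half%:C%C :> R[i] by rewrite fmorphV rmorph_nat.
  have xq : x = q *+ 2 - 1 by rewrite /q; ncring.
  exists q; split.
  + split; first by rewrite /q h2 adjZR adjD xs adj1.
    transitivity (2^-1 *: (2^-1 *: (x * x - 1)) + q); first by rewrite /q; ncring.
    by rewrite -{1}xs xx subrr !scaler0 add0r.
  + have -> : q - y = half%:C%C *: (x - z) by rewrite /q -h2 /z; ncring.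
    rewrite unZR ?invr_ge0// -(ler_pM2l (ltr0n _ 2 : 0 < 2)) mulrA mulfV ?mul1r ?pnatr_eq0//.
    by rewrite (le_trans xz)// z4; lra.
  + move=> P cP Py hw.
    pose Q := [set u : A | adj u = u /\ P (2^-1 *: (u + 1))].
    suff [h1 h2'] : P (2^-1 *: (z + 1)) /\ uclosed Q.
      have [] // := hP Q h2' (conj zs h1).
      move=> u [us Pu]; split; first exact: nstep_adj.
      have := hw _ _ Pu; rewrite h2 adjZR adjD us adj1 => /(_ erefl).
      set w := _ *: _; have -> // : (w * w) *+ 3 - (w * w * w) *+ 2 = half%:C%C *: (nstep u + 1).
      by rewrite /w /nstep us; ncring.
    split; first by have -> : 2^-1 *: (z + 1) = y by rewrite /z; ncring.
    move=> u hu; split.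
      by apply: uclosed_adj => e /hu[v [? ?] ?]; exists v.
    apply: cP => e e0; have [|v [_ Pv] uv] := hu (e * 2); first by rewrite mulr_gt0.
    exists (2^-1 *: (v + 1)) => //.
    have -> : 2^-1 *: (u + 1) - 2^-1 *: (v + 1) = half%:C%C *: (u - v) by rewrite -h2; ncring.
    by rewrite unZR ?invr_ge0// mulrC ltr_pdivrMr.
Qed.

Lemma seq_un_bound F : exists2 K : R, 0 <= K & forall x, x \in F -> un x <= K.
Proof.
elim: F => [|a F [K K0 hK]]; first by exists 0.
exists (K + un a) => [|x]; first by rewrite addr_ge0 ?un_ge0.
rewrite in_cons => /orP[/eqP ->|/hK h]; first lra.
by have := un_ge0 a; lra.
Qed.

Definition sadj b : A := (2^-1 : R)%:C%C *: (b + adj b).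

Lemma sadj_adj b : adj (sadj b) = sadj b.
Proof. by rewrite adjZR adjD adjK addrC. Qed.

Lemma sadj_mem B b : starsub B -> B b -> B (sadj b).
Proof. by move=> sB Bb; apply: (linZ sB); apply: (linD sB) => //; exact: ss_adj. Qed.

Lemma sadj_near x b : adj x = x -> un (x - sadj b) <= un (x - b).
Proof.
move=> xs; have -> : x - sadj b = half%:C%C *: ((x - b) + adj (x - b)).
  by rewrite adjB xs /sadj; ncring.
rewrite unZR ?invr_ge0//; have := unD (x - b) (adj (x - b)).
by rewrite un_adj; lra.
Qed.

Lemma LFset_selfadj J : LFset J -> forall F (e : R),
  (forall x, x \in F -> J x /\ adj x = x) -> 0 < e ->
  exists B, [/\ fdalg B, B `<=` J & forall x, x \in F ->
    exists b, [/\ B b, adj b = b & un (x - b) < e]].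
Proof.
move=> LJ F e hF e0; have [|B [fB BJ hB]] := LJ F e _ e0; first by move=> x /hF[].
exists B; split=> // x xF; have [b Bb xb] := hB x xF; exists (sadj b).
split; [by apply: sadj_mem => //; case: fB|exact: sadj_adj|].
by apply: le_lt_trans xb; apply: sadj_near; case: (hF x xF).
Qed.

Section Ideal.
Variable J : set A.
Hypotheses (sJ : starsub J) (cJ : uclosed J) (LJ : LFset J).

Lemma idealizer_mem x : J x -> idealizer J x.
Proof. by move=> Jx j Jj; split; exact: ssM. Qed.

Lemma idealizer_linset : linset (idealizer J).
Proof.
split.
- by move=> j Jj; rewrite mul0r mulr0; split; exact: lin0 sJ.
- move=> x y hx hy j Jj; have [? ?] := hx j Jj; have [? ?] := hy j Jj.
  by rewrite mulrDl mulrDr; split; exact: (linD sJ).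
- move=> k x hx j Jj; have [? ?] := hx j Jj.
  by rewrite -scalerAl -scalerAr; split; exact: (linZ sJ).
Qed.

Lemma idealizer1 : idealizer J 1.
Proof. by move=> j Jj; rewrite mul1r mulr1. Qed.

Lemma idealizer_starsub : starsub (idealizer J).
Proof.
split; first exact: idealizer_linset.
- move=> x y hx hy j Jj; rewrite -mulrA [j * _]mulrA; split.
    by have [/hx[]] := hy j Jj.
  by have [_ /hy[]] := hx j Jj.
- move=> x hx j Jj; split.
    by rewrite -(adjK j) -adjM; apply: (ss_adj sJ); have [] := hx _ (ss_adj sJ Jj).
  by rewrite -(adjK j) -adjM; apply: (ss_adj sJ); have [] := hx _ (ss_adj sJ Jj).
Qed.

Lemma idealizer_uclosed : uclosed (idealizer J).
Proof.
move=> x hx j Jj.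
have K0 : 0 < un j + 1 by have := un_ge0 j; lra.
split; apply: cJ => e e0; have [|y Iy xy] := hx (e / (un j + 1)); rewrite ?divr_gt0//.
- exists (y * j); first by case: (Iy j Jj).
  rewrite -mulrBl (le_lt_trans (unM _ _))//; move: xy; rewrite ltr_pdivlMr//.
  by have := un_ge0 (x - y); nra.
- exists (j * y); first by case: (Iy j Jj).
  rewrite -mulrBr (le_lt_trans (unM _ _))//; move: xy; rewrite ltr_pdivlMr//.
  by have := un_ge0 (x - y); nra.
Qed.

(** The unit r of a finite-dimensional algebra near F almost fixes F but need not lie under T, while
    T r T lies under T but is no projection. A spectral cut of an approximant of T r T almost fixes
    F and is almost under T; compressed by T, it is close to a projection that the invariance clause
    of [near_proj] keeps in J and under T. *)
Lemma corner_unit T F (e : R) : isproj T -> idealizer J T ->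
  (forall x, x \in F -> J x /\ T * x = x) -> 0 < e ->
  exists q, [/\ isproj q, J q, T * q = q & forall x, x \in F -> un (x - q * x) < e].
Proof.
move=> pT IT hF e0; have [K K0 hK] := seq_un_bound F.
have [Ts TT] := pT; have pT' := isprojC pT.
(* 14 = 2 + 12, from the estimates of x - q0 x and of q0 - q. *)
have [eta [eta0 eta1 eta2]] : exists eta : R, [/\ 0 < eta, eta <= 64^-1 & 14 * eta * (1 + K) < e].
  exists (Num.min 64^-1 (e / (28 * (1 + K)))).
  have K1 : 0 < 28 * (1 + K) by lra.
  split; first by rewrite lt_min invr_gt0 divr_gt0//; lra.
    by rewrite ge_min lexx.
  have : Num.min 64^-1 (e / (28 * (1 + K))) <= e / (28 * (1 + K)).
    by rewrite ge_min lexx orbT.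
  by rewrite ler_pdivlMr//; lra.
have [|B1 [fB1 B1J hB1]] := LJ _ eta0 (F := F); first by move=> x /hF[].
have [r [pr Br hr]] := fdalg_unit fB1; have pr' := isprojC pr.
have [rs rr] := pr.
have xr x : x \in F -> un (x - r * x) <= eta.
  move=> xF; have [b Bb xb] := hB1 x xF.
  have -> : x - r * x = (1 - r) * (x - b) by rewrite mulrBr !mulrBl !mul1r (hr b)// subrr subr0.
  rewrite -[eta]mul1r; apply: unM_le; [exact: isproj_le1|exact: ltW].
pose h := T * r * T.
have hs : adj h = h by rewrite !adjM Ts rs mulrA.
have Th : T * h = h by rewrite /h !mulrA TT.
have Jh : J h.
  by have [_] := IT _ (B1J _ Br); have [] := IT _ (B1J _ Br) => J1 _; have [_] := IT _ J1.
have [|B [fB BJ /(_ h (mem_head _ _))[b [Bb bs hb]]]] := @LFset_selfadj J LJ [:: h] eta _ eta0.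
  by move=> x; rewrite inE => /eqP ->.
have [q0 [c [d [pq0 Bq0 [q0c c2] [q0d d2]]]]] := spectral_cut fB Bb bs.
have [q0s q0q0] := pq0.
(* 1 - q0 = adj d * (1 - b), and (1 - b) x is small because T r T x = T r x is close to T x = x. *)
have q0x x : x \in F -> un (x - q0 * x) <= 2 * (eta * (1 + K)).
  move=> xF; have [_ Tx] := hF x xF.
  have -> : x - q0 * x = adj d * (x - b * x).
    have : adj (1 - q0) = adj ((1 - b) * d) by rewrite q0d.
    rewrite adjM !adjB adj1 q0s bs => e1.
    by rewrite -{1}[x]mul1r -mulrBl e1 -mulrA mulrBl mul1r.
  apply: unM_le; first by rewrite un_adj.
  have -> : x - b * x = T * (x - r * x) + (h - b) * x.
    by rewrite mulrBr Tx mulrBl /h -!mulrA Tx addrA subrK.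
  rewrite (le_trans (unD _ _))// [eta * _]mulrDr mulr1 lerD//.
    by rewrite -[eta]mul1r; apply: unM_le; [exact: isproj_le1|exact: xr].
  by apply: unM_le; [exact: ltW|exact: hK].
have Tq0 : un ((1 - T) * q0) <= 2 * eta.
  have -> : (1 - T) * q0 = (1 - T) * (b - h) * c.
    by rewrite q0c mulrBr [(1 - T) * h]mulrBl mul1r Th subrr subr0 mulrA.
  rewrite [2 * _]mulrC; apply: unM_le => //; rewrite -[eta]mul1r; apply: unM_le.
    exact: isproj_le1.
  by rewrite unBC ltW.
have Tq0' : un (q0 * (1 - T)) <= 2 * eta.
  by rewrite -un_adj adjM (proj1 pT') q0s.
pose y := T * q0 * T.
have ys : adj y = y by rewrite !adjM Ts q0s mulrA.
have yy : un (y * y - y) <= 2 * eta.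
  have -> : y * y - y = - (T * (q0 * ((1 - T) * q0)) * T).
    transitivity (T * q0 * (T * T) * q0 * T - T * (q0 * q0) * T).
      by rewrite /y q0q0 !mulrA.
    rewrite TT; ncring.
  rewrite unN -[2 * eta]mulr1; apply: unM_le; last exact: isproj_le1.
  rewrite -[2 * eta]mul1r; apply: unM_le; first exact: isproj_le1.
  rewrite -[2 * eta]mul1r; apply: unM_le => //; exact: isproj_le1.
have [|q [pq qy hP]] := near_proj ys; first by move: yy eta1; lra.
have [Jq Tq] : J q /\ T * q = q.
  apply: (hP (J `&` [set z | T * z = z])).
  - by apply: uclosedI => //; under [X in uclosed X]eq_set => z do rewrite -[X in _ = X]mul1r; exact: uclosed_mull.
  - split; last by rewrite /= /y !mulrA TT.
    have Jq0 := BJ _ Bq0; have [J1 _] := IT _ Jq0.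
    by have [_] := IT _ J1.
  - move=> w _ [Jw /= Tw]; split.
      apply: (linB sJ); rewrite -scaler_nat; apply: (linZ sJ).
        exact: ssM.
      by do !apply: ssM.
    by rewrite /= mulrBr !mulrnAr !mulrA Tw.
exists q; split=> // x xF.
have qq0 : un (q0 - q) <= 12 * eta.
  have -> : q0 - q = (1 - T) * q0 + T * (q0 * (1 - T)) - (q - y).
    rewrite /y; ncring.
  rewrite (le_trans (unB _ _))// (le_trans (lerD (unD _ _) (lexx _)))//.
  have : un (T * (q0 * (1 - T))) <= 2 * eta.
    by rewrite -[2 * eta]mul1r; apply: unM_le => //; exact: isproj_le1.
  by move: qy yy Tq0; lra.
have -> : x - q * x = (x - q0 * x) + (q0 - q) * x by rewrite mulrBl addrA subrK.
apply: le_lt_trans eta2; rewrite (le_trans (unD _ _))//.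
have := q0x x xF; have := unM_le qq0 (hK x xF); nra.
Qed.

(** A finite-dimensional B near r and F contains a projection r' near r. Since adj X * X = r' for
    the polar part X of r r', the map b -> X b adj X is multiplicative on the corner r' B r', which
    it moves by little into r J r. *)
Lemma corner_LF r F (e : R) : isproj r -> J r ->
  (forall x, x \in F -> [/\ J x, r * x = x & x * r = x]) -> 0 < e ->
  exists B, [/\ fdalg B, B `<=` J, forall x, B x -> r * x = x &
    forall x, x \in F -> exists2 b, B b & un (x - b) < e].
Proof.
move=> pr Jr hF e0; have [K K0 hK] := seq_un_bound F; have [rs rr] := pr.
have [eta [eta0 eta1 eta2]] : exists eta : R, [/\ 0 < eta, eta <= 128^-1 & 110 * eta * (1 + K) < e].
  exists (Num.min 128^-1 (e / (220 * (1 + K)))).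
  have K1 : 0 < 220 * (1 + K) by lra.
  split; first by rewrite lt_min invr_gt0 divr_gt0//; lra.
    by rewrite ge_min lexx.
  have : Num.min 128^-1 (e / (220 * (1 + K))) <= e / (220 * (1 + K)).
    by rewrite ge_min lexx orbT.
  by rewrite ler_pdivlMr//; lra.
have [|B [fB BJ hB]] := LJ _ eta0 (F := r :: F).
  by move=> x; rewrite in_cons => /orP[/eqP ->//|/hF[]].
have sB := proj1 fB.
have [r0 Br0 rr0] := hB r (mem_head _ _).
have Bs := sadj_mem sB Br0; have ss := sadj_adj r0.
have {rr0} := le_lt_trans (sadj_near r0 rs) rr0; move: (sadj r0) Bs ss => {Br0}r0 Br0 r0s rr0.
have r0r0 : un (r0 * r0 - r0) <= 4 * eta.
  have -> : r0 * r0 - r0 = (r - r0) * (r - r0) - r * (r - r0) - (r - r0) * r + (r - r0).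
    transitivity (r0 * r0 - r0 + (r - r * r)); first by rewrite rr subrr addr0.
    ncring.
  have h1 := unM_le (ltW rr0) (ltW rr0).
  have h2 := unM_le (isproj_le1 pr) (ltW rr0); have h3 := unM_le (ltW rr0) (isproj_le1 pr).
  rewrite (le_trans (unD _ _))// (le_trans (lerD (unB _ _) (lexx _)))//.
  rewrite (le_trans (lerD (lerD (unB _ _) (lexx _)) (lexx _)))//.
  by move: h1 h2 h3 (ltW rr0) eta1 eta0; nra.
have [|r' [pr' r'r0 hP]] := near_proj r0s; first by move: r0r0 eta1; lra.
have Br' : B r'.
  apply: (hP B) => //; first exact: fdalg_uclosed.
  move=> w _ Bw; apply: (linB sB); rewrite -scaler_nat; apply: (linZ sB).
    exact: ssM.
  by do !apply: ssM.
have [r's r'r'] := pr'.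
have rr' : un (r - r') <= 17 * eta.
  by rewrite (le_trans (un_tri r0 _ _))// (unBC r0); move: r'r0 r0r0 (ltW rr0); lra.
pose y := r * r'.
have yr : y * r' = y by rewrite -mulrA r'r'.
have yy : un (adj y * y - r') <= 17 * eta.
  have -> : adj y * y - r' = r' * (r - r') * r'.
    by rewrite adjM rs r's mulrBr mulrBl r'r' r'r' -!mulrA (mulrA r) rr.
  rewrite -[leRHS]mulr1; apply: unM_le; last exact: isproj_le1.
  by rewrite -[leRHS]mul1r; apply: unM_le => //; exact: isproj_le1.
have [|X [XX Xy hX]] := newton pr' yr; first by move: yy eta1; lra.
have [[JX rX] Xr'] : (J X /\ r * X = X) /\ X * r' = X.
  apply: (hX ((J `&` [set z | r * z = z]) `&` [set z | z * r' = z])).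
  - apply: uclosedI; first apply: uclosedI => //.
      by under [X in uclosed X]eq_set => z do rewrite -[X in _ = X]mul1r; exact: uclosed_mull.
    by under [X in uclosed X]eq_set => z do rewrite -[X in _ = X]mulr1; exact: uclosed_mulr.
  - do !split; [by apply: ssM => //; exact: BJ|by rewrite /= mulrA rr|exact: yr].
  - move=> z [[Jz /= rz] zr]; do !split.
    + apply: (linZ sJ); apply: (linB sJ); first by rewrite -scaler_nat; exact: (linZ sJ).
      by apply: (ssM sJ) => //; apply: (ssM sJ) => //; exact: ss_adj.
    + by rewrite /= /nstep -scalerAr mulrBr mulrnAr !mulrA rz.
    + by rewrite /= /nstep -scalerAl mulrBl mulrnAl -(mulrA _ z r') zr.
have X1 : un X <= 1.
  rewrite -(@ler_pXn2r _ 2) ?nnegrE ?un_ge0// -un_adjM XX expr1n; exact: isproj_le1.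
have Xr : un (X - r) <= 51 * eta.
  rewrite (le_trans (un_tri y _ _))//.
  have : un (y - r) <= 17 * eta.
    have -> : y - r = r * (r' - r) by rewrite mulrBr rr.
    by rewrite -[leRHS]mul1r; apply: unM_le; [exact: isproj_le1|rewrite unBC].
  by move: Xy yy; lra.
pose f b := X * b * adj X.
have fl k x y' : f (k *: x + y') = k *: f x + f y'.
  by rewrite /f mulrDr mulrDl -scalerAr -scalerAl.
pose B0 := B `&` [set b | r' * b = b /\ b * r' = b].
exists (f @` B0); split.
- split; last first.
    have [_ [n dB]] := fB; exists n; apply: dimle_image => //.
    by apply: dimle_sub dB => b [].
  split; first split.
  + exists 0; last by rewrite /f mulr0 mul0r.
    by split; [exact: lin0 sB|rewrite /= mulr0 mul0r].
  + move=> _ _ [u [Bu [/= u1 u2]] <-] [v [Bv [/= v1 v2]] <-]; exists (u + v).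
      by split; [exact: (linD sB)|rewrite /= mulrDr mulrDl u1 u2 v1 v2].
    by have := fl 1 u v; rewrite !scale1r.
  + move=> k _ [u [Bu [/= u1 u2]] <-]; exists (k *: u).
      by split; [exact: (linZ sB)|rewrite /= -scalerAr -scalerAl u1 u2].
    by rewrite /f -scalerAr -scalerAl.
  + move=> _ _ [u [Bu [/= u1 u2]] <-] [v [Bv [/= v1 v2]] <-]; exists (u * v).
      by split; [exact: ssM|rewrite /= mulrA u1 -mulrA v2].
    rewrite /f !mulrA; congr (_ * _); rewrite -(mulrA (X * u)) XX.
    by rewrite -(mulrA X u r') u2.
  + move=> _ [u [Bu [/= u1 u2]] <-]; exists (adj u).
      split; first exact: ss_adj.
      by split; rewrite -{1}r's -adjM ?u1 ?u2.
    by rewrite /f !adjM adjK mulrA.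
- move=> _ [u [Bu _] <-]; apply: (ssM sJ); last exact: ss_adj.
  by apply: (ssM sJ) => //; exact: BJ.
- by move=> _ [u [Bu _] <-]; rewrite /f !mulrA rX.
- move=> x xF; have [Jx rx xr] := hF x xF.
  have [|b Bb xb] := hB x; first by rewrite in_cons xF orbT.
  exists (f (r' * b * r')).
    exists (r' * b * r') => //; split; first by apply: (ssM sB) => //; apply: (ssM sB).
    by split; rewrite /= ?mulrA ?r'r'// -mulrA r'r'.
  have -> : f (r' * b * r') = X * b * adj X.
    by rewrite /f !mulrA Xr' -mulrA -{1}r's -adjM Xr'.
  have -> : x - X * b * adj X = - ((X - r) * b * adj X) + r * (x - b) * adj X
      - r * x * adj (X - r).
    rewrite adjB rs.
    transitivity (r * x * r - X * b * adj X); first by rewrite rx xr.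
    ncring.
  have bK : un b <= K + eta.
    by rewrite (le_trans (un_triB b x))// unBC lerD ?hK// ltW.
  have aX : un (adj X) <= 1 by rewrite un_adj.
  have h1 := unM_le (unM_le Xr bK) aX.
  have h2 := unM_le (unM_le (isproj_le1 pr) (ltW xb)) aX.
  have h3 : un (r * x * adj (X - r)) <= K * (51 * eta).
    by apply: unM_le; rewrite ?un_adj// rx hK.
  apply: le_lt_trans eta2.
  rewrite (le_trans (unB _ _))// (le_trans (lerD (unD _ _) (lexx _)))// unN.
  by move: h1 h2 h3; nra.
Qed.

End Ideal.
End LocallyFinite.

(** * Lifting projections *)

Section Cayley.
Variables (R : realType) (A : ucstarAlgType R).
Implicit Types (W : set A) (x y t G : A).
Local Notation half := (2^-1 : R).

(** Closed unital subalgebras serve to locate limits of polynomials in an element: with a commutant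
    they give commutation, with [idealizer J] membership. *)
Record subunital W : Prop := Subunital {
  su_lin :> linset W;
  su1 : W 1;
  suM : forall x y, W x -> W y -> W (x * y);
  su_closed : uclosed W }.

Lemma subunital_comm x : subunital [set z | z * x = x * z].
Proof.
split; first split.
- by rewrite /= mul0r mulr0.
- by move=> u v /= ux vx; rewrite mulrDl mulrDr ux vx.
- by move=> k u /= ux; rewrite -scalerAl -scalerAr ux.
- by rewrite /= mul1r mulr1.
- by move=> u v /= ux vx; rewrite -mulrA vx mulrA ux mulrA.
- apply: (@uclosed_eq _ _ (fun z => z * x) (fun z => x * z) (un x *+ 2)) => u v.
  have -> : u * x - x * u - (v * x - x * v) = (u - v) * x - x * (u - v) by ncring.
  rewrite (le_trans (unB _ _))// mulr2n [leRHS]mulrDl.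
  by apply: lerD; [rewrite mulrC|]; exact: unM.
Qed.

Lemma geometric x : un x <= half ->
  exists g, [/\ (1 - x) * g = 1, g * (1 - x) = 1 & forall W, subunital W -> W x -> W g].
Proof.
move=> x2; pose u n := \sum_(i < n) x ^+ i.
have xn n : un (x ^+ n) <= half ^+ n.
  elim: n => [|n IH]; first by rewrite !expr0 un1.
  by rewrite !exprS; exact: unM_le.
have [|g hg] := @un_complete _ A u.
  by move=> n; rewrite /u big_ord_recr /= addrAC subrr add0r.
have un' n : (1 - x) * u n = 1 - x ^+ n.
  elim: n => [|n IH]; first by rewrite /u big_ord0 mulr0 expr0 subrr.
  by rewrite /u big_ord_recr /= mulrDr -/(u n) IH mulrBl mul1r -exprS addrA subrK.
have cu n : u n * x = x * u n.
  by rewrite /u mulr_suml mulr_sumr; apply: eq_bigr => i _; rewrite -exprS -exprSr.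
have un'' n : u n * (1 - x) = 1 - x ^+ n.
  by rewrite mulrBr mulr1 cu -{1}[u n]mul1r -mulrBl un'.
have x1 : un (1 - x) <= 2 by rewrite (le_trans (unB _ _))// un1; lra.
exists g; split.
- apply/eqP; rewrite -subr_eq0; apply/eqP; apply: le0_un.
  apply: (@le0_half _ _ 33) => // n.
  have -> : (1 - x) * g - 1 = (1 - x) * (g - u n) - x ^+ n.
    by rewrite mulrBr un'; move: (x ^+ n) => w; ncring.
  rewrite (le_trans (unB _ _))//; have := xn n; have := unM_le x1 (hg n).
  by have := half_ge0 R n; nra.
- apply/eqP; rewrite -subr_eq0; apply/eqP; apply: le0_un.
  apply: (@le0_half _ _ 33) => // n.
  have -> : g * (1 - x) - 1 = (g - u n) * (1 - x) - x ^+ n.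
    by rewrite mulrBl un''; move: (x ^+ n) => w; ncring.
  rewrite (le_trans (unB _ _))//; have := xn n; have := unM_le (hg n) x1.
  by have := half_ge0 R n; nra.
- move=> W sW Wx; apply: (su_closed sW) => e e0.
  have [|n hn] := @half_lt R (e / 16); first by rewrite divr_gt0.
  exists (u n); last by have := hg n; lra.
  apply: (lin_sum _ sW) => i _; elim: (i : nat) => [|j IH]; first exact: su1.
  by rewrite exprS; exact: suM.
Qed.

(* [2 t G + i (2 G - 1)] is a Cayley transform of [t], hence unitary. *)
Lemma cayley_bound t G : adj t = t -> adj G = G -> t * G = G * t ->
  (1 + t * t) * G = 1 ->
  [/\ (t * G) *+ 2 * ((t * G) *+ 2) + (G *+ 2 - 1) * (G *+ 2 - 1) = 1,
      un ((t * G) *+ 2) <= 1 & un (G *+ 2 - 1) <= 1].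
Proof.
move=> ts Gs tG GE; set s := (t * G) *+ 2; set y := G *+ 2 - 1.
have sy1 : s * s + y * y = 1.
  transitivity (4 *: ((t * (G * t) + G) * G) - 4 *: G + 1); first by rewrite /s /y; ncring.
  rewrite -tG.
  transitivity (4 *: (((1 + t * t) * G) * G) - 4 *: G + 1); first by ncring.
  by rewrite GE mul1r subrr add0r.
have ss : adj s = s by rewrite /s mulr2n adjD adjM ts Gs tG.
have ys : adj y = y by rewrite /y mulr2n adjB adjD adj1 Gs.
have sy : s * y = y * s.
  rewrite /s /y.
  transitivity (4 *: (t * G * G) - (t * G) *+ 2); first by ncring.
  transitivity (4 *: (G * t * G) - (t * G) *+ 2); last by ncring.
  by rewrite tG.
have ii : 'i%C * 'i%C = -1 :> R[i] by rewrite -expr2 sqr_i.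
have iJ : (('i%C : R[i])^*)%C = - 'i%C by apply/eqP; rewrite eq_complex /= oppr0 !eqxx.
pose V := s + 'i%C *: y.
have Vs : adj V = s - 'i%C *: y by rewrite adjD adjZ ss ys iJ scaleNr.
have VV : adj V * V = 1.
  transitivity (s * s - ('i%C * 'i%C) *: (y * y) + 'i%C *: (s * y - y * s)).
    by rewrite Vs /V; ncring.
  by rewrite ii sy subrr scaler0 addr0 scaleN1r opprK.
have V1 : un V = 1.
  apply/eqP; rewrite -(@eqrXn2 _ 2) ?un_ge0// -un_adjM VV un1 expr1n//.
split=> //.
- have -> : s = half%:C%C *: (V + adj V) by rewrite Vs /V; ncring.
  by rewrite unZR ?invr_ge0//; have := unD V (adj V); rewrite un_adj V1; lra.
- have -> : y = half%:C%C *: ((- 'i%C) *: (V - adj V)).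
    have -> : V - adj V = (2 * 'i%C) *: y by rewrite Vs /V; ncring.
    rewrite !scalerA; have -> : half%:C%C * - 'i%C * (2 * 'i%C) = - ('i%C * 'i%C) :> R[i].
      by field.
    by rewrite ii opprK scale1r.
  rewrite unZR ?invr_ge0// unZ normrN normci mul1r.
  by have := unB V (adj V); rewrite un_adj V1; lra.
Qed.

(** The Neumann series serves small t only. For t' = t / sqrt 2 and G' the inverse of 1 + t'^2, one
    has 1 + t^2 = 2 (1 + t'^2) (1 - G' / 2), and |G'| <= 1 by [cayley_bound]; so the last factor is
    invertible, and the induction halves |t|^2 until the series applies. *)
Lemma inv_one_sq t : adj t = t ->
  exists G, [/\ adj G = G, (1 + t * t) * G = 1 &
    forall W, subunital W -> W (t * t) -> W G].
Proof.
move=> ts.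
suff : forall (k : nat) t, adj t = t -> un t ^+ 2 <= 2 ^+ k * half ->
    exists G, [/\ (1 + t * t) * G = 1, G * (1 + t * t) = 1 &
      forall W, subunital W -> W (t * t) -> W G].
  pose k := (Num.truncn (un t ^+ 2 * 2)).+1.
  move=> /(_ k t ts) [|G [G1 G2 GW]].
    rewrite ler_pdivlMr// ltW// (lt_le_trans (truncnS_gt _))// -/k -natrX ler_nat.
    by apply/ltnW; apply: ltn_expl.
  exists G; split=> //.
  rewrite -[LHS]mulr1 -{1}G1 mulrA.
  have -> : adj G * (1 + t * t) = 1.
    by have := congr1 adj G1; rewrite adjM adjD !adj1 adjM ts.
  by rewrite mul1r.
elim=> [|k IH] {}t {}ts ht.
  have [|g [g1 g2 gW]] := @geometric (- (t * t)).
    by rewrite unN (le_trans (unM _ _))//; move: ht; rewrite expr0 mul1r expr2.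
  rewrite opprK in g1 g2; exists g; split=> // W sW Wt; apply: gW => //.
  exact: (linN sW).
pose r : R := (Num.sqrt 2)^-1; pose t' := r%:C%C *: t.
have r0 : 0 <= r by rewrite invr_ge0 sqrtr_ge0.
have r2 : r * r = half by rewrite -invfM -expr2 sqr_sqrtr.
have t's : adj t' = t' by rewrite adjZR ts.
have t't : t' * t' = half%:C%C *: (t * t).
  by rewrite -scalerAl -scalerAr scalerA -rmorphM r2.
have t'2 : un t' ^+ 2 <= 2 ^+ k * half.
  by rewrite unZR// exprMn expr2 r2; move: ht; rewrite (exprS 2 k); lra.
clearbody t'.
have [G [G1 G2 GW]] := IH t' t's t'2.
have cG : t' * G = G * t'.
  apply/esym/(GW [set z | z * t' = t' * z]); first exact: subunital_comm.
  by rewrite /= mulrA.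
have Gs : adj G = G.
  rewrite -[LHS]mulr1 -{1}G1 mulrA.
  have -> : adj G * (1 + t' * t') = 1.
    by have := congr1 adj G1; rewrite adjM adjD !adj1 adjM t's.
  by rewrite mul1r.
have [_ _ y1] := cayley_bound t's Gs cG G1.
have Gle : un G <= 1.
  have -> : G = half%:C%C *: (1 + (G *+ 2 - 1)) by ncring.
  by rewrite unZR ?invr_ge0//; have := unD 1 (G *+ 2 - 1); rewrite un1; lra.
have [|g [g1 g2 gW]] := @geometric (half%:C%C *: G).
  by rewrite unZR ?invr_ge0//; lra.
have E1 : 1 + t * t = (2 : R)%:C%C *: ((1 + t' * t') * (1 - half%:C%C *: G)).
  rewrite mulrBr mulr1 -scalerAr G1 t't; ncring.
have E2 : 1 + t * t = (2 : R)%:C%C *: ((1 - half%:C%C *: G) * (1 + t' * t')).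
  rewrite mulrBl mul1r -scalerAl G2 t't; ncring.
have h2 : (2 : R)%:C%C * half%:C%C = 1 :> R[i] by rewrite -rmorphM mulfV ?pnatr_eq0.
exists (half%:C%C *: (g * G)); split.
- rewrite E2 -scalerAl -scalerAr scalerA h2 scale1r.
  have gG : g * G = G * g.
    apply: (gW [set z | z * G = G * z]); first exact: subunital_comm.
    by rewrite /= -scalerAl -scalerAr.
  by rewrite gG -mulrA (mulrA (1 + t' * t')) G1 mul1r g1.
- rewrite E1 -scalerAl -scalerAr scalerA mulrC h2 scale1r.
  by rewrite -mulrA (mulrA G) G2 mul1r g2.
- move=> W sW Wt; have WG : W G.
    by apply: GW => //; rewrite t't; exact: (linZ sW).
  apply: (linZ sW); apply: (suM sW) => //; apply: gW => //; exact: (linZ sW).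
Qed.

End Cayley.

Section ProjectionLifting.
Variables (R : realType) (A : ucstarAlgType R).
Implicit Types (B J P : set A) (u v w x y t X Y Z H : A).
Local Notation half := (2^-1 : R).

(** Newton's iteration from v, which preserves 1 + B, gives an isometry X; then 1 - X * adj X is a
    projection of norm less than 1, hence 0. *)
Lemma unitary_near B u v (d : R) : fdalg B -> adj u * u = 1 -> u * adj u = 1 ->
  B (v - 1) -> un (v - u) <= d -> d <= 100^-1 ->
  exists X, [/\ adj X * X = 1, X * adj X = 1, B (X - 1) & un (X - u) <= 7 * d].
Proof.
move=> fB uu uu' Bv vu d1; have sB := proj1 fB.
have d0 : 0 <= d by apply: le_trans vu; exact: un_ge0.
have un_unit (w : A) : adj w * w = 1 -> un w = 1.
  by move=> ww; apply/eqP; rewrite -(@eqrXn2 _ 2) ?un_ge0// -un_adjM ww un1 expr1n.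
have u1 := un_unit u uu.
have v2 : un v <= 2 by rewrite (le_trans (un_triB v u))// u1; lra.
have pr1 : isproj (1 : A) by split; [exact: adj1|rewrite mulr1].
have vv : un (adj v * v - 1) <= 3 * d.
  have -> : adj v * v - 1 = adj (v - u) * v + adj u * (v - u).
    by rewrite adjB -uu; ncring.
  rewrite (le_trans (unD _ _))//.
  have h1 : un (adj (v - u) * v) <= d * 2 by apply: unM_le; rewrite ?un_adj.
  have h2 : un (adj u * (v - u)) <= 1 * d by apply: unM_le; rewrite ?un_adj ?u1.
  lra.
have [|X [XX Xv hP]] := newton pr1 (mulr1 v); first by lra.
have BX : B (X - 1).
  apply: (hP [set z | B (z - 1)]) => //.
    by apply: (@uclosed_shift _ _ B 1); exact: fdalg_uclosed.
  move=> z /= Bz; set w := z - 1 in Bz *.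
  have Bw' := ss_adj sB Bz.
  have -> : nstep z - 1 = half%:C%C *: (w - adj w - w * adj w - w * w - adj w * w - w * adj w * w).
    have -> : z = w + 1 by rewrite /w subrK.
    by rewrite /nstep adjD adj1; ncring.
  apply: (linZ sB); do !apply: (linB sB) => //; do !apply: ssM => //.
have Xu : un (X - u) <= 7 * d by rewrite (le_trans (un_tri v _ _))//; move: Xv vv vu; lra.
have X1 := un_unit X XX.
exists X; split=> //.
have pf : isproj (1 - X * adj X).
  apply: isprojC; split; first by rewrite adjM adjK.
  by rewrite mulrA -(mulrA X) XX mulr1.
have : un (1 - X * adj X) < 1.
  have -> : 1 - X * adj X = (u - X) * adj u + X * adj (u - X).
    by rewrite adjB -uu'; ncring.
  rewrite (le_lt_trans (unD _ _))//.
  have h1 : un ((u - X) * adj u) <= 7 * d * 1 by apply: unM_le; rewrite ?un_adj ?u1// unBC.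
  have h2 : un (X * adj (u - X)) <= 1 * (7 * d) by apply: unM_le; rewrite ?un_adj ?X1// unBC.
  lra.
have [f0 _|/eqP f0] := eqVneq (1 - X * adj X) 0.
  by apply/esym/eqP; rewrite -subr_eq0 f0.
by have := isproj_ge1 pf f0; rewrite leNgt => /negP nlt /nlt.
Qed.

(* With [X = exp(i theta)] and [theta] in [0, 2 pi): [Y = sin(theta/2)],
   [Z = sin(theta)/2] and [cos(theta/2) + Y H] is the sign of [cos(theta/2)]. *)
Lemma unitary_half_angle B X : fdalg B -> adj X * X = 1 -> X * adj X = 1 -> B (X - 1) ->
  exists Y Z H, [/\ [/\ B Y, B (Y * H), adj H = H & Y * H = H * Y], upos Y,
    un H <= 1, 4 *: (Y * Y) = 2 *: 1 - X - adj X /\ (4 * 'i%C) *: Z = X - adj X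
    & [/\ Z * H = H * Z & (Z * H) *+ 2 + Y * H * (Y * H) = Y * Y]].
Proof.
move=> fB XX XX' BX; have sB := proj1 fB; pose w := X - 1.
have XE : X = w + 1 by rewrite /w subrK.
have wn : adj w * w = w * adj w.
  rewrite /w adjB adj1; transitivity (adj X * X - X - adj X + 1); first by ncring.
  by rewrite XX -{1}XX'; ncring.
have [s [P h]] := specdec_exists fB BX wn.
have XF : X = fc s P (fun z => z + 1).
  by rewrite XE -[w](fcid h) -(fc1 h) fcD.
have aXF : adj X = fc s P (fun z => (z + 1)^*%C) by rewrite XF (fc_adj h).
(* For an eigenvalue z of X - 1, a = cos(theta) and b = sin(theta). *)
pose a (z : R[i]) := 1 + complex.Re z; pose b (z : R[i]) := complex.Im z.
have ab z : z \in s -> a z ^+ 2 + b z ^+ 2 = 1.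
  move=> zs; have := @fc_ge _ _ _ _ _ _ h (fun z => (z + 1)^*%C * (z + 1) - 1) z zs.
  have -> : fc s P (fun z => (z + 1)^*%C * (z + 1) - 1) = 0.
    by rewrite -fcB -(fcM h) -aXF -XF (fc1 h) XX subrr.
  rewrite un0 => h0; have : cn ((z + 1)^*%C * (z + 1) - 1) = 0.
    by apply/eqP; rewrite eq_le h0 cn_ge0.
  move/cn_eq0; rewrite /a /b; case: z {zs h0} => p q /= [h1 _].
  by move: h1; rewrite !addr0; lra.
(* r = sin(theta / 2) and sg * k = cos(theta / 2); where the cosine is 0, the sign is taken to be 1.
   Since r = 0 at z = 0, Y and Y * H lie in B. *)
pose r z := Num.sqrt ((1 - a z) / 2); pose k z := Num.sqrt ((1 + a z) / 2).
pose sg z : R := if 0 <= b z then 1 else -1.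
have r0 z : 0 <= r z := sqrtr_ge0 _; have k0 z : 0 <= k z := sqrtr_ge0 _.
have sg1 z : `|sg z| = 1 by rewrite /sg; case: ifP => _; rewrite ?normrN normr1.
have sgsg z : sg z * sg z = 1 by rewrite /sg; case: ifP => _; lra.
have rr z : z \in s -> r z ^+ 2 = (1 - a z) / 2.
  by move=> zs; rewrite sqr_sqrtr// divr_ge0//; have := ab z zs; nra.
have kk z : z \in s -> k z ^+ 2 = (1 + a z) / 2.
  by move=> zs; rewrite sqr_sqrtr// divr_ge0//; have := ab z zs; nra.
have krb z : z \in s -> sg z * k z * r z = b z / 2.
  move=> zs; have e : (k z * r z) ^+ 2 = (b z / 2) ^+ 2.
    by rewrite exprMn kk// rr//; have := ab z zs; lra.
  have kr0 : 0 <= k z * r z by rewrite mulr_ge0.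
  have : k z * r z = `|b z / 2|.
    by apply/eqP; rewrite -(@eqrXn2 _ 2)// real_normK ?num_real// e.
  rewrite -mulrA => ->; rewrite normrM [`|2^-1|]ger0_norm ?invr_ge0// /sg.
  by case: ifP => b0; [rewrite ger0_norm// mul1r|
    rewrite ltr0_norm ?ltNge ?b0// mulN1r mulNr opprK].
pose Y := fc s P (fun z => (r z)%:C%C).
pose Z := fc s P (fun z => (sg z * k z * r z)%:C%C).
pose H := fc s P (fun z => (sg z * r z / (1 + k z))%:C%C).
have k1 z : 1 + k z != 0 by rewrite gt_eqF// ltr_pwDl.
have r_0 z : z = 0 -> r z = 0.
  by move=> ->; rewrite /r /a /= addr0 subrr mul0r sqrtr0.
have rle z : z \in s -> r z <= 1.
  move=> zs; rewrite -(@ler_pXn2r _ 2) ?nnegrE// rr//; have := ab z zs; nra.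
have fcR (f : R[i] -> R) : adj (fc s P (fun z => (f z)%:C%C)) = fc s P (fun z => (f z)%:C%C).
  by rewrite (fc_adj h); apply: fc_ext => z _; rewrite /= oppr0.
have fcC (f g : R[i] -> R[i]) : fc s P f * fc s P g = fc s P g * fc s P f.
  by rewrite !(fcM h); apply: fc_ext => z _; rewrite mulrC.
exists Y, Z, H; split.
- split; [| |exact: fcR|exact: fcC].
    by apply: (fc_mem h sB) => z _ z0; rewrite r_0.
  by rewrite (fcM h); apply: (fc_mem h sB) => z _ z0; rewrite r_0// mul0r.
- split; first exact: fcR.
  exists 1 => //; rewrite -{1}(fc1 h) fcZ fcB; apply: (fc_le h) => // z zs.
  rewrite -[complex.Re _]/(cn (1%:C%C * 1 - (r z)%:C%C)) mulr1 -rmorphB cnR ger0_norm ?subr_ge0 ?rle//.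
  by rewrite gerBl.
- apply: (fc_le h) => // z zs.
  rewrite -[complex.Re _]/(cn (sg z * r z / (1 + k z))%:C%C) cnR.
  rewrite !normrM sg1 mul1r normfV (ger0_norm (r0 z)) ger0_norm ?addr_ge0//.
  rewrite ler_pdivrMr ?ltr_pwDl// mul1r (le_trans (rle z zs))//.
  by rewrite lerDl.
- have e1 : 2 *: 1 = fc s P (fun=> 2) by rewrite -(fc1 h) fcZ; apply: fc_ext => z _; rewrite mulr1.
  split.
    rewrite (fcM h) fcZ e1 aXF XF !fcB; apply: fc_ext => z zs.
    rewrite -rmorphM -expr2 rr// /a; case: z {zs} => p q /=.
    rewrite -(rmorph_nat (real_complex R) 4) -(rmorph_nat (real_complex R) 2).
    by apply/eqP; rewrite eq_complex /=; apply/andP; split; apply/eqP; field.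
  rewrite fcZ aXF XF fcB; apply: fc_ext => z zs.
  rewrite krb// /b; case: z {zs} => p q.
  rewrite -(rmorph_nat (real_complex R) 4).
  by apply/eqP; rewrite eq_complex /=; apply/andP; split; apply/eqP; field.
- split; first exact: fcC.
  rewrite mulr2n !(fcM h) !fcD; apply: fc_ext => z zs.
  rewrite -!rmorphM -!rmorphD; congr (_%:C%C).
  have e : r z ^+ 2 + k z ^+ 2 = 1 by rewrite rr// kk//; field.
  have g1 := sgsg z; have g2 := k1 z.
  transitivity (r z * r z * (sg z * sg z) * (k z *+ 2 / (1 + k z) + (r z ^+ 2) / (1 + k z) ^+ 2)).
    by field.
  rewrite g1 mulr1 (_ : r z ^+ 2 = 1 - k z ^+ 2); last by lra.
  by field.
Qed.

End ProjectionLifting.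

Ltac clear_ineqs := repeat match goal with H : is_true _ |- _ => clear H end.

Section LiftProjection.
Variables (R : realType) (A : ucstarAlgType R).
Implicit Types (B J P : set A) (u v w x y t G : A).
Local Notation half := (2^-1 : R).

(* A selfadjoint [x] with [x k = 1] and [|k|] close to [1] has no spectrum
   between -1 and 0, so near it [y = x - 1] may be replaced by its positive part. *)
Lemma pos_part_near B y b k (d e : R) : fdalg B -> B b -> adj b = b -> un y <= 1 ->
  (1 + y) * k = 1 -> un k <= 1 + d -> un (y - b) <= e -> 0 <= d -> d <= 10^-1 -> e <= 10^-1 ->
  exists b', [/\ B b', upos b' & un (b' - b) <= d + 2 * e].
Proof.
move=> fB Bb bs y1 yk kd ye d0 d1 e1; have [|s [P h]] := specdec_exists fB Bb; first by rewrite bs.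
have e0 : 0 <= e by apply: le_trans ye; exact: un_ge0.
have bE : b = fc s P id by rewrite (fcid h).
have b1 : un b <= 1 + e by rewrite (le_trans (un_triB b y))// unBC; lra.
have rl z : z \in s -> z = (complex.Re z)%:C%C by exact: (sd_real h bs).
have mu z : z \in s -> - (d + 2 * e) <= complex.Re z <= 1 + e.
  move=> zs; have zb : cn z <= un b by rewrite bE; exact: (@fc_ge _ _ _ _ _ _ h id).
  have zr := rl z zs; rewrite zr cnR in zb; move: zr zb; set m := complex.Re z => zr zb.
  have mb : `|m| <= 1 + e by rewrite (le_trans zb).
  have pp := sd_proj h zs; have /eqP p0 := sd_neq0 h zs.
  (* Inserting (1 + y) k = 1 after the eigenprojection shows that |1 + m| is not much less than 1;
     as |m| <= 1 + e, this keeps m from being far below 0. *)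
  have pE : P z = (1 + m)%:C%C *: (P z * k) + P z * (y - b) * k.
    have pb : P z * b = m%:C%C *: P z by rewrite bE (fc_projl h)// -zr.
    rewrite -{1}[P z]mulr1 -yk.
    transitivity (P z * k + (P z * b) * k + P z * (y - b) * k); first by ncring.
    by rewrite pb; ncring.
  have p1 := isproj_le1 pp.
  have : 1 <= `|1 + m| * (1 + d) + e * (1 + d).
    rewrite (le_trans (isproj_ge1 pp p0))// {1}pE (le_trans (unD _ _))// lerD//.
      rewrite unZ -[complex.Re _]/(cn (1 + m)%:C%C) cnR ler_wpM2l//.
      by rewrite -[1 + d]mul1r; exact: unM_le.
    by apply: unM_le => //; rewrite -[e]mul1r; exact: unM_le.
  move: mb; rewrite ler_norml => /andP[m1 m2] h1; apply/andP; split=> //.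
  have [mm|mm] := leP 0 (1 + m); first by move: h1; rewrite ger0_norm//; nra.
  by move: h1; rewrite ltr0_norm//; nra.
pose f (z : R[i]) : R := Num.max (complex.Re z) 0.
have f01 z : z \in s -> 0 <= f z <= 1 + e.
  move=> zs; have /andP[h1 h2] := mu z zs; rewrite /f le_max lexx orbT /=.
  by rewrite ge_max h2 /=; lra.
exists (fc s P (fun z => (f z)%:C%C)); split.
- by apply: (fc_mem h (proj1 fB)) => z _ ->; rewrite /f maxxx.
- split; first by rewrite (fc_adj h); apply: fc_ext => z _; rewrite /= oppr0.
  exists (1 + e); first lra.
  rewrite -(fc1 h) fcZ fcB; apply: (fc_le h) => [|z zs]; first lra.
  rewrite -[complex.Re _]/(cn ((1 + e)%:C%C * 1 - (f z)%:C%C)) mulr1 -rmorphB cnR.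
  by have /andP[h1 h2] := f01 z zs; rewrite ger0_norm ?subr_ge0// gerBl.
- rewrite bE fcB; apply: (fc_le h) => [|z zs]; first by lra.
  rewrite -[complex.Re _]/(cn ((f z)%:C%C - z)) {2}(rl z zs) -rmorphB cnR.
  have /andP[h1 h2] := mu z zs; rewrite /f.
  by case: (leP (complex.Re z) 0) => hz; [rewrite sub0r normrN ler0_norm//; lra|rewrite subrr normr0; lra].
Qed.

Section Lift.
Variable J : set A.
Hypotheses (sJ : starsub J) (cJ : uclosed J) (LJ : LFset J).
Local Notation I := (idealizer J).

Lemma idealizer_subunital : subunital I.
Proof.
split; [exact: idealizer_linset|exact: idealizer1| |exact: idealizer_uclosed].
exact: (ssM (idealizer_starsub sJ)).
Qed.

(* The lift is [s + D] up to a small error, where [s = 2 t (1 + t^2)^-1] and [D]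
   is computed inside a finite-dimensional algebra from a unitary close to
   [(s + i y)^2]: there the sign of [s] makes sense although it is a
   discontinuous function. *)
Lemma lift_proj_small t : adj t = t -> I t -> J (t * t - 1) -> un t <= 1 + 1000^-1 ->
  exists e, isproj e /\ J (e - half%:C%C *: (1 + t)).
Proof.
move=> ts It Jt t1; have sI := idealizer_starsub sJ; have lI := ss_lin sI.
have I1 : I 1 by exact: idealizer1.
have [G [Gs GE GW]] := inv_one_sq ts.
have IG : I G by apply: (GW I); [exact: idealizer_subunital|exact: (ssM sI)].
have tG : t * G = G * t.
  by apply/esym/(GW [set z | z * t = t * z]); [exact: subunital_comm|rewrite /= mulrA].
have [sy1 s1 y1] := cayley_bound ts Gs tG GE.
set s := (t * G) *+ 2 in sy1 s1; set y := G *+ 2 - 1 in sy1 y1.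
have ss : adj s = s by rewrite /s mulr2n adjD adjM ts Gs tG.
have ys : adj y = y by rewrite /y mulr2n adjB adjD adj1 Gs.
have sy : s * y = y * s.
  rewrite /s /y; transitivity (4 *: (t * G * G) - (t * G) *+ 2); first by ncring.
  transitivity (4 *: (G * t * G) - (t * G) *+ 2); last by ncring.
  by rewrite tG.
have yE : y = - ((t * t - 1) * G).
  rewrite /y -{1}GE; ncring.
have Jy : J y by rewrite yE; apply: (linN sJ); have [_] := IG _ Jt.
have Is : I s by rewrite /s -scaler_nat; apply: (linZ lI); exact: (ssM sI).
have Jsy : J (s * y) by have [] := Is y Jy.
have sys : adj (s * y) = s * y by rewrite adjM ss ys sy.
have ii : 'i%C * 'i%C = -1 :> R[i] by rewrite -expr2 sqr_i.
have ssE : s * s = 1 - y * y by rewrite -sy1 addrK.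
(* u = (s + i y)^2. The square is taken because s is only in the idealizer of J, whereas u - 1 is
   made of y and s y, which lie in J and can be approximated in a finite-dimensional subalgebra of
   J. *)
pose u := 1 - (y * y) *+ 2 + (2 * 'i%C) *: (s * y).
have us : adj u = 1 - (y * y) *+ 2 - (2 * 'i%C) *: (s * y).
  rewrite /u adjD adjB adj1 mulr2n adjD adjM ys adjZ sys -mulr2n.
  have -> : ((2 * 'i%C : R[i])^*)%C = - (2 * 'i%C).
    by rewrite conj_mul conj_i conj_nat mulrN.
  by rewrite scaleNr.
have uu0 : (1 - (y * y) *+ 2) * (1 - (y * y) *+ 2) + 4 *: (s * y * (s * y)) = 1.
  have -> : s * y * (s * y) = (1 - y * y) * (y * y).
    by rewrite -ssE -!mulrA; congr (_ * _); rewrite !mulrA sy.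
  by ncring.
have uu : adj u * u = 1.
  rewrite us -[RHS]uu0 /u.
  have yysy : (y * y) * (s * y) = (s * y) * (y * y) by rewrite -(mulrA y y) (mulrA y s y) -sy -(mulrA s y y) (mulrA y s) -sy.
  transitivity ((1 - (y * y) *+ 2) * (1 - (y * y) *+ 2) - (4 * ('i%C * 'i%C)) *: (s * y * (s * y))
   + (4 * 'i%C) *: ((s * y) * (y * y) - (y * y) * (s * y))); first by ncring.
  by rewrite ii yysy subrr scaler0 addr0 mulrN1 scaleNr opprK.
have uu' : u * adj u = 1.
  rewrite us -[RHS]uu0 /u.
  have yysy : (y * y) * (s * y) = (s * y) * (y * y) by rewrite -(mulrA y y) (mulrA y s y) -sy -(mulrA s y y) (mulrA y s) -sy.
  transitivity ((1 - (y * y) *+ 2) * (1 - (y * y) *+ 2) - (4 * ('i%C * 'i%C)) *: (s * y * (s * y))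
   + (4 * 'i%C) *: ((y * y) * (s * y) - (s * y) * (y * y))); first by ncring.
  by rewrite ii yysy subrr scaler0 addr0 mulrN1 scaleNr opprK.
have u2 : 2 *: 1 - u - adj u = 4 *: (y * y) by rewrite us /u; ncring.
have u3 : u - adj u = (4 * 'i%C) *: (s * y) by rewrite us /u; ncring.
(* eta is the error of approximation; 1 + d bounds the norm of (1 + t^2) / 2, the inverse of 1 +
   y. *)
pose eta : R := 10000^-1; pose d : R := 400^-1.
have eta0 : 0 < eta by rewrite invr_gt0.
have [|B [fB BJ hB]] := @LFset_selfadj _ _ J LJ [:: y; s * y] eta _ eta0.
  by move=> x; rewrite !inE => /orP[] /eqP ->.
have [|b [Bb bs yb]] := hB y; first by rewrite inE eqxx.
have [|c [Bc cs syc]] := hB (s * y); first by rewrite !inE eqxx orbT.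
have sB := proj1 fB.
pose v := 1 - (b * b) *+ 2 + (2 * 'i%C) *: c.
have i2 : cn (2 * 'i%C : R[i]) = 2.
  by rewrite cnM -(rmorph_nat (real_complex R)) cnR ger0_norm// /cn normci mulr1.
have b2 : un b <= 2.
  by rewrite (le_trans (un_triB b y))// unBC; move: yb y1; rewrite /eta; clear_ineqs; lra.
have vu : un (v - u) <= 8 * eta.
  have -> : v - u = ((y - b) * y + b * (y - b)) *+ 2 - (2 * 'i%C) *: (s * y - c).
    by rewrite /v /u; ncring.
  rewrite (le_trans (unB _ _))// unZ -[complex.Re _]/(cn (2 * 'i%C)) i2.
  have h1 := unM_le (ltW yb) y1; have h2 := unM_le b2 (ltW yb).
  have : un ((y - b) * y + b * (y - b)) <= 3 * eta.
    by rewrite (le_trans (unD _ _))//; move: h1 h2; clear_ineqs; lra.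
  move: (ltW syc); rewrite mulr2n.
  by have := unD ((y - b) * y + b * (y - b)) ((y - b) * y + b * (y - b)); clear_ineqs; lra.
have [||X [XX XX' BX Xu]] := unitary_near fB uu uu' _ vu; last 1 first.
- have [Y [Z [H [[BY BYH Hs YH] Yp H1 [Y4 Z4] [ZH YZH]]]]] := unitary_half_angle fB XX XX' BX.
  have aXu : un (adj X - adj u) <= 7 * (8 * eta) by rewrite -adjB un_adj.
  have YY : un (Y * Y - y * y) <= 28 * eta.
    have e4 : (4 : R)%:C%C *: (Y * Y - y * y) = - (X - u) - (adj X - adj u).
      rewrite scalerBr (rmorph_nat (real_complex R)) Y4 -u2; ncring.
    rewrite -(ler_pM2l (ltr0n _ 4 : 0 < 4)) -(unZR _ (ler0n R 4)) e4.
    by rewrite (le_trans (unB _ _))// unN; move: Xu aXu; clear_ineqs; lra.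
  have i4 : cn (4 * 'i%C : R[i]) = 4.
    by rewrite cnM -(rmorph_nat (real_complex R)) cnR ger0_norm// /cn normci mulr1.
  have ZZ : un (Z - s * y) <= 28 * eta.
    have e4 : (4 * 'i%C) *: (Z - s * y) = (X - u) - (adj X - adj u).
      rewrite scalerBr Z4 -u3; ncring.
    rewrite -(ler_pM2l (ltr0n _ 4 : 0 < 4)).
    have -> : 4 * un (Z - s * y) = un ((4 * 'i%C) *: (Z - s * y)).
      by rewrite unZ -[complex.Re _]/(cn (4 * 'i%C)) i4.
    by rewrite e4 (le_trans (unB _ _))//; move: Xu aXu; clear_ineqs; lra.
  pose k := half%:C%C *: (1 + t * t).
  have yk : (1 + y) * k = 1.
    have GE' : G * (1 + t * t) = 1.
      by have := congr1 adj GE; rewrite adjM adjD !adj1 adjM ts Gs.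
    by rewrite -{2}GE' /y /k; ncring.
  have kd : un k <= 1 + d.
    rewrite unZR ?invr_ge0//.
    have h1 := unM_le t1 t1; have := unD 1 (t * t); rewrite un1 /d.
    by move: h1; clear_ineqs; lra.
  have d0 : 0 <= d by rewrite invr_ge0.
  have d1 : d <= 10^-1 by rewrite /d; clear_ineqs; lra.
  have et1 : eta <= 10^-1 by rewrite /eta; clear_ineqs; lra.
  have [b' [Bb' b'p b'b]] := pos_part_near fB Bb bs y1 yk kd (ltW yb) d0 d1 et1.
  have b'y : un (b' - y) <= d + 3 * eta.
    by rewrite (le_trans (un_tri b _ _))// (unBC b y); move: b'b (ltW yb); clear_ineqs; lra.
  (* Y and b' are positive with almost equal squares: Y^2 is close to y^2 by the choice of X, and b'
     is close to y because y is almost positive when |t| is hardly above 1. *)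
  have Yb : un (Y - b') <= 8^-1.
    apply: (sqrt_close fB) => //; [exact: (linB sB)|by rewrite invr_ge0|].
    have -> : Y * Y - b' * b' = (Y * Y - y * y) + ((y - b') * y + b' * (y - b')) by ncring.
    have b'2 : un b' <= 2.
      by rewrite (le_trans (un_triB b' y))//; move: b'y y1; rewrite /eta /d; clear_ineqs; lra.
    rewrite unBC in b'y.
    have h1 := unM_le b'y y1; have h2 := unM_le b'2 b'y.
    rewrite (le_trans (unD _ _))// (le_trans (lerD (lexx _) (unD _ _)))//.
    by move: YY h1 h2; rewrite /eta /d; clear_ineqs; lra.
  have Yy : un (Y - y) <= 7^-1.
    by rewrite (le_trans (un_tri b' _ _))//; move: Yb b'y; rewrite /eta /d; clear_ineqs; lra.
  pose D := Y * H; pose s' := s + D.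
  have Ds : adj D = D by rewrite adjM Hs (proj1 Yp) -YH.
  have JD : J D by apply: BJ.
  have s's : adj s' = s' by rewrite adjD ss Ds.
  (* s plays the part of cos(theta / 2). If Y were y and Z were s y, the identity for Y, Z and H
     would give s'^2 = 1; what remains are these errors. *)
  have e1 : s' * s' - 1 = (Y * Y - y * y) +
      ((s * (Y - y) - (Z - s * y)) * H + adj ((s * (Y - y) - (Z - s * y)) * H)).
    have Zs : adj Z = Z.
      have := congr1 adj Z4; rewrite adjZ adjB adjK.
      have -> : ((4 * 'i%C : R[i])^*)%C = - (4 * 'i%C).
        by rewrite conj_mul conj_i conj_nat mulrN.
      rewrite scaleNr -opprB -Z4 => /oppr_inj; apply: scalerI.
      by rewrite mulf_eq0 pnatr_eq0 /= -normr_eq0 normci oner_eq0.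
    have -> : (s * (Y - y) - (Z - s * y)) * H = s * Y * H - Z * H by ncring.
    rewrite adjB !adjM Zs (proj1 Yp) ss Hs -ZH (mulrA H Y s) -YH -YZH.
    transitivity (s * s - 1 + s * D + D * s + D * D); first by rewrite /s'; ncring.
    by rewrite ssE /D; ncring.
  have h1 : un ((s * (Y - y) - (Z - s * y)) * H) <= (1 * 7^-1 + 28 * eta) * 1.
    by apply: unM_le => //; rewrite (le_trans (unB _ _))// lerD//; apply: unM_le.
  have s'1 : un (s' * s' - 1) <= 2^-1.
    rewrite e1 (le_trans (unD _ _))// (le_trans (lerD (lexx _) (unD _ _)))// un_adj.
    by move: YY h1; rewrite /eta; clear_ineqs; lra.
  pose h := half%:C%C *: (1 + s').
  have hs : adj h = h by rewrite adjZR adjD adj1 s's.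
  have hhE : h * h - h = (4^-1 : R)%:C%C *: (s' * s' - 1) by rewrite /h; ncring.
  have Ih : I h.
    apply: (linZ lI); apply: (linD lI) => //; apply: (linD lI) => //; exact: idealizer_mem.
  have Jhh : J (h * h - h).
    rewrite hhE; apply: (linZ sJ).
    have -> : s' * s' - 1 = - (y * y) + s * D + D * s + D * D.
      by rewrite /s' -sy1; ncring.
    have [? ?] := Is D JD.
    do 3?[apply: (linD sJ) => //]; [apply: (linN sJ)|]; exact: ssM.
  have [|e [pe _ hP]] := near_proj hs.
    by rewrite hhE unZR ?invr_ge0//; move: s'1; clear_ineqs; lra.
  exists e; split=> //.
  have -> : e - half%:C%C *: (1 + t) = (e - h) + half%:C%C *: (t * y + D).
    by rewrite /h /s' /s /y; ncring.
  apply: (linD sJ); last first.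
    by apply: (linZ sJ); apply: (linD sJ) => //; case: (It y Jy).
  (* Modulo J the iteration fixes h, as 3 w^2 - 2 w^3 - w = - (w^2 - w) (2 w - 1). *)
  apply: (hP [set w | J (w - h)]); first exact: uclosed_shift.
    by rewrite /= subrr; exact: lin0 sJ.
  move=> w _ /=; set j := w - h => Jj.
  have wE : w = h + j by rewrite /j addrC subrK.
  have Jww : J (w * w - w).
    have -> : w * w - w = (h * h - h) + h * j + j * h + j * j - j by rewrite wE; ncring.
    have [? ?] := Ih j Jj.
    apply: (linB sJ) => //; apply: (linD sJ); last exact: ssM.
    by do 2?[apply: (linD sJ) => //].
  have Iw : I (w *+ 2 - 1).
    apply: (linB lI) => //; rewrite -scaler_nat; apply: (linZ lI).
    by rewrite wE; apply: (linD lI) => //; exact: idealizer_mem.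
  have -> : w * w *+ 3 - w * w * w *+ 2 - h = - ((w * w - w) * (w *+ 2 - 1)) + j.
    by rewrite /j; ncring.
  by apply: (linD sJ) => //; apply: (linN sJ); have [_] := Iw _ Jww.
- have -> : v - 1 = (2 * 'i%C) *: c - 2 *: (b * b) by rewrite /v; ncring.
  by apply: (linB sB); apply: (linZ sB) => //; exact: ssM.
- by rewrite /eta; clear_ineqs; lra.
Qed.

(** A projection p of J that almost absorbs t^2 - 1 brings the norm of t (1 - p) down to nearly 1
    and changes t only by elements of J; its selfadjoint part satisfies the hypotheses of
    [lift_proj_small]. *)
Lemma lift_proj t : adj t = t -> I t -> J (t * t - 1) ->
  exists e, isproj e /\ J (e - half%:C%C *: (1 + t)).
Proof.
move=> ts It Jt; have sI := idealizer_starsub sJ; have lI := ss_lin sI.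
have pr1 : isproj (1 : A) by split; [exact: adj1|rewrite mulr1].
have [||p [pp Jp _ hp]] := @corner_unit _ _ J sJ cJ LJ 1 [:: t * t - 1] 1000^-1 pr1 (@idealizer1 _ _ J).
- by move=> x; rewrite inE => /eqP ->; rewrite mul1r.
- by rewrite invr_gt0.
have {}hp := hp _ (mem_head _ _); have [ps ppp] := pp; have pc := isprojC pp.
pose t1 := t * (1 - p); pose j := sadj t1 - t.
have Jtp : J (t * p) by case: (It p Jp).
have jE : j = - half%:C%C *: (t * p + adj (t * p)).
  by rewrite /j /sadj /t1 !adjM adjB adj1 ts; ncring.
have Jj : J j.
  rewrite jE; apply: (linZ sJ); apply: (linD sJ) => //; exact: ss_adj.
have tE : sadj t1 = t + j by rewrite /j addrC subrK.
have [|||e [pe Je]] := @lift_proj_small (sadj t1) (sadj_adj t1).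
- by rewrite tE; apply: (linD lI) => //; exact: idealizer_mem.
- rewrite tE; have -> : (t + j) * (t + j) - 1 = (t * t - 1) + t * j + j * t + j * j by ncring.
  have [? ?] := It j Jj.
  by do 3?[apply: (linD sJ) => //]; exact: ssM.
- have t12 : un t1 ^+ 2 <= 1 + 1000^-1.
    rewrite -un_adjM.
    have -> : adj t1 * t1 = (1 - p) * (1 - p) + (1 - p) * ((t * t - 1) - p * (t * t - 1)) * (1 - p).
      rewrite /t1 adjM ts (proj1 pc).
      have cc := proj2 pc.
      transitivity ((1 - p) * (t * t) * (1 - p)); first by ncring.
      have -> : (1 - p) * (t * t - 1 - p * (t * t - 1)) = (1 - p) * (1 - p) * (t * t - 1) by ncring.
      by transitivity ((1 - p) * (1 - p) + (1 - p) * (t * t - 1) * (1 - p)); [ncring|rewrite !cc].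
    rewrite (le_trans (unD _ _))// lerD//.
      by rewrite (proj2 pc); exact: isproj_le1.
    rewrite -[leRHS]mulr1; apply: unM_le; last exact: isproj_le1.
    rewrite -[leRHS]mul1r; apply: unM_le; [exact: isproj_le1|exact: ltW].
  have t11 : un t1 <= 1 + 1000^-1.
    have := un_ge0 t1; move: t12; rewrite expr2; nra.
  rewrite /sadj unZR ?invr_ge0//; have := unD t1 (adj t1); rewrite un_adj; lra.
- exists e; split=> //.
  have -> : e - half%:C%C *: (1 + t) = (e - half%:C%C *: (1 + sadj t1)) + half%:C%C *: j.
    by rewrite tE; ncring.
  by apply: (linD sJ) => //; exact: (linZ sJ).
Qed.

End Lift.
End LiftProjection.

(** * Matrix blocks *)

Section FiniteDimensionalStructure.
Variables (R : realType) (A : ucstarAlgType R).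
Implicit Types (B C : set A) (e f x y : A).
Local Notation half := (2^-1 : R).

Section Structure.
Variable C : set A.
Hypothesis fC : fdalg C.
Let sC : starsub C := proj1 fC.

Definition minproj e := [/\ isproj e, C e, e <> 0 &
  forall c, C c -> exists k : R[i], e * c * e = k *: e].

(** If e C e is not scalar, the real or the imaginary part of a nonscalar element has a spectral
    projection strictly under e, whose corner has smaller dimension. *)
Lemma minproj_exists e : isproj e -> C e -> e <> 0 -> exists f, minproj f.
Proof.
have [_ [n dC]] := fC.
have : dimle n [set c | [/\ C c, e * c = c & c * e = c]].
  by apply: dimle_sub dC => c [].
elim: n {dC} e => [|n IH] e de pe Ce e0.
  by case: e0; apply: (dimle0 de); split=> //; exact: (proj2 pe).
have [|] := pselect (forall c, C c -> exists k : R[i], e * c * e = k *: e); first by exists e.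
move=> /existsNP[c /not_implyP[Cc nk]]; have [es ee] := pe.
pose a := e * c * e.
have Ca : C a by apply: (ssM sC) => //; exact: ssM.
have ea : e * a = a by rewrite /a !mulrA ee.
have ae : a * e = a by rewrite /a -!mulrA ee.
have [b [Cb bs [eb be nb]]] : exists b, [/\ C b, adj b = b &
    [/\ e * b = b, b * e = b & ~ exists k : R[i], b = k *: e]].
  have eadj y : e * y = y -> y * e = y -> e * adj y = adj y /\ adj y * e = adj y.
    by move=> h1 h2; split; rewrite -{1}es -adjM ?h1 ?h2.
  have sad y : C y -> e * y = y -> y * e = y ->
      [/\ C (sadj y), e * sadj y = sadj y & sadj y * e = sadj y].
    move=> Cy h1 h2; have [h3 h4] := eadj y h1 h2; split; first exact: sadj_mem.
      by rewrite /sadj -scalerAr mulrDr h1 h3.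
    by rewrite /sadj -scalerAl mulrDl h2 h4.
  have [C1 e1 e1'] := sad a Ca ea ae.
  have [| |C2 e2 e2'] := sad ('i%C *: a) (linZ sC _ Ca).
  - by rewrite -scalerAr ea.
  - by rewrite -scalerAl ae.
  have [[k1 k1E]|n1] := pselect (exists k : R[i], sadj a = k *: e); last first.
    by exists (sadj a); split=> //; exact: sadj_adj.
  have [[k2 k2E]|n2] := pselect (exists k : R[i], sadj ('i%C *: a) = k *: e); last first.
    by exists (sadj ('i%C *: a)); split=> //; exact: sadj_adj.
  case: nk; exists (k1 - 'i%C * k2); rewrite scalerBl -scalerA -k1E -k2E -/a.
  rewrite /sadj adjZ conj_i.
  transitivity ((half%:C%C - half%:C%C * ('i%C * 'i%C)) *: a
     + (half%:C%C + half%:C%C * ('i%C * 'i%C)) *: adj a); last by ncring.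
  have ii : 'i%C * 'i%C = -1 :> R[i] by rewrite -expr2 sqr_i.
  rewrite ii; ncring.
have [|s [P h]] := specdec_exists fC Cb; first by rewrite bs.
have [z zs z0] : exists2 z, z \in s & z != 0.
  apply: contrapT => hn; apply: nb; exists 0; rewrite scale0r (sd_id h) big_seq big1// => z zs.
  by have [->|z0] := eqVneq z 0; [rewrite scale0r|case: hn; exists z].
have pf := sd_proj h zs; have f0 := sd_neq0 h zs; have Cf := sd_mem h zs z0.
have bf : b * P z = z *: P z by rewrite -{1}(fcid h) (fc_proj h).
have ef : e * P z = P z.
  have -> : P z = b * (z^-1 *: P z) by rewrite -scalerAr bf scalerA mulVf// scale1r.
  by rewrite mulrA eb.
have fe : P z * e = P z by rewrite -{1}(proj1 pf) -es -adjM ef (proj1 pf).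
apply: (IH (P z)) => //; last exact/eqP.
apply: (dimle_proper (x := e)) de => /=.
- split=> [|u v [Cu u1 u2] [Cv v1 v2]|k u [Cu u1 u2]].
  + by split; [exact: lin0 sC|rewrite mulr0|rewrite mul0r].
  + by split; [exact: (linD sC)|rewrite mulrDr u1 v1|rewrite mulrDl u2 v2].
  + by split; [exact: (linZ sC)|rewrite -scalerAr u1|rewrite -scalerAl u2].
- move=> u [Cu u1 u2]; split=> //; first by rewrite -u1 mulrA ef.
  by rewrite -u2 -mulrA fe.
- by split.
- move=> [_ fe' _]; apply: nb; exists z.
  by rewrite -be -fe' fe bf.
Qed.

(** The x_i are an orthonormal basis of C e for the product adj x * y, whose values are multiples of
    e. For a maximal orthonormal family the remainder y of c e is 0: otherwise adj y * y = r e with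
    r > 0, by [adjM_neg], and y / sqrt r could be added. *)
Lemma minproj_basis e : minproj e -> exists n (x : 'I_n -> A),
  [/\ forall i, C (x i), forall i, x i * e = x i,
      forall i j, adj (x i) * x j = (i == j)%:R *: e &
      forall c, C c -> exists k : 'I_n -> R[i], c * e = \sum_i k i *: x i].
Proof.
move=> [pe Ce e0 mine]; have [es ee] := pe; have [_ [n dC]] := fC.
pose Q m (x : 'I_m -> A) := [/\ forall i, C (x i), forall i, x i * e = x i &
  forall i j, adj (x i) * x j = (i == j)%:R *: e].
pose P m := `[< exists x : 'I_m -> A, Q m x >].
have exP : exists m, P m.
  by exists 0%N; apply/asboolP; exists (fun=> 0); split=> -[].
have Pn m : P m -> (m <= n)%N.
  move=> /asboolP[x [Cx xe xx]]; apply: (dC _ x) => // c c0 i.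
  have : adj (x i) * \sum_j c j *: x j = 0 by rewrite c0 mulr0.
  rewrite mulr_sumr (bigD1 i)//= -scalerAr xx eqxx scale1r big1 ?addr0.
    by move/eqP; rewrite scaler_eq0 => /orP[/eqP//|/eqP].
  by move=> j ji; rewrite -scalerAr xx eq_sym (negPf ji) scale0r scaler0.
case: (ex_maxnP exP Pn) => m /asboolP[x [Cx xe xx]] mmax.
exists m, x; split=> // c Cc.
have /choice[k hk] : forall i, exists k : R[i], adj (x i) * (c * e) = k *: e.
  move=> i; have [|k hk] := mine (adj (x i) * c).
    by apply: (ssM sC) => //; exact: (ss_adj sC).
  by exists k; rewrite -hk !mulrA (isproj_adjr pe (xe i)).
exists k; pose y := c * e - \sum_i k i *: x i.
have Cy : C y.
  apply: (linB sC); first exact: ssM.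
  by apply: (lin_sum _ sC) => i _; exact: (linZ sC).
have ye : y * e = y.
  rewrite mulrBl -mulrA ee mulr_suml; congr (_ - _).
  by apply: eq_bigr => i _; rewrite -scalerAl xe.
have xy i : adj (x i) * y = 0.
  rewrite mulrBr hk mulr_sumr (bigD1 i)//= -scalerAr xx eqxx scale1r big1 ?addr0 ?subrr//.
  by move=> j ji; rewrite -scalerAr xx eq_sym (negPf ji) scale0r scaler0.
apply/eqP; rewrite -subr_eq0 -/y; apply/negP => /negP y0.
have [|l lE] := mine (adj y * y); first by apply: ssM => //; exact: (ss_adj sC).
have {}lE : adj y * y = l *: e.
  by rewrite -lE !mulrA (isproj_adjr pe ye) -mulrA ye.
have lr : l = (complex.Re l)%:C%C.
  have : (l - l^*%C) *: e = 0.
    have -> : (l - l^*%C) *: e = l *: e - adj (l *: e) by rewrite adjZ es scalerBl.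
    by rewrite -lE adjM adjK subrr.
  move/eqP; rewrite scaler_eq0 => /orP[|/eqP//].
  by case: (l) => p q /eqP[_ qq]; congr (_ +i* _)%C; move: qq => /=; lra.
rewrite lr in lE; set r := complex.Re l in lE.
have r0 : 0 <= r := adjM_neg fC Cy pe e0 ye lE.
have rn0 : r != 0.
  apply: contraNneq y0 => r00; apply/eqP/un0_eq0/eqP.
  have := un_adjM y; rewrite lE r00 scale0r un0 => /esym/eqP.
  by rewrite expf_eq0.
pose w := ((Num.sqrt r)^-1)%:C%C *: y.
have ww : adj w * w = e.
  rewrite adjZR -scalerAl -scalerAr lE !scalerA -!rmorphM.
  have -> : (Num.sqrt r)^-1 * (Num.sqrt r)^-1 * r = 1.
    by rewrite -invfM -expr2 sqr_sqrtr// mulVf.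
  by rewrite scale1r.
have xw i : adj (x i) * w = 0 by rewrite -scalerAr xy scaler0.
have : P m.+1.
  apply/asboolP; exists (consf w x); split.
  - by apply: (@consf_ind _ _ m w x C) => //; exact: (linZ sC).
  - by apply: (@consf_ind _ _ m w x (fun u => u * e = u)) => //; rewrite -scalerAl ye.
  - move=> i j; rewrite /consf.
    case: (unliftP ord0 i) => [i' ->|->]; case: (unliftP ord0 j) => [j' ->|->].
    + by rewrite xx (inj_eq lift_inj).
    + by rewrite xw eq_sym (negPf (neq_lift _ _)) scale0r.
    + have -> : adj w * x j' = adj (adj (x j') * w) by rewrite adjM adjK.
      by rewrite xw adj0 (negPf (neq_lift _ _)) scale0r.
    + by rewrite ww eqxx scale1r.
by move=> /mmax; rewrite ltnn.
Qed.

(** The sum z of the x_i * adj x_i is the unit of the block. It is central: C z lies in the span of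
    the x_i * adj x_j, so z c z = c z, and adjoints give z c z = z c. C' is the part of C killed by
    z, and it is smaller because it misses z. *)
Lemma block_split : (exists2 c, C c & c <> 0) ->
  exists n (x : 'I_n -> A) e C', 
  [/\ isproj e, C e, forall i, C (x i), forall i, x i * e = x i &
      forall i j, adj (x i) * x j = (i == j)%:R *: e] /\
  [/\ starsub C', C' `<=` C, uclosed C',
      forall m, dimle m.+1 C -> dimle m C' &
      (forall c c', C c -> C' c' -> C' (c * c') /\ C' (c' * c)) /\
      (forall c, C c -> exists k : 'I_n -> 'I_n -> R[i],
        C' (c - \sum_i \sum_j k i j *: (x i * adj (x j))))].
Proof.
move=> [c0 Cc0 c00]; have [e0 [_ [pe0 Ce0 e00 _]]] := fdalg_isproj fC Cc0 c00.
have [e me] := minproj_exists pe0 Ce0 e00; have [pe Ce en0 _] := me.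
have [n [x [Cx xe xx hx]]] := minproj_basis me; have [es ee] := pe.
pose z := \sum_i x i * adj (x i).
have Cz : C z by apply: (lin_sum _ sC) => i _; apply: ssM => //; exact: (ss_adj sC).
have zs : adj z = z by rewrite adj_sum; apply: eq_bigr => i _; rewrite adjM adjK.
have zx j : z * x j = x j.
  rewrite mulr_suml (bigD1 j)//= -mulrA xx eqxx scale1r xe big1 ?addr0// => i ij.
  by rewrite -mulrA xx (negPf ij) scale0r mulr0.
have cz c : C c -> exists k : 'I_n -> 'I_n -> R[i],
    c * z = \sum_i \sum_j k i j *: (x i * adj (x j)).
  move=> Cc; have /choice[k hk] : forall j, exists k : 'I_n -> R[i], c * x j = \sum_i k i *: x i.
    by move=> j; have [|k hk] := hx (c * x j); [exact: ssM|exists k; rewrite -hk -mulrA xe].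
  exists (fun i j => k j i); rewrite exchange_big /= mulr_sumr; apply: eq_bigr => j _.
  by rewrite mulrA hk mulr_suml; apply: eq_bigr => i _; rewrite scalerAl.
have zcz c : C c -> z * (c * z) = c * z.
  move=> /cz[k ->]; rewrite mulr_sumr; apply: eq_bigr => i _.
  rewrite mulr_sumr; apply: eq_bigr => j _.
  by rewrite -scalerAr mulrA zx.
have comm c : C c -> c * z = z * c.
  move=> Cc; have h1 := zcz c Cc; have := zcz _ (ss_adj sC Cc).
  by move/(congr1 adj); rewrite !adjM adjK zs -mulrA h1.
pose C' := C `&` [set c | c * z = 0].
exists n, x, e, C'; split; first by split.
have sC' : starsub C'.
  split; first split.
  - by split; [exact: lin0 sC|rewrite /= mul0r].
  - by move=> u v [Cu /= u0] [Cv /= v0]; split; [exact: (linD sC)|rewrite /= mulrDl u0 v0 addr0].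
  - by move=> k u [Cu /= u0]; split; [exact: (linZ sC)|rewrite /= -scalerAl u0 scaler0].
  - by move=> u v [Cu /= u0] [Cv /= v0]; split; [exact: (ssM sC)|rewrite /= -mulrA v0 mulr0].
  - move=> u [Cu /= u0]; split; first exact: (ss_adj sC).
    by rewrite /= -[LHS]adjK adjM adjK zs -comm// u0 adj0.
split=> //.
- by move=> c [].
- apply: uclosedI; first exact: fdalg_uclosed.
  suff <- : [set c | c * z = c * 0] = [set c | c * z = 0] by exact: uclosed_mulr.
  by apply/seteqP; split=> u /=; rewrite mulr0.
- move=> m; apply: (dimle_proper (ss_lin sC') _ Cz); first by move=> c [].
  move=> [_ /= zz]; apply: en0; have [k] := hx e Ce; rewrite ee => eE.
  have ze : z * e = e.
    by rewrite eE mulr_sumr; apply: eq_bigr => i _; rewrite -scalerAr zx.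
  by rewrite -ze -[X in _ * X]ze mulrA zz mul0r.
- split.
    move=> c c' Cc [Cc' /= c'0]; split; split; try exact: ssM.
      by rewrite /= -mulrA c'0 mulr0.
    by rewrite /= -mulrA comm// mulrA c'0 mul0r.
  move=> c Cc; have [k hk] := cz c Cc; exists k; rewrite -hk; split.
    by apply: (linB sC) => //; exact: ssM.
  by rewrite /= mulrBl -mulrA [z * z](_ : _ = z) ?subrr// mulr_sumr;
    apply: eq_bigr => i _; rewrite mulrA zx.
Qed.

End Structure.
End FiniteDimensionalStructure.

Section SumOfSpans.
Variables (K : fieldType) (V : lmodType K).
Implicit Types S T : set V.

Lemma fspan_dimle (I : finType) (w : I -> V) :
  dimle #|I| [set x | exists k : I -> K, x = \sum_i k i *: w i].
Proof.
have := @span_dimle K V _ (fun i : 'I_#|I| => w (enum_val i)).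
apply: dimle_sub => _ [k ->]; exists (fun i => k (enum_val i)).
by rewrite -(big_enum_val (fun i => k i *: w i)).
Qed.

Lemma dimle_add m n S T : linset S -> linset T -> dimle m S -> dimle n T ->
  exists k, dimle k [set x | exists y z, [/\ S y, T z & x = y + z]].
Proof.
move=> lS lT /(dimle_span lS)[p [b [_ ->]]] /(dimle_span lT)[q [c [_ ->]]].
have := @fspan_dimle ('I_p + 'I_q)%type (fun i => match i with inl j => b j | inr j => c j end).
set k := #|_| => h; exists k; apply: dimle_sub h => _ [_ [_ [[f ->] [g ->] ->]]].
exists (fun i => match i with inl j => f j | inr j => g j end).
by rewrite big_sumType.
Qed.

End SumOfSpans.

(** * A full matrix block modulo an LF ideal *)

Section Block.
Variables (R : realType) (A : ucstarAlgType R).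
Implicit Types (B J : set A).
Local Notation half := (2^-1 : R).
Variables (J M : set A) (n : nat) (x : 'I_n -> A) (e : A).
Hypotheses (sJ : starsub J) (cJ : uclosed J) (LJ : LFset J).
Hypotheses (sM : starsub M) (JM : J `<=` M) (MI : M `<=` idealizer J).
Hypotheses (Mx : forall i, M (x i)) (Me : M e).
Hypotheses (es : J (adj e - e)) (ee : J (e * e - e)) (xe : forall i, J (x i * e - x i)).
Hypothesis xx : forall i j, J (adj (x i) * x j - (i == j)%:R *: e).

Lemma congJM a a' b b' : M a' -> M b -> J (a - a') -> J (b - b') -> J (a * b - a' * b').
Proof.
move=> Ma' Mb ha hb.
have -> : a * b - a' * b' = (a - a') * b + a' * (b - b') by ncring.
by apply: (linD sJ); [case: (MI Mb ha)|case: (MI Ma' hb)].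
Qed.

Lemma congJM_mem a a' : M a -> J (a' - a) -> M a'.
Proof. by move=> Ma h; rewrite -(subrK a a'); apply: (linD sM) => //; exact: JM. Qed.

Lemma congJ_trans b a c : J (a - b) -> J (b - c) -> J (a - c).
Proof.
by move=> h1 h2; rewrite -(subrK b a) -addrA; exact: (linD sJ).
Qed.

Lemma congJ_sym a b : J (a - b) -> J (b - a).
Proof. by move=> h; rewrite -opprB; exact: (linN sJ). Qed.

Lemma congJ_adj a b : J (a - b) -> J (adj a - adj b).
Proof. by move=> h; rewrite -adjB; exact: (ss_adj sJ). Qed.

Lemma lift_block_proj : exists E, isproj E /\ J (E - e).
Proof.
have h1 : J (sadj e - e).
  have -> : sadj e - e = half%:C%C *: (adj e - e) by rewrite /sadj; ncring.
  exact: (linZ sJ).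
have Ms := congJM_mem Me h1.
pose t := sadj e *+ 2 - 1.
have ts : adj t = t by rewrite adjB adj1 mulr2n adjD sadj_adj.
have [||E [pE JE]] := lift_proj sJ cJ LJ ts.
- apply: (linB (ss_lin (idealizer_starsub sJ))); last exact: idealizer1.
  by rewrite -scaler_nat; apply: (linZ (ss_lin (idealizer_starsub sJ))); exact: MI.
- have -> : t * t - 1 = 4 *: (sadj e * sadj e - sadj e) by rewrite /t; ncring.
  apply: (linZ sJ); apply: (congJ_trans (b := e)); last exact: congJ_sym.
  by apply: (congJ_trans (b := e * e)) => //; exact: congJM.
exists E; split=> //; apply: (congJ_trans (b := sadj e)) => //.
by have <- : half%:C%C *: (1 + t) = sadj e by rewrite /t; ncring.
Qed.

(** Gram-Schmidt makes y orthogonal to the earlier X_i, but adj y * y equals E only modulo J,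
    perhaps far from it in norm. Removing from E a projection p of J that almost absorbs the
    difference makes it small, and Newton's iteration from y * E1 finishes. The earlier X_i become
    X_i * E1, so E shrinks at every step. *)
Lemma lift_block (k : nat) : (k <= n)%N ->
  exists E (X : 'I_n -> A), [/\ isproj E, J (E - e),
    forall i : 'I_n, (i < k)%N -> J (X i - x i) /\ X i * E = X i &
    forall i j : 'I_n, (i < k)%N -> (j < k)%N -> adj (X i) * X j = (i == j)%:R *: E].
Proof.
elim: k => [_|k IH kn].
  by have [E [pE JE]] := lift_block_proj; exists E, x; split.
have [E [X [pE JE XE XX]]] := IH (ltnW kn).
have ME := congJM_mem Me JE; have [Es EE] := pE.
pose o := Ordinal kn.
have MX (i : 'I_n) : (i < k)%N -> M (X i).
  by move=> ik; apply: (congJM_mem (Mx i)); case: (XE i ik).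
have Mxo := Mx o.
pose y := (1 - \sum_(i < n | (i < k)%N) X i * adj (X i)) * x o * E.
have Xy (i : 'I_n) : (i < k)%N -> adj (X i) * y = 0.
  move=> ik; rewrite /y !mulrA mulrBr mulr1 mulr_sumr (bigD1 i)//= mulrA XX//.
  rewrite eqxx scale1r (isproj_adjr pE) ?(proj2 (XE i ik))// big1 ?addr0 ?subrr ?mul0r//.
  by move=> j /andP[jk ji]; rewrite mulrA XX// eq_sym (negPf ji) scale0r mul0r.
have yo : J (y - x o).
  have -> : y - x o = (x o * E - x o) -
      (\sum_(i < n | (i < k)%N) X i * (adj (X i) * x o)) * E.
    rewrite /y !mulrBl mul1r addrAC; congr (_ - _ * _).
    by rewrite mulr_suml; apply: eq_bigr => i _; rewrite mulrA.
  apply: (linB sJ).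
    apply: (congJ_trans (b := x o * e)) => //.
    by apply: congJM => //; rewrite ?subrr; exact: lin0 sJ.
  suff : J (\sum_(i < n | (i < k)%N) X i * (adj (X i) * x o)) by move=> /(MI ME)[].
  apply: (lin_sum _ sJ) => i ik.
  suff : J (adj (X i) * x o) by move=> /(MI (MX i ik))[].
  have h : J (adj (X i) * x o - adj (x i) * x o).
    apply: congJM => //; first exact: (ss_adj sM).
      by apply: congJ_adj; case: (XE i ik).
    by rewrite subrr; exact: lin0 sJ.
  have := xx i o; rewrite (_ : i == o = false) ?scale0r ?subr0; last first.
    by apply/eqP => io; move: ik; rewrite io ltnn.
  by move=> h2; rewrite -[_ * _](subrK (adj (x i) * x o)); exact: (linD sJ).
have yE : y * E = y by rewrite /y -!mulrA EE.
have My := congJM_mem Mxo yo.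
pose g := adj y * y - E.
have Jg : J g.
  apply: (congJ_trans (b := adj (x o) * x o)).
    by apply: congJM => //; [exact: (ss_adj sM)|exact: congJ_adj].
  apply: (congJ_trans (b := e)); last exact: congJ_sym.
  by have := xx o o; rewrite eqxx scale1r.
have Eg : E * g = g by rewrite mulrBr mulrA (isproj_adjr pE yE) EE.
have [||p [pp Jp Ep hp]] := @corner_unit _ _ J sJ cJ LJ E [:: g] 4^-1 pE (MI ME).
- by move=> u; rewrite inE => /eqP ->.
- by rewrite invr_gt0.
have {}hp := hp _ (mem_head _ _); have [ps ppp] := pp.
have pE1 : isproj (E - p) := isprojM pE pp Ep.
have pE' : p * E = p by rewrite -ps -Es -adjM Ep.
set E1 := E - p in pE1; have [E1s E1E1] := pE1.
have JE1 : J (E1 - e).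
  by rewrite /E1 addrAC; apply: (linB sJ).
have E1E : E1 * E = E1 by rewrite mulrBl EE pE'.
have EE1 : E * E1 = E1 by rewrite mulrBr EE Ep.
have XE1 u : M u -> u * E = u -> J (u * E1 - u).
  move=> Mu uE; rewrite /E1 mulrBr uE addrAC subrr add0r; apply: (linN sJ).
  by case: (MI Mu Jp).
have E1g : E1 * g = g - p * g by rewrite mulrBl Eg.
clearbody E1.
pose y1 := y * E1.
have y1E1 : y1 * E1 = y1 by rewrite /y1 -mulrA E1E1.
have y1y1 : un (adj y1 * y1 - E1) <= half.
  have -> : adj y1 * y1 - E1 = (g - p * g) * E1.
    by rewrite -E1g /g /y1 adjM E1s mulrBr E1E mulrBl E1E1 !mulrA.
  rewrite (le_trans (unM_le (ltW hp) (isproj_le1 pE1)))//; lra.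
have [z [zz _ hP]] := newton pE1 y1E1 y1y1.
have [[Jz zE1] Xz] : (J (z - x o) /\ z * E1 = z) /\
    forall i : 'I_n, (i < k)%N -> adj (X i) * z = 0.
  apply: (hP [set z | (J (z - x o) /\ z * E1 = z) /\
    forall i : 'I_n, (i < k)%N -> adj (X i) * z = 0]).
  - move=> u hu; split; first split.
    + by apply: (uclosed_shift (a := x o) cJ) => d /hu[v [[? ?] ?] ?]; exists v.
    + rewrite -[RHS]mulr1; apply: (@uclosed_mulr _ A E1 1 u) => d /hu[v [[? vE] ?] ?].
      by exists v => //=; rewrite vE mulr1.
    + move=> i ik; rewrite -[RHS](mul0r u).
      apply: (@uclosed_mull _ A (adj (X i)) 0 u) => d /hu[v [_ vX] ?].
      by exists v => //=; rewrite vX// mul0r.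
  - split; last by move=> i ik; rewrite /y1 mulrA Xy// mul0r.
    split=> //; apply: (congJ_trans (b := y)) => //; exact: XE1.
  - move=> u [[Ju uE] uX]; have Mu := congJM_mem Mxo Ju; split; first split.
    + apply: (congJ_trans (b := u)) => //.
      have -> : nstep u - u = - (half%:C%C *: (u * (adj u * u) - u)).
        by rewrite /nstep; ncring.
      apply: (linN sJ); apply: (linZ sJ).
      apply: (congJ_trans (b := x o * (adj (x o) * x o))).
        have h : J (adj u * u - adj (x o) * x o).
          by apply: congJM => //; [exact: (ss_adj sM)|exact: congJ_adj].
        by apply: congJM => //; apply: (ssM sM) => //; exact: (ss_adj sM).
      apply: (congJ_trans (b := x o)); last exact: congJ_sym.
      apply: (congJ_trans (b := x o * e)) => //.
      apply: congJM => //; first by apply: (ssM sM) => //; exact: (ss_adj sM).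
        by rewrite subrr; exact: lin0 sJ.
      by have := xx o o; rewrite eqxx scale1r.
    + by rewrite /= /nstep -scalerAl mulrBl mulrnAl -(mulrA _ u E1) uE.
    + by move=> i ik; rewrite /nstep -scalerAr mulrBr mulrnAr !mulrA uX// mul0rn !mul0r subrr scaler0.
have ltk (i : 'I_n) : i != o -> (i < k.+1)%N -> (i < k)%N.
  rewrite ltnS leq_eqVlt => io /orP[/eqP ik|//].
  by case/eqP: io; apply: val_inj.
exists E1, (fun i => if i == o then z else X i * E1); split=> //.
- move=> i ik; case: (eqVneq i o) => [->//|io].
  have [h1 h2] := XE i (ltk i io ik).
  by rewrite -mulrA E1E1; split=> //; apply: (congJ_trans (b := X i)) => //; apply: XE1 => //; exact/MX/ltk.
- move=> i j ik jk; case: (boolP (i == o)) => [/eqP ->|io]; case: (boolP (j == o)) => [/eqP ->|jo].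
  + by rewrite zz eqxx scale1r.
  + rewrite eq_sym (negPf jo) scale0r mulrA -[adj z * X j]adjK adjM adjK.
    by rewrite Xz ?adj0 ?mul0r//; exact: ltk.
  + by rewrite adjM -mulrA Xz ?mulr0 ?(negPf io) ?scale0r//; exact: ltk.
  + rewrite adjM E1s -mulrA (mulrA _ (X j)) XX ?ltk// -scalerAl -scalerAr EE1.
    by rewrite E1E1.
Qed.

Hypothesis gM : forall m, M m -> exists k : 'I_n -> 'I_n -> R[i],
  J (m - \sum_i \sum_j k i j *: (x i * adj (x j))).

(** An approximating subalgebra of J and the lifted block need not generate a finite-dimensional
    algebra. A projection r of J separates them: it almost absorbs the errors of the finite set
    modulo the block and commutes with the units X_i * adj X_j. Under r there is the corner r J r;
    off r there is the block with E - q in place of E, orthogonal to that corner. *)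
Lemma block_LF : LFset M.
Proof.
move=> F eps FM eps0.
have [E [X [pE JE XE XX]]] := lift_block (leqnn n).
have {}XX i j : adj (X i) * X j = (i == j)%:R *: E by apply: XX.
have JX i : J (X i - x i) by case: (XE i).
have {}XE i : X i * E = X i by case: (XE i).
have ME := congJM_mem Me JE; have [Es EE] := pE.
have MX i : M (X i) by apply: (congJM_mem (Mx i)).
have MaX i : M (adj (X i)) by exact: (ss_adj sM).
have EX i : E * adj (X i) = adj (X i) by exact: isproj_adjr.
(* The matrix k with q in every slot; [T k 1] lifts the block component. *)
pose T (k : 'I_n -> 'I_n -> R[i]) (q : A) := \sum_i \sum_j k i j *: (X i * q * adj (X j)).
have /choice[k hk] : forall m, exists k : 'I_n -> 'I_n -> R[i], M m -> J (m - T k 1).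
  move=> m; have [Mm|nMm] := pselect (M m); last by exists (fun=> fun=> 0).
  have [k hk] := gM Mm; exists k => _; apply: congJ_trans hk _.
  rewrite -sumrB; apply: (lin_sum _ sJ) => i _; rewrite -sumrB.
  apply: (lin_sum _ sJ) => j _; rewrite -scalerBr mulr1; apply: (linZ sJ).
  by apply: congJM => //; [exact: (ss_adj sM)|exact: congJ_sym|apply/congJ_adj/congJ_sym].
pose jf m := m - T (k m) 1.
pose Z := \sum_i X i * adj (X i).
have Zs : adj Z = Z by rewrite adj_sum; apply: eq_bigr => i _; rewrite adjM adjK.
have ZX i : Z * X i = X i.
  rewrite mulr_suml (bigD1 i)//= -mulrA XX eqxx scale1r XE big1 ?addr0// => j ji.
  by rewrite -mulrA XX (negPf ji) scale0r mulr0.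
have ZZ : Z * Z = Z by rewrite {2}/Z mulr_sumr; apply: eq_bigr => i _; rewrite mulrA ZX.
have pZ : isproj (1 - Z) by apply: isprojC.
have IZ : idealizer J (1 - Z).
  apply: (linB (ss_lin (idealizer_starsub sJ))); first exact: idealizer1.
  by apply: MI; apply: (lin_sum _ sM) => i _; exact: (ssM sM).
(* Adjoints are included so that r almost absorbs the errors on both sides. *)
pose L := map jf F ++ map (fun m => adj (jf m)) F.
have JL m : m \in L -> J m.
  rewrite mem_cat => /orP[] /mapP[f fF ->]; last apply: (ss_adj sJ);
    by apply: hk; exact: FM.
(* m - r m has n + 1 summands, one from 1 - Z and one for each X_i, which share eps / 8. *)
pose eta := eps / (8 * n.+1%:R).
have n0 : 0 < n.+1%:R :> R by rewrite ltr0n.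
have eta0 : 0 < eta by rewrite divr_gt0// mulr_gt0.
have [|r0 [pr0 Jr0 Zr0 hr0]] := corner_unit sJ cJ LJ (F := map (fun m => (1 - Z) * m) L) pZ IZ _ eta0.
  move=> _ /mapP[m /JL Jm ->]; rewrite mulrA (proj2 pZ); split=> //.
  by case: (IZ m Jm).
have [|q [pq Jq Eq hq]] := corner_unit sJ cJ LJ
    (F := flatten [seq [seq adj (X i) * m | i <- enum 'I_n] | m <- L]) pE (MI ME) _ eta0.
  move=> _ /flattenP[_ /mapP[m /JL Jm ->] /mapP[i _ ->]]; rewrite mulrA EX; split=> //.
  by case: (MI (MaX i) Jm).
have [r0s r0r0] := pr0; have [qs qq] := pq.
have r0Z : r0 * (1 - Z) = r0 by have := isproj_adjl pZ Zr0; rewrite r0s.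
have qE : q * E = q by have := isproj_adjl pE Eq; rewrite qs.
have r0X i : r0 * X i = 0 by rewrite -r0Z -mulrA mulrBl mul1r ZX subrr mulr0.
have Xr0 i : adj (X i) * r0 = 0 by rewrite -[LHS]adjK adjM adjK r0s r0X adj0.
(* The same q in each slot is what makes r commute with the units. *)
pose Q := \sum_i X i * q * adj (X i); pose r := r0 + Q.
have QX i : Q * X i = X i * q.
  rewrite mulr_suml (bigD1 i)//= -mulrA XX eqxx scale1r -mulrA qE big1 ?addr0// => j ji.
  by rewrite -mulrA XX (negPf ji) scale0r mulr0.
have rX i : r * X i = X i * q by rewrite mulrDl r0X QX add0r.
have rs : adj r = r.
  by rewrite adjD r0s adj_sum; congr (_ + _); apply: eq_bigr => i _; rewrite !adjM adjK qs mulrA.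
have Xr i : adj (X i) * r = q * adj (X i).
  by rewrite -[LHS]adjK adjM adjK rs rX adjM qs.
have rr : r * r = r.
  rewrite {2}/r mulrDr /Q mulr_sumr; congr (_ + _).
    rewrite mulrDl r0r0 mulr_suml big1 ?addr0// => i _.
    by rewrite -mulrA Xr0 mulr0.
  by apply: eq_bigr => i _; rewrite !mulrA rX -(mulrA (X i)) qq.
have pr : isproj r by [].
have Jr : J r.
  apply: (linD sJ) => //; apply: (lin_sum _ sJ) => i _.
  by have [_] := MI (MaX i) (proj1 (MI (MX i) Jq)).
have X1 i : un (X i) <= 1.
  by rewrite -(@ler_pXn2r _ 2) ?nnegrE ?un_ge0// -un_adjM XX eqxx scale1r expr1n isproj_le1.
have rL m : m \in L -> un (m - r * m) <= eps / 8.
  move=> mL; have -> : m - r * m = ((1 - Z) * m - r0 * ((1 - Z) * m)) +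
      \sum_i X i * (adj (X i) * m - q * (adj (X i) * m)).
    under eq_bigr => i _ do rewrite mulrBr !mulrA.
    rewrite sumrB -!mulr_suml -/Z -/Q (mulrA r0) r0Z /r; ncring.
  rewrite (le_trans (unD _ _))//.
  have -> : eps / 8 = eta + \sum_(i < n) eta.
    rewrite sumr_const card_ord -mulrS -(mulr_natr eta) /eta.
    by rewrite invfM mulrA divfK ?gt_eqF.
  rewrite lerD//; first by apply/ltW/hr0/map_f.
  rewrite (le_trans (un_sum _ _ _))// ler_sum// => i _.
  rewrite -[eta]mul1r; apply: unM_le => //; apply/ltW/hq/flattenP.
  exists [seq adj (X i) * m | i <- enum 'I_n]; first exact: (map_f (fun m => [seq adj (X i) * m | i <- enum 'I_n])).
  by apply: (map_f (fun i => adj (X i) * m)); rewrite mem_enum.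
have jL m : m \in F -> un (jf m - r * jf m * r) <= eps / 4.
  move=> mF; have h1 : un (jf m - r * jf m) <= eps / 8.
    by apply: rL; rewrite mem_cat (map_f jf)//.
  have h2 : un (jf m - jf m * r) <= eps / 8.
    rewrite -un_adj adjB adjM rs; apply: rL; rewrite mem_cat; apply/orP; right.
    exact: (map_f (fun m => adj (jf m))).
  have -> : jf m - r * jf m * r = (jf m - r * jf m) + r * (jf m - jf m * r) by ncring.
  rewrite (le_trans (unD _ _))//.
  by have := unM_le (isproj_le1 pr) h2; lra.
pose B2 := [set u | exists c, u = T c (E - q)].
have [|B1 [fB1 B1J rB1 hB1]] := corner_LF sJ cJ LJ (F := [seq r * m * r | m <- F]) pr Jr _
    (divr_gt0 eps0 (ltr0n _ 2)).
  move=> _ /mapP[m mF ->]; rewrite -(mulrA _ r r) rr !mulrA rr; split=> //.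
  by have [_] := MI (FM m mF) Jr; move=> /(MI (JM Jr))[] .
have [sB1 [d1 dB1]] := fB1.
have B1r u : B1 u -> u * r = u.
  by move=> /(ss_adj sB1)/rB1/(congr1 adj); rewrite adjM adjK rs.
have Tr c u : r * u = u -> T c (E - q) * u = 0.
  move=> ru; rewrite mulr_suml big1// => i _; rewrite mulr_suml big1// => j _.
  rewrite -scalerAl -(mulrA (X i * (E - q))) -ru (mulrA (adj _)) Xr.
  by rewrite -!mulrA (mulrA (E - q)) mulrBl Eq qq subrr mul0r mulr0 scaler0.
have rT c u : u * r = u -> u * T c (E - q) = 0.
  move=> ur; rewrite mulr_sumr big1// => i _; rewrite mulr_sumr big1// => j _.
  rewrite -scalerAr !mulrA -ur -(mulrA u) rX -!mulrA (mulrA q) mulrBr qE qq subrr mul0r.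
  by rewrite !mulr0 scaler0.
have Eqp : (E - q) * (E - q) = E - q by have [] := isprojM pE pq Eq.
have lB2 : linset B2.
  split.
  - exists (fun=> fun=> 0); rewrite /T big1// => i _; rewrite big1// => j _.
    by rewrite scale0r.
  - move=> _ _ [c ->] [c' ->]; exists (fun i j => c i j + c' i j).
    rewrite /T -big_split; apply: eq_bigr => i _; rewrite -big_split /=.
    by apply: eq_bigr => j _; rewrite scalerDl.
  - move=> a _ [c ->]; exists (fun i j => a * c i j).
    rewrite /T scaler_sumr; apply: eq_bigr => i _; rewrite scaler_sumr.
    by apply: eq_bigr => j _; rewrite scalerA.
have sB2 : starsub B2.
  split=> //.
  - move=> _ _ [c ->] [c' ->]; exists (fun i j => \sum_l c i l * c' l j).
    rewrite /T mulr_suml; apply: eq_bigr => i _; rewrite mulr_suml.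
    transitivity (\sum_l \sum_j (c i l * c' l j) *: (X i * (E - q) * adj (X j))); last first.
      by rewrite exchange_big; apply: eq_bigr => j _; rewrite -scaler_suml.
    apply: eq_bigr => l _; rewrite mulr_sumr (bigD1 l)//= [X in _ + X]big1 ?addr0; last first.
      move=> i' il; rewrite mulr_sumr big1// => j _.
      rewrite -scalerAl -scalerAr -!mulrA (mulrA (adj (X l))) XX eq_sym (negPf il).
      by rewrite scale0r mul0r !mulr0 !scaler0.
    rewrite mulr_sumr; apply: eq_bigr => j _.
    rewrite -scalerAl -scalerAr scalerA; congr (_ *: _).
    rewrite -!mulrA (mulrA (adj (X l))) XX eqxx scale1r; congr (_ * _).
    rewrite (mulrA E) (_ : E * (E - q) = E - q); last by rewrite mulrBr EE Eq.
    by rewrite mulrA Eqp.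
  - move=> _ [c ->]; exists (fun i j => (c j i)^*%C).
    rewrite /T adj_sum exchange_big; apply: eq_bigr => i _; rewrite adj_sum.
    by apply: eq_bigr => j _; rewrite adjZ !adjM adjK adjB Es qs mulrA.
have dB2 : dimle #|{: 'I_n * 'I_n}| B2.
  have := @fspan_dimle _ _ ('I_n * 'I_n)%type (fun p => X p.1 * (E - q) * adj (X p.2)).
  apply: dimle_sub => _ [c ->]; exists (fun p => c p.1 p.2).
  by rewrite /T pair_big.
have [d dB] := dimle_add (ss_lin sB1) lB2 dB1 dB2.
exists [set u | exists y z, [/\ B1 y, B2 z & u = y + z]]; split.
- split; last by exists d.
  split; first split.
  + by exists 0, 0; split; [exact: lin0 sB1|exact: lin0 lB2|rewrite addr0].
  + move=> _ _ [a [b [ha hb ->]]] [a' [b' [ha' hb' ->]]]; exists (a + a'), (b + b').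
    by split; [exact: (linD sB1)|exact: (linD lB2)|rewrite addrACA].
  + move=> c _ [a [b [ha hb ->]]]; exists (c *: a), (c *: b).
    by split; [exact: (linZ sB1)|exact: (linZ lB2)|rewrite scalerDr].
  + move=> _ _ [a [b [ha hb ->]]] [a' [b' [ha' hb' ->]]]; exists (a * a'), (b * b').
    split; [exact: (ssM sB1)|exact: (ssM sB2)|].
    have [c bE] := hb; have [c' b'E] := hb'.
    have z1 : a * b' = 0 by rewrite b'E rT// B1r.
    have z2 : b * a' = 0 by rewrite bE Tr// rB1.
    by rewrite mulrDl !mulrDr z1 z2 addr0 add0r.
  + move=> _ [a [b [ha hb ->]]]; exists (adj a), (adj b).
    by split; [exact: (ss_adj sB1)|exact: (ss_adj sB2)|rewrite adjD].
- move=> _ [a [_ [ha [c ->] ->]]]; apply: (linD sM); first exact/JM/B1J.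
  apply: (lin_sum _ sM) => i _; apply: (lin_sum _ sM) => j _; apply: (linZ sM).
  apply: (ssM sM) => //; apply: (ssM sM) => //; apply: (linB sM) => //; exact: JM.
- move=> m mF; have [|b Bb hb] := hB1 (r * m * r); first exact: (map_f (fun m => r * m * r)).
  exists (b + T (k m) (E - q)); first by exists b, (T (k m) (E - q)); split=> //; exists (k m).
  (* The lifted block splits along r: its corner part is absorbed in r m r, the rest lies in B2. *)
  have TE : T (k m) 1 = T (k m) (E - q) + r * T (k m) 1 * r.
    rewrite /T mulr_sumr mulr_suml -big_split; apply: eq_bigr => i _ /=.
    rewrite mulr_sumr mulr_suml -big_split; apply: eq_bigr => j _ /=.
    rewrite -scalerAr -scalerAl -scalerDr mulr1 !mulrA rX -(mulrA _ _ r) Xr.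
    congr (_ *: _); rewrite mulrBr mulrBl XE.
    by rewrite (mulrA (X i * q)) -(mulrA (X i) q q) qq subrK.
  have -> : m - (b + T (k m) (E - q)) = (jf m - r * jf m * r) + (r * m * r - b).
    rewrite {1 2}/jf; have := TE; move: (T (k m) 1) (T (k m) (E - q)) => t1 t2 t1E.
    have -> : t2 = t1 - r * t1 * r by rewrite {1}t1E addrK.
    ncring.
  rewrite (le_lt_trans (unD _ _))//; have := jL m mF; lra.
Qed.

End Block.

(** * Unitization and extensions *)

Section OperatorNorm.
Variables (R : realType) (V : lmodType R[i]) (nu : V -> R).
Hypotheses (nu_ge0 : forall a, 0 <= nu a).
Hypotheses (nuZ : forall k a, nu (k *: a) = cn k * nu a).

(** Serves both the unitization, acting on the algebra, and matrices, acting on row vectors. *)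
Definition opnorm (f : V -> V) : R := sup [set nu (f a) | a in [set a | nu a <= 1]].

Section Bounded.
Variables (f : V -> V) (c : R).
Hypotheses (fZ : forall k a, f (k *: a) = k *: f a).
Hypotheses (fc : forall a, nu (f a) <= c * nu a).

Let nu0 : nu 0 = 0.
Proof. by rewrite -(scale0r 0) nuZ /cn normr0 mul0r. Qed.

Lemma opnorm_has_sup : has_sup [set nu (f a) | a in [set a | nu a <= 1]].
Proof.
split; first by exists (nu (f 0)), 0 => //=; rewrite nu0.
exists `|c| => _ [a /= a1 <-]; rewrite (le_trans (fc _))//.
by have := nu_ge0 a; have := ler_norm c; have := normr_ge0 c; nra.
Qed.

Lemma opnorm_app1 a : nu a <= 1 -> nu (f a) <= opnorm f.
Proof.
by move=> a1; apply: sup_ubound; [case: opnorm_has_sup|exists a].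
Qed.

Lemma opnorm_ge0 : 0 <= opnorm f.
Proof.
by apply: le_trans (nu_ge0 (f 0)) _; apply: opnorm_app1; rewrite nu0.
Qed.

Lemma opnorm_app a : nu (f a) <= opnorm f * nu a.
Proof.
have [a0|a0] := eqVneq (nu a) 0.
  by rewrite (le_trans (fc _))// a0 !mulr0.
have p : 0 < nu a by rewrite lt_neqAle eq_sym a0 nu_ge0.
have cp : cn ((nu a)^-1)%:C%C = (nu a)^-1.
  by rewrite cnR ger0_norm// invr_ge0 nu_ge0.
rewrite -ler_pdivrMr// mulrC -cp -nuZ -fZ; apply: opnorm_app1.
by rewrite nuZ cp mulVf.
Qed.

Lemma opnorm_le d : (forall a, nu a <= 1 -> nu (f a) <= d) -> opnorm f <= d.
Proof.
move=> h; apply: sup_le_ub; first by case: opnorm_has_sup.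
by move=> _ [a /= a1 <-]; exact: h.
Qed.

End Bounded.
End OperatorNorm.

Section Unitization.
Variables (R : realType) (A : cstarAlgType R).
Local Notation half := (2^-1 : R).

Definition unitization : Type := (A * R[i]^o)%type.

HB.instance Definition _ := GRing.Lmodule.on unitization.

Implicit Types (x y z : unitization) (a b : A) (k : R[i]).

Definition uact x a : A := x.1 ** a + x.2 *: a.
Definition umul x y : unitization :=
  (x.1 ** y.1 + y.2 *: x.1 + x.2 *: y.1, x.2 * y.2).
Definition uone : unitization := (0, 1).
Definition ustar x : unitization := (x.1^†, (x.2^*)%C).

Lemma unit_eq x y : x.1 = y.1 -> x.2 = y.2 -> x = y.
Proof. by case: x => ? ?; case: y => ? ? /= -> ->. Qed.

Fact umulA : associative umul.
Proof.
move=> x y z; apply: unit_eq; rewrite /= ?mulrA//.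
rewrite !amulDl !amulDr !amulZl !amulZr !scalerDr !scalerA amulA.
rewrite !addrA [LHS](ACl (1*3*5*2*4*6*7))/=.
by rewrite [z.2 * y.2]mulrC [z.2 * x.2]mulrC.
Qed.

Fact umul1l : left_id uone umul.
Proof.
by move=> x; apply: unit_eq; rewrite /= ?mul1r// amul0l scaler0 !add0r scale1r.
Qed.

Fact umul1r : right_id uone umul.
Proof.
move=> x; apply: unit_eq; rewrite /= ?mulr1//.
by rewrite amul0r scaler0 addr0 add0r scale1r.
Qed.

Fact umulDl : left_distributive umul +%R.
Proof.
move=> x y z; apply: unit_eq; rewrite /= ?mulrDl//.
by rewrite amulDl scalerDr scalerDl !addrA (ACl (1*3*5*2*4*6)).
Qed.

Fact umulDr : right_distributive umul +%R.
Proof.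
move=> x y z; apply: unit_eq; rewrite /= ?mulrDr//.
by rewrite amulDr scalerDr scalerDl !addrA (ACl (1*3*5*2*4*6)).
Qed.

Fact uone_neq0 : uone != 0.
Proof. by apply/eqP => -[] /eqP; rewrite oner_eq0. Qed.

HB.instance Definition _ := GRing.Zmodule_isNzRing.Build unitization
  umulA umul1l umul1r umulDl umulDr uone_neq0.

Fact umulZl k x y : k *: (x * y) = (k *: x) * y.
Proof.
apply: unit_eq; last exact: mulrA.
rewrite /= amulZl !scalerDr !scalerA; congr (_ + _ *: _ + _).
exact: mulrC.
Qed.

HB.instance Definition _ := GRing.Lmodule_isLalgebra.Build R[i] unitization
  umulZl.

Fact umulZr k x y : k *: (x * y) = x * (k *: y).
Proof.
apply: unit_eq; last exact: mulrCA.
rewrite /= amulZr !scalerDr !scalerA; congr (_ + _ + _ *: _).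
exact: mulrC.
Qed.

HB.instance Definition _ := GRing.Lalgebra_isAlgebra.Build R[i] unitization
  umulZr.

Lemma uactZ x k a : uact x (k *: a) = k *: uact x a.
Proof. by rewrite /uact amulZr !scalerA mulrC -scalerA scalerDr scalerA. Qed.

Lemma uactDl x y a : uact (x + y) a = uact x a + uact y a.
Proof. by rewrite /uact amulDl scalerDl addrACA. Qed.

Lemma uactZl k x a : uact (k *: x) a = k *: uact x a.
Proof. by rewrite /uact amulZl scalerDr scalerA. Qed.

Lemma uactM x y a : uact (x * y) a = uact x (uact y a).
Proof.
rewrite /uact /= !amulDl !amulDr !amulZl amulZr !scalerDr scalerA amulA.
by rewrite !addrA.
Qed.

Lemma uact_star x a b : (uact x a)^† ** b = a^† ** uact (ustar x) b.
Proof.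
by rewrite /uact starD starM starZ amulDl amulDr amulZl amulZr !amulA.
Qed.

Lemma uact_le x a : nr (uact x a) <= (nr x.1 + cn x.2) * nr a.
Proof.
by rewrite mulrDl (le_trans (nrD _ _))// lerD ?nrM// nrZ.
Qed.

Definition opn x : R := opnorm (@nr R A) (uact x).

Let nr_pos (a : A) : 0 <= nr a.
Proof. exact: nr_ge0. Qed.

Let nr_scale k a : nr (k *: a) = cn k * nr a.
Proof. exact: nrZ. Qed.

Lemma opn_ge0 x : 0 <= opn x.
Proof. exact (opnorm_ge0 nr_pos nr_scale (uact_le x)). Qed.

Lemma opn_app x a : nr (uact x a) <= opn x * nr a.
Proof. exact (opnorm_app nr_pos nr_scale (uactZ x) (uact_le x) a). Qed.

Lemma opn_app1 x a : nr a <= 1 -> nr (uact x a) <= opn x.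
Proof. exact (@opnorm_app1 _ _ _ nr_pos nr_scale _ _ (uact_le x) a). Qed.

Lemma opn_le x c : (forall a, nr a <= 1 -> nr (uact x a) <= c) -> opn x <= c.
Proof. exact (@opnorm_le _ _ _ nr_pos nr_scale _ _ (uact_le x) c). Qed.

Lemma opnD x y : opn (x + y) <= opn x + opn y.
Proof.
apply: opn_le => a a1; rewrite uactDl (le_trans (nrD _ _))//.
by rewrite lerD// opn_app1.
Qed.

Lemma opnZ_le k x : opn (k *: x) <= cn k * opn x.
Proof.
apply: opn_le => a a1; rewrite uactZl nrZ ler_wpM2l ?cn_ge0//.
exact: opn_app1.
Qed.

Lemma opnZ k x : opn (k *: x) = cn k * opn x.
Proof.
apply/eqP; rewrite eq_le opnZ_le /=.
have [->|k0] := eqVneq k 0; first by rewrite /cn normr0 mul0r opn_ge0.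
have ck : cn k != 0 by apply: contra_neq k0 => /cn_eq0.
have ck0 : 0 < cn k by rewrite lt_neqAle eq_sym ck cn_ge0.
rewrite -ler_pdivlMl//; have := opnZ_le k^-1 (k *: x).
rewrite scalerA mulVf// scale1r.
suff -> : cn k^-1 = (cn k)^-1 by [].
by apply: (mulfI ck); rewrite -cnM mulfV// mulfV// /cn normr1.
Qed.

Lemma opnM x y : opn (x * y) <= opn x * opn y.
Proof.
apply: opn_le => a a1; rewrite uactM (le_trans (opn_app _ _))//.
by rewrite ler_wpM2l ?opn_ge0// opn_app1.
Qed.

Lemma opn_sq_le x : opn x ^+ 2 <= opn (ustar x * x).
Proof.
rewrite -[leRHS]sqr_sqrtr ?opn_ge0// ler_sqr ?nnegrE ?opn_ge0 ?sqrtr_ge0//.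
apply: opn_le => a a1; rewrite -(@ler_pXn2r _ 2) ?nnegrE ?nr_ge0 ?sqrtr_ge0//.
rewrite sqr_sqrtr ?opn_ge0// -nr_star_amul uact_star -uactM.
rewrite (le_trans (nrM _ _))// nr_star (le_trans (ler_wpM2l _ (opn_app1 _ a1)))//.
by rewrite -[leRHS]mul1r ler_wpM2r// opn_ge0.
Qed.

Lemma ustarK : involutive ustar.
Proof. by move=> x; apply: unit_eq; rewrite /= ?starK// conjcK. Qed.

Lemma opn_ustar x : opn (ustar x) = opn x.
Proof.
have le y : opn y <= opn (ustar y).
  have := le_trans (opn_sq_le y) (opnM _ _); rewrite expr2.
  have := opn_ge0 y; rewrite le0r => /orP[/eqP -> _|y0]; first exact: opn_ge0.
  by rewrite ler_pM2r.
by apply/eqP; rewrite eq_le (le x) andbT -{2}(ustarK x) le.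
Qed.

Lemma opn_adjM x : opn (ustar x * x) = opn x ^+ 2.
Proof.
apply/eqP; rewrite eq_le opn_sq_le andbT (le_trans (opnM _ _))//.
by rewrite opn_ustar expr2.
Qed.

(** The norm of the action on A may vanish on a nonzero element: if A has a unit p, then p - 1 acts
    by 0. The maximum with the modulus of the scalar part, which is also a C*-seminorm, cures
    this. *)
Definition unrm x : R := Num.max (cn x.2) (opn x).

Definition uembed a : unitization := (a, 0).

Lemma opn_uembed a : opn (uembed a) = nr a.
Proof.
apply/eqP; rewrite eq_le; apply/andP; split.
  apply: opn_le => b b1; rewrite (le_trans (uact_le _ _))//=.
  by rewrite /cn normr0 addr0 -[leRHS]mulr1 ler_wpM2l// nr_ge0.
have := opn_app (uembed a) a^†; rewrite /uact /= scale0r addr0.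
rewrite -{1}(starK a) nr_star_amul nr_star expr2.
have := nr_ge0 a; rewrite le0r => /orP[/eqP -> _|a0]; first exact: opn_ge0.
by rewrite ler_pM2r.
Qed.

Fact unrm0_eq0 x : unrm x = 0 -> x = 0.
Proof.
move=> x0; have : unrm x <= 0 by rewrite x0.
rewrite /unrm ge_max => /andP[k0 o0].
have xk : x.2 = 0 by apply: cn_eq0; apply/eqP; rewrite eq_le k0 cn_ge0.
have xE : x = uembed x.1 by exact: unit_eq.
apply: unit_eq => //; apply: nr0_eq0; apply/eqP; rewrite eq_le nr_ge0 andbT.
by rewrite -opn_uembed -xE.
Qed.

Fact unrmD x y : unrm (x + y) <= unrm x + unrm y.
Proof.
rewrite /unrm ge_max (le_trans (cnD _ _)) ?lerD ?le_max ?lexx//=.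
by rewrite (le_trans (opnD _ _))// lerD// le_max lexx orbT.
Qed.

Fact unrmZ k x : unrm (k *: x) = complex.Re `|k| * unrm x.
Proof. by rewrite /unrm opnZ -[(k *: x).2]/(k * x.2) cnM -maxr_pMr// cn_ge0. Qed.

Fact unrmM x y : unrm (x * y) <= unrm x * unrm y.
Proof.
rewrite /unrm ge_max; apply/andP; split.
  by rewrite cnM ler_pM ?cn_ge0// le_max lexx.
by rewrite (le_trans (opnM _ _))// ler_pM ?opn_ge0// le_max lexx orbT.
Qed.

Fact ustarD : {morph ustar : x y / x + y}.
Proof. by move=> x y; apply: unit_eq; rewrite /= ?starD ?rmorphD. Qed.

Fact ustarZ k x : ustar (k *: x) = (k^*)%C *: ustar x.
Proof. by apply: unit_eq; [exact: starZ|exact: conj_mul]. Qed.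

Fact ustarM x y : ustar (x * y) = ustar y * ustar x.
Proof.
apply: unit_eq; last by rewrite /= conj_mul mulrC.
by rewrite /= !starD starM !starZ addrAC.
Qed.

Lemma cn_conj k : cn (k^*)%C = cn k.
Proof. by rewrite /cn normcJ. Qed.

Fact unrm_adjM x : unrm (ustar x * x) = unrm x ^+ 2.
Proof.
rewrite /unrm opn_adjM cnM /= cn_conj -expr2.
have [h|h] := leP (cn x.2) (opn x).
  by rewrite max_r// ler_sqr ?nnegrE ?cn_ge0 ?opn_ge0.
by rewrite max_l// ler_sqr ?nnegrE ?cn_ge0 ?opn_ge0 ?ltW.
Qed.

Lemma unrm_le x : unrm x <= nr x.1 + cn x.2.
Proof.
rewrite /unrm ge_max lerDr nr_ge0 /=; apply: opn_le => a a1.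
rewrite (le_trans (uact_le _ _))// -[leRHS]mulr1 ler_wpM2l//.
by rewrite addr_ge0 ?nr_ge0 ?cn_ge0.
Qed.

(** The component in A is x minus a scalar, and each of the two contributes at most [unrm x]. *)
Lemma nr1_le x : nr x.1 <= 2 * unrm x.
Proof.
have xE : uembed x.1 = x + - x.2 *: 1.
  by apply: unit_eq; rewrite /= ?scaler0 ?addr0// scaleNr [x.2 *: _]mulr1 subrr.
rewrite -opn_uembed xE (le_trans (opnD _ _))// opnZ.
have o1 : opn 1 <= 1.
  by apply: opn_le => a a1; rewrite /uact /= amul0l scale1r add0r.
have cN : cn (- x.2) = cn x.2 by rewrite /cn normrN.
rewrite mulr_natl mulr2n lerD//; first by rewrite le_max lexx orbT.
rewrite cN (le_trans (ler_wpM2l (cn_ge0 _) o1))// mulr1.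
by rewrite le_max lexx.
Qed.

Fact unrm_complete (u : nat -> unitization) :
  (forall n, unrm (u n.+1 - u n) <= half ^+ n) ->
  exists l, forall n, unrm (l - u n) <= 16 * half ^+ n.
Proof.
move=> ru.
have [|k hk] := @complex_rapid R (fun n => (u n).2).
  by move=> n; apply: le_trans (ru n); rewrite le_max lexx.
(* Differences of first components are bounded by 2 / 2^n only, so the sequence is halved and its
   limit doubled. *)
have [|l hl] := @rapid_limit R A (fun n => (half)%:C%C *: (u n).1).
  move=> n; rewrite -scalerBr nrZ -/(cn _) cnR ger0_norm ?invr_ge0//.
  by have := nr1_le (u n.+1 - u n); have := ru n; rewrite /=; lra.
exists (2 *: l, k) => n; rewrite (le_trans (unrm_le _))//=.
have -> : 2 *: l - (u n).1 = 2 *: (l - half%:C%C *: (u n).1).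
  rewrite scalerBr scalerA -(rmorph_nat (real_complex R)) -rmorphM /=.
  by rewrite mulfV ?pnatr_eq0// scale1r.
rewrite nrZ normr_nat -(rmorph_nat (real_complex R)) /=.
by have := hl n; have := hk n; rewrite /=; have := half_gt0 R n; lra.
Qed.

HB.instance Definition _ := Algebra_isUCStar.Build R unitization
  unrm0_eq0 unrmD unrmZ unrmM ustarK ustarD ustarZ ustarM unrm_adjM
  unrm_complete.

Lemma un_uembed a : un (uembed a) = nr a.
Proof.
rewrite -[LHS]/(unrm _) /unrm opn_uembed max_r// /cn normr0.
exact: nr_ge0.
Qed.

Lemma uembedD a b : uembed (a + b) = uembed a + uembed b.
Proof. by apply: unit_eq => //=; rewrite addr0. Qed.

Lemma uembedB a b : uembed (a - b) = uembed a - uembed b.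
Proof. by apply: unit_eq => //=; rewrite subr0. Qed.

Lemma uembedZ k a : uembed (k *: a) = k *: uembed a.
Proof. by apply: unit_eq => //=; rewrite scaler0. Qed.

Lemma uembedM a b : uembed (a ** b) = uembed a * uembed b.
Proof. by apply: unit_eq => /=; rewrite ?mulr0// !scale0r !addr0. Qed.

Lemma uembed_star a : uembed a^† = adj (uembed a).
Proof. by apply: unit_eq; [|exact/esym/conjc0]. Qed.

End Unitization.

Section Transfer.
Variables (R : realType) (A : cstarAlgType R) (U : ucstarAlgType R) (j : A -> U).
Hypotheses (jD : {morph j : x y / x + y}) (jZ : forall k, {morph j : x / k *: x}).
Hypotheses (jM : forall x y, j (x ** y) = j x * j y).
Hypotheses (jS : forall x, j x^† = adj (j x)).

Lemma cstar_fdalg (B : set A) :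
  cstar_subalgebra B -> finite_dim B -> fdalg (j @` B).
Proof.
move=> [B0 BD BZ BM BS _] [n [b BE]]; split; last first.
  exists n; apply: dimle_image; first by move=> k x y; rewrite jD jZ.
  by rewrite BE; exact: span_dimle.
have j0 : j 0 = 0 by rewrite -(scale0r 0) jZ scale0r.
split; first split.
- by exists 0.
- by move=> _ _ [x Bx <-] [y By <-]; exists (x + y); [exact: BD|rewrite jD].
- by move=> k _ [x Bx <-]; exists (k *: x); [exact: BZ|rewrite jZ].
- by move=> _ _ [x Bx <-] [y By <-]; exists (x ** y); [exact: BM|rewrite jM].
- by move=> _ [x Bx <-]; exists x^†; [exact: BS|rewrite jS].
Qed.

Lemma LF_LFset : (forall x, un (j x) = nr x) -> LF A -> LFset (range j).
Proof.
move=> jn LA F e Fj e0.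
have [s Fs] : exists s : seq A, F = [seq j x | x <- s].
  elim: F Fj => [|y F IH] Fj; first by exists [::].
  have [|s ->] := IH; first by move=> x xF; apply: Fj; rewrite inE xF orbT.
  by have [|x _ <-] := Fj y; [rewrite inE eqxx|exists (x :: s)].
have [|B [sB fB hB]] := LA [set` s] e _ e0; first exact: finite_seq.
exists (j @` B); split; [exact: cstar_fdalg|by move=> _ [x _ <-]; exists x|].
move=> y; rewrite Fs => /mapP[x xs ->]; have [b Bb xb] := hB x xs.
exists (j b); first by exists b.
rewrite -scaleN1r -jZ -jD jn scaleN1r.
by move: xb; rewrite nrE ltcR.
Qed.

End Transfer.

Section FdSubalgebras.
Variables (R : realType) (A : cstarAlgType R).
Local Notation uembed := (@uembed R A).

Lemma closedP_nr (B : set A) :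
  (forall x, (forall e : R, 0 < e -> exists2 y, B y & nr (x - y) < e) -> B x) <->
  closed B.
Proof.
split=> [h x cx|cB x h].
  apply: h => e e0; have [|y [By]] := cx (ball x (e%:C%C)).
    by apply: nbhsx_ballx; rewrite ltcR.
  by rewrite nr_ball => xy; exists y.
apply: cB => V /nbhs_ballP[e /= e0 sV].
have eE := ge0_ReE (ltW e0).
have /h[y By xy] : 0 < complex.Re e by rewrite -ltcR -eE.
by exists y; split => //; apply: sV; rewrite eE nr_ball.
Qed.

Lemma fdalg_cstar (B : set (unitization A)) : fdalg B -> B `<=` range uembed ->
  cstar_subalgebra (uembed @^-1` B) /\ finite_dim (uembed @^-1` B).
Proof.
move=> fB Bi; have [sB [n dB]] := fB; split.
  split => /=.
  - by have := lin0 sB.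
  - by move=> x y Bx By; rewrite uembedD; exact: (linD sB).
  - by move=> k x Bx; rewrite uembedZ; exact: (linZ sB).
  - by move=> x y Bx By; rewrite uembedM; exact: ssM.
  - by move=> x Bx; rewrite uembed_star; exact: ss_adj.
  apply/closedP_nr => x h; apply: (fdalg_uclosed fB) => e /h[y By xy].
  by exists (uembed y) => //; rewrite -uembedB un_uembed.
have dB' : dimle n (uembed @^-1` B).
  have -> : uembed @^-1` B = fst @` B.
    apply/seteqP; split=> [x Bx|_ [x Bx <-]]; first by exists (uembed x).
    by have [a _ ax] := Bi _ Bx; rewrite /= -ax /= ax.
  by apply: dimle_image dB.
have [|m [b [_ bE]]] := dimle_span _ dB'; last by exists m, b.
split=> [|x y Bx By|k x Bx] /=; first exact: (lin0 sB).
- by rewrite uembedD; exact: (linD sB).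
- by rewrite uembedZ; exact: (linZ sB).
Qed.

End FdSubalgebras.

Lemma uclosed_preimage (R : realType) (U W : ucstarAlgType R) (f : U -> W)
    (c : R) (P : set W) :
  (forall x y, un (f x - f y) <= c * un (x - y)) -> uclosed P ->
  uclosed (f @^-1` P).
Proof.
move=> hf cP x h; apply: cP => e e0.
have c0 : 0 < `|c| + 1 by rewrite ltr_wpDl.
have [|y Py xy] := h (e / (`|c| + 1)); first by rewrite divr_gt0.
exists (f y) => //; apply: le_lt_trans (hf x y) _.
move: xy; rewrite ltr_pdivlMr//; have := un_ge0 (x - y); have := ler_norm c.
nra.
Qed.

Section Extension.
Variables (R : realType) (A : cstarAlgType R) (I : closedIdeal A).
Local Notation U := (unitization A).
Local Notation Q := (unitization (quotAlg I)).
Implicit Types (x y : U) (z : Q) (C : set Q).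

Definition upi x : Q := (quot_pi I x.1, x.2).
(** A mere set-theoretic section: the hypotheses of [block_LF] are congruences, so matrix units may
    be lifted arbitrarily. *)
Definition ulift z : U := (repr z.1, z.2).

Lemma upiK z : upi (ulift z) = z.
Proof. by apply: unit_eq => //; exact: quot_pi_repr. Qed.

Lemma quot_piZE k (a : A) : quot_pi I (k *: a) = k *: quot_pi I a.
Proof. exact/esym/quot_piZ. Qed.

Lemma quot_piME (a b : A) : quot_pi I (a ** b) = quot_pi I a ** quot_pi I b.
Proof. exact/esym/quot_piM. Qed.

Lemma upiD : {morph upi : x y / x + y}.
Proof. by move=> x y; apply: unit_eq => //; exact: quot_piD. Qed.

Lemma upiZ k : {morph upi : x / k *: x}.
Proof. by move=> x; apply: unit_eq => //; exact: quot_piZE. Qed.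

Lemma upiM : {morph upi : x y / x * y}.
Proof.
by move=> x y; apply: unit_eq => //=; rewrite !quot_piD !quot_piZE quot_piME.
Qed.

Lemma upi_adj x : upi (adj x) = adj (upi x).
Proof. by apply: unit_eq => //=; exact/esym/quot_pi_star. Qed.

Lemma upi0 : upi 0 = 0.
Proof. by rewrite -(scale0r 0) upiZ scale0r. Qed.

Lemma upiB x y : upi (x - y) = upi x - upi y.
Proof. by rewrite upiD -scaleN1r upiZ scaleN1r. Qed.

Lemma upi_sum n (F : 'I_n -> U) : upi (\sum_i F i) = \sum_i upi (F i).
Proof. exact: (big_morph _ upiD upi0). Qed.

(** Any Lipschitz constant makes preimages of closed sets closed. *)
Lemma upi_le x : un (upi x) <= 3 * un x.
Proof.
rewrite (le_trans (unrm_le _))//=.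
have := quot_norm_le I x.1; have := nr1_le x.
have : cn x.2 <= un x by rewrite -[leRHS]/(unrm _) le_max lexx.
rewrite -[nr (quot_pi I _)]/(quot_norm _) -[unrm x]/(un x); lra.
Qed.

Lemma starsub_preimage C : starsub C -> starsub (upi @^-1` C).
Proof.
move=> sC; split; first split.
- by rewrite /= upi0; exact: (lin0 sC).
- by move=> x y Cx Cy; rewrite /= upiD; exact: (linD sC).
- by move=> k x Cx; rewrite /= upiZ; exact: (linZ sC).
- by move=> x y Cx Cy; rewrite /= upiM; exact: ssM.
- by move=> x Cx; rewrite /= upi_adj; exact: ss_adj.
Qed.

Hypothesis LI : LF (idealAlg I).

Lemma LFset_preimage n C : starsub C -> C `<=` range (@uembed R (quotAlg I)) ->
  dimle n C -> LFset (upi @^-1` C).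
Proof.
have base C0 : starsub C0 -> ~ (exists2 c, C0 c & c <> 0) -> LFset (upi @^-1` C0).
  move=> sC0 nC.
  have -> : upi @^-1` C0 = range (fun a : idealAlg I => uembed (val a)).
    apply/seteqP; split=> [x C0x|_ [a _ <-]].
      have x0 : upi x = 0 by apply: contrapT => x0; apply: nC; exists (upi x).
      have Ix : ideal_set I x.1.
        have /(congr1 fst) /= := x0; rewrite -(quot_pi0 I) => /quot_piP.
        by rewrite subr0.
      by exists (toIdeal Ix) => //; apply: unit_eq => //; have /(congr1 snd) := x0.
    rewrite /=; have -> : upi (uembed (val a)) = 0; last exact: (lin0 sC0).
    apply: unit_eq => //=; rewrite -(quot_pi0 I); apply/quot_piP; rewrite subr0.
    exact: idealAlgP.
  apply: LF_LFset => //; first by move=> a b; rewrite -uembedD.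
  - by move=> k a; rewrite -uembedZ.
  - by move=> a b; rewrite -uembedM.
  - by move=> a; rewrite -uembed_star.
  - by move=> a; rewrite un_uembed.
elim: n C => [|n IH] C sC Ci dC;
    have [C0|nC0] := pselect (exists2 c, C c & c <> 0).
- by have [c /(dimle0 dC)] := C0.
- exact: base.
- have [m [x [e [C' [[pe Ce Cx xe xx] [sC' C'C cC' dC' [C'I xg]]]]]]] :=
    block_split (conj sC (ex_intro (fun k => dimle k C) _ dC)) C0.
  have [es ee] := pe.
  apply: (@block_LF _ _ (upi @^-1` C') (upi @^-1` C) m (ulift \o x) (ulift e)).
  + exact: starsub_preimage.
  + apply: (@uclosed_preimage _ _ _ upi 3) => // y y'.
    by rewrite -upiB upi_le.
  + apply: IH => //; [by apply: subset_trans Ci|exact: dC'].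
  + exact: starsub_preimage.
  + by move=> y /= /C'C.
  + move=> y /= Cy w /= Cw; rewrite !upiM.
    by have [] := C'I _ _ Cy Cw.
  + by move=> i /=; rewrite upiK.
  + by rewrite /= upiK.
  + by rewrite /= upiB upi_adj upiK es subrr; exact: (lin0 sC').
  + by rewrite /= upiB upiM upiK ee subrr; exact: (lin0 sC').
  + by move=> i; rewrite /= upiB upiM !upiK xe subrr; exact: (lin0 sC').
  + move=> i k; rewrite /= upiB upiM upiZ upi_adj !upiK xx subrr.
    exact: (lin0 sC').
  + move=> y /= /xg[k hk]; exists k; rewrite upiB upi_sum.
    under eq_bigr => i _.
      rewrite upi_sum; under eq_bigr => l _ do rewrite upiZ upiM upi_adj !upiK.
    over.
    exact: hk.
- exact: base.
Qed.

Lemma LF_extension : LF (quotAlg I) -> LF A.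
Proof.
move=> LQ F eps fF eps0; have e2 : 0 < eps / 2 by rewrite divr_gt0.
have [|B [sB fB hB]] := LQ (quot_pi I @` F) _ _ e2; first exact: finite_image.
pose C := @uembed R (quotAlg I) @` B.
have fC : fdalg C.
  by apply: cstar_fdalg => //; [exact: uembedD|exact: uembedZ|exact: uembedM|exact: uembed_star].
have Ci : C `<=` range (@uembed R (quotAlg I)) by move=> _ [q _ <-]; exists q.
have [sC [n dC]] := fC.
have LC := LFset_preimage sC Ci dC.
(* The quotient norm is an infimum over lifts, so a can be moved by less than eps / 2 to an element
   whose class lies in B. *)
have /choice[g hg] a : exists b, F a -> (upi @^-1` C) (uembed b) /\ nr (a - b) < eps / 2.
  have [Fa|nF] := pselect (F a); last by exists a.
  have [|b Bq] := hB (quot_pi I a); first by exists a.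
  rewrite nrE ltcR -[nr _]/(quot_norm _) -subr_gt0 => d0.
  have [c cE hc] := quot_norm_lt (quot_pi I a - b) d0.
  exists (a - c) => _; split.
    exists b => //; apply: unit_eq => //=.
    by rewrite quot_piB cE opprB addrC subrK.
  by rewrite opprB addrC subrK; lra.
have [s Fs] := (finite_seqP F).1 fF.
have [|B2 [fB2 B2C hB2]] := LC [seq uembed (g a) | a <- s] _ _ e2.
  by move=> _ /mapP[a aS ->]; have [] := hg a; rewrite ?Fs.
have B2i : B2 `<=` range (@uembed R A).
  move=> x /B2C[q _ qx]; exists x.1 => //; apply: unit_eq => //=.
  by have /(congr1 snd) := qx.
have [cB2 dB2] := fdalg_cstar fB2 B2i.
exists (@uembed R A @^-1` B2); split => // a Fa.
have [|b Bb] := hB2 (uembed (g a)); first by apply: map_f; move: Fa; rewrite Fs.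
have [b' _ bE] := B2i _ Bb; rewrite -bE -uembedB un_uembed => hb.
exists b'; first by rewrite /= bE.
rewrite nrE ltcR; have := nr_triangle (g a) a b'; have [_] := hg _ Fa; lra.
Qed.

End Extension.

(** * Two by two matrices *)

Section Mat2.
Variable R : realType.
Local Notation C := (R[i]).
Local Notation half := (2^-1 : R).
Implicit Types (p q : 'rV[C]_2).

Lemma cn_sq (z : C) : cn z ^+ 2 = complex.Re z ^+ 2 + complex.Im z ^+ 2.
Proof.
apply: complexI; rewrite rmorphXn /= -cnE sqr_normc; case: z => a b.
by apply/eqP; rewrite eq_complex /=; apply/andP; split; apply/eqP; ring.
Qed.

(* The Euclidean norm of C^2 is the modulus of the complex number whose real and
   imaginary parts are the moduli of the coordinates. *)
Definition hn p : R := cn (Complex (cn (p 0 0)) (cn (p 0 1))).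

Lemma hn_sq p : hn p ^+ 2 = cn (p 0 0) ^+ 2 + cn (p 0 1) ^+ 2.
Proof.
exact: cn_sq.
Qed.

Lemma hn_ge0 p : 0 <= hn p.
Proof. exact: cn_ge0. Qed.

Lemma hn_le p (c : R) : 0 <= c -> cn (p 0 0) ^+ 2 + cn (p 0 1) ^+ 2 <= c ^+ 2 ->
  hn p <= c.
Proof.
by move=> c0 h; rewrite -(@ler_pXn2r _ 2) ?nnegrE ?hn_ge0// hn_sq.
Qed.

Lemma hnZ k p : hn (k *: p) = cn k * hn p.
Proof.
apply/eqP; rewrite -(@eqrXn2 _ 2) ?mulr_ge0 ?cn_ge0//.
by rewrite exprMn !hn_sq !mxE !cnM !exprMn mulrDr.
Qed.

Lemma hnD p q : hn (p + q) <= hn p + hn q.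
Proof.
apply: le_trans (cnD _ _); apply: hn_le; first exact: cn_ge0.
rewrite !mxE [leRHS]cn_sq /=.
by apply: lerD; rewrite ler_sqr ?nnegrE ?addr_ge0 ?cn_ge0// cnD.
Qed.

Lemma cn_le_hn p k : cn (p 0 k) <= hn p.
Proof.
rewrite -(@ler_pXn2r _ 2) ?nnegrE ?hn_ge0 ?cn_ge0// hn_sq.
have := sqr_ge0 (cn (p 0 0)); have := sqr_ge0 (cn (p 0 1)).
by case: k => [[|[|//]] h]; [have -> : Ordinal h = 0 by exact: val_inj
  |have -> : Ordinal h = 1 by exact: val_inj]; lra.
Qed.

Lemma hn_le_add p : hn p <= cn (p 0 0) + cn (p 0 1).
Proof.
apply: hn_le; first by rewrite addr_ge0 ?cn_ge0.
by have := cn_ge0 (p 0 0); have := cn_ge0 (p 0 1); nra.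
Qed.

Definition hdot p q : C := p 0 0 * (q 0 0)^*%C + p 0 1 * (q 0 1)^*%C.

Lemma hdot_le p q : cn (hdot p q) <= hn p * hn q.
Proof.
apply: (le_trans (cnD _ _)); rewrite !cnM !cn_conj.
rewrite -(@ler_pXn2r _ 2) ?nnegrE ?mulr_ge0 ?addr_ge0 ?mulr_ge0 ?cn_ge0 ?hn_ge0//.
rewrite exprMn !hn_sq.
move: (cn _) (cn _) (cn _) (cn _) => a b c d.
by have := sqr_ge0 (a * d - c * b); nra.
Qed.

Lemma hdotpp p : cn (hdot p p) = hn p ^+ 2.
Proof.
have -> : hdot p p = (hn p ^+ 2)%:C%C.
  by rewrite hn_sq /hdot -!sqr_normc !cnE rmorphD !rmorphXn.
by rewrite cnR ger0_norm// exprn_ge0// hn_ge0.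
Qed.

Definition mat2 : Type := 'M[C]_2.
HB.instance Definition _ := GRing.Algebra.on mat2.
Implicit Types (x y : mat2).

Definition madj x : mat2 := (map_mx conjc x)^T.

Definition mn x : R := opnorm hn (fun p => p *m x).

Definition entries x : R := (cn (x 0 0) + cn (x 0 1)) + (cn (x 1 0) + cn (x 1 1)).

Lemma row2E p x j : (p *m x) 0 j = p 0 0 * x 0 j + p 0 1 * x 1 j.
Proof.
rewrite mxE big_ord_recl big_ord1.
by have -> : lift ord0 ord0 = 1 :> 'I_2 by exact: val_inj.
Qed.

Lemma hn_entries p x : hn (p *m x) <= entries x * hn p.
Proof.
apply: (le_trans (hn_le_add _)).
have E k : cn ((p *m x) 0 k) <= (cn (x 0 k) + cn (x 1 k)) * hn p.
  rewrite row2E mulrDl (le_trans (cnD _ _))// !cnM.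
  by rewrite ![cn _ * hn p]mulrC lerD// ler_wpM2r ?cn_ge0// cn_le_hn.
have := E 0; have := E 1; rewrite /entries; lra.
Qed.

Let rowZ x k p : (k *: p) *m x = k *: (p *m x).
Proof. exact/esym/scalemxAl. Qed.

Lemma mn_ge0 x : 0 <= mn x.
Proof. exact (opnorm_ge0 hn_ge0 hnZ (fun p => hn_entries p x)). Qed.

Lemma mn_app x p : hn (p *m x) <= mn x * hn p.
Proof. exact (opnorm_app hn_ge0 hnZ (rowZ x) (fun p => hn_entries p x) p). Qed.

Lemma mn_app1 x p : hn p <= 1 -> hn (p *m x) <= mn x.
Proof.
exact (@opnorm_app1 _ _ _ hn_ge0 hnZ _ _ (fun p => hn_entries p x) p).
Qed.

Lemma mn_le x c : (forall p, hn p <= 1 -> hn (p *m x) <= c) -> mn x <= c.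
Proof.
exact (@opnorm_le _ _ _ hn_ge0 hnZ _ _ (fun p => hn_entries p x) c).
Qed.

Lemma mn_le_entries x : mn x <= entries x.
Proof.
apply: mn_le => p p1; rewrite (le_trans (hn_entries _ _))//.
by rewrite -[leRHS]mulr1 ler_wpM2l// !addr_ge0 ?cn_ge0.
Qed.

Lemma entry_le_mn x i j : cn (x i j) <= mn x.
Proof.
have -> : x i j = row i (x : 'M_2) 0 j by rewrite mxE.
rewrite rowE.
apply: (le_trans (cn_le_hn _ _)); apply: mn_app1; apply: hn_le => //.
have cb (b : bool) : cn b%:R = b%:R by case: b; rewrite /cn ?normr1 ?normr0.
rewrite !mxE !cb expr1n; case: i => -[|[|//]] h.
  by rewrite /= !expr0n !expr1n addr0.
by rewrite /= !expr0n !expr1n add0r.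
Qed.

Fact mn0_eq0 x : mn x = 0 -> x = 0.
Proof.
move=> x0; apply/matrixP => i j; rewrite mxE; apply: cn_eq0.
by apply/eqP; rewrite eq_le cn_ge0 -x0 entry_le_mn.
Qed.

Fact mnD x y : mn (x + y) <= mn x + mn y.
Proof.
apply: mn_le => p p1; rewrite mulmxDr (le_trans (hnD _ _))//.
by rewrite lerD// mn_app1.
Qed.

Lemma mnZ_le k x : mn (k *: x) <= cn k * mn x.
Proof.
apply: mn_le => p p1; rewrite -scalemxAr hnZ ler_wpM2l ?cn_ge0//.
exact: mn_app1.
Qed.

Fact mnZ k x : mn (k *: x) = complex.Re `|k| * mn x.
Proof.
apply/eqP; rewrite eq_le mnZ_le andTb.
have [->|k0] := eqVneq k 0; first by rewrite normr0 mul0r mn_ge0.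
have ck : cn k != 0 by apply: contra_neq k0 => /cn_eq0.
have ck0 : 0 < cn k by rewrite lt_neqAle eq_sym ck cn_ge0.
rewrite -/(cn _) -ler_pdivlMl//; have := mnZ_le k^-1 (k *: x).
rewrite scalerA mulVf// scale1r.
suff -> : cn k^-1 = (cn k)^-1 by [].
by apply: (mulfI ck); rewrite -cnM mulfV// mulfV// /cn normr1.
Qed.

Fact mnM x y : mn (x * y) <= mn x * mn y.
Proof.
apply: mn_le => p p1; rewrite -[x * y]/(x *m y) mulmxA (le_trans (mn_app _ _))//.
by rewrite mulrC ler_wpM2r ?mn_ge0// mn_app1.
Qed.

Fact madjK : involutive madj.
Proof. by move=> x; apply/matrixP => i j; rewrite !mxE conjcK. Qed.

Fact madjD : {morph madj : x y / x + y}.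
Proof. by move=> x y; apply/matrixP => i j; rewrite !mxE rmorphD. Qed.

Fact madjZ k x : madj (k *: x) = (k^*)%C *: madj x.
Proof. by apply/matrixP => i j; rewrite !mxE conj_mul. Qed.

Fact madjM x y : madj (x * y) = madj y * madj x.
Proof. by rewrite /madj map_mxM trmx_mul. Qed.

Lemma hdot_madj p q x : hdot (p *m x) q = hdot p (q *m madj x).
Proof.
have conj_add (z w : C) : ((z + w)^*)%C = (z^*)%C + (w^*)%C by exact: rmorphD.
by rewrite /hdot !row2E !mxE !conj_add !conj_mul !conjcK; ring.
Qed.

(** Matrices act on rows from the right, so Cauchy-Schwarz for p x leads to x * madj x; the usual
    order of the factors follows by [mn_madj]. *)
Lemma mn_sq_le x : mn x ^+ 2 <= mn (x * madj x).
Proof.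
rewrite -[leRHS]sqr_sqrtr ?mn_ge0// ler_sqr ?nnegrE ?mn_ge0 ?sqrtr_ge0//.
apply: mn_le => p p1; rewrite -(@ler_pXn2r _ 2) ?nnegrE ?hn_ge0 ?sqrtr_ge0//.
rewrite [leRHS]sqr_sqrtr ?mn_ge0// -hdotpp hdot_madj -mulmxA.
apply: (le_trans (hdot_le _ _)); have := mn_app1 (x * madj x) p1.
have := hn_ge0 (p *m (x *m madj x)); have := hn_ge0 p.
rewrite -[x * madj x]/(x *m madj x); move: p1; nra.
Qed.

Lemma mn_madj x : mn (madj x) = mn x.
Proof.
have le y : mn y <= mn (madj y).
  have := le_trans (mn_sq_le y) (mnM _ _); rewrite expr2.
  have := mn_ge0 y; rewrite le0r => /orP[/eqP -> _|y0]; first exact: mn_ge0.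
  by rewrite ler_pM2l.
by apply/eqP; rewrite eq_le (le x) andbT -{2}(madjK x) le.
Qed.

Fact mn_adjM x : mn (madj x * x) = mn x ^+ 2.
Proof.
apply/eqP; rewrite eq_le; apply/andP; split.
  by rewrite (le_trans (mnM _ _))// mn_madj expr2.
by have := mn_sq_le (madj x); rewrite madjK mn_madj.
Qed.

Fact mn_complete (u : nat -> mat2) :
  (forall n, mn (u n.+1 - u n) <= half ^+ n) ->
  exists l, forall n, mn (l - u n) <= 16 * half ^+ n.
Proof.
move=> ru.
have /choice[l hl] (ij : 'I_2 * 'I_2) :
    exists l, forall n, cn (l - u n ij.1 ij.2) <= 4 * half ^+ n.
  apply: complex_rapid => n; apply: le_trans (ru n).
  by have := entry_le_mn (u n.+1 - u n) ij.1 ij.2; rewrite !mxE.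
exists (\matrix_(i, j) l (i, j)) => n; apply: (le_trans (mn_le_entries _)).
(* Four entries, each within 4 / 2^n of its limit, account for the constant 16. *)
have h i j := hl (i, j) n; rewrite /entries !mxE.
by have := h 0 0; have := h 0 1; have := h 1 0; have := h 1 1; rewrite /=; lra.
Qed.

HB.instance Definition _ := Algebra_isUCStar.Build R mat2
  mn0_eq0 mnD mnZ mnM madjK madjD madjZ madjM mn_adjM mn_complete.

Lemma mat2_dimle : dimle #|{: 'I_2 * 'I_2}| [set: mat2].
Proof.
have := @fspan_dimle _ mat2 ('I_2 * 'I_2)%type (fun ij => delta_mx ij.1 ij.2).
apply: dimle_sub => x _; exists (fun ij => x ij.1 ij.2).
by rewrite {1}[x]matrix_sum_delta pair_bigA.
Qed.

Definition mx2 (a b c d : C) : mat2 :=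
  \matrix_(i, j) (if i == 0 then (if j == 0 then a else b)
                  else (if j == 0 then c else d)).

Lemma mx2M a b c d a' b' c' d' : mx2 a b c d * mx2 a' b' c' d' =
  mx2 (a * a' + b * c') (a * b' + b * d') (c * a' + d * c') (c * b' + d * d').
Proof.
apply/matrixP => i j; rewrite !mxE big_ord_recl big_ord1 !mxE /=.
by case: ifP => _; case: ifP.
Qed.

Lemma madj_mx2 a b c d : madj (mx2 a b c d) = mx2 (a^*)%C (c^*)%C (b^*)%C (d^*)%C.
Proof.
by apply/matrixP => i j; rewrite !mxE; case: ifP => _; case: ifP.
Qed.

Definition mat2v : mat2 := mx2 1 0 0 0.

(* The projection onto the line of (t, 1), with t = 2^-n. *)
Definition mat2w n : mat2 :=
  let t : R := half ^+ n in
  ((1 + t ^+ 2)^-1)%:C%C *: mx2 (t ^+ 2)%:C%C t%:C%C t%:C%C 1.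

Lemma mat2v_isproj : isproj mat2v.
Proof.
split; first by rewrite /adj /= madj_mx2 conjc0 conjc1.
by rewrite mx2M !(mul0r, mulr0, addr0, mulr1).
Qed.

Lemma mat2w_isproj n : isproj (mat2w n).
Proof.
rewrite /mat2w; set t := half ^+ n; set k := (1 + _)^-1.
have conjR (u : R) : ((u%:C)^*)%C = u%:C%C by rewrite /= oppr0.
have adjE a b c d : adj (mx2 a b c d) = mx2 (a^*)%C (c^*)%C (b^*)%C (d^*)%C.
  exact: madj_mx2.
split; first by rewrite adjZ adjE !conjR.
have k1 : k * (1 + t ^+ 2) = 1 by rewrite mulVf// gt_eqF// ltr_pwDl// sqr_ge0.
have sq : mx2 (t ^+ 2)%:C%C t%:C%C t%:C%C 1 * mx2 (t ^+ 2)%:C%C t%:C%C t%:C%C 1 =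
    (1 + t ^+ 2)%:C%C *: mx2 (t ^+ 2)%:C%C t%:C%C t%:C%C 1.
  rewrite mx2M; apply/matrixP => i j; rewrite !mxE.
  by case: ifP => _; case: ifP => _; apply/eqP; rewrite eq_complex /=;
    apply/andP; split; apply/eqP; ring.
by rewrite -scalerAl -scalerAr sq !scalerA -mulrA -rmorphM k1 mulr1.
Qed.

Lemma mat2vw_neq0 n : mat2v * mat2w n != 0.
Proof.
rewrite /mat2w -scalerAr mx2M; set t := half ^+ n.
have t0 : 0 < t by exact: half_gt0.
rewrite scaler_eq0 negb_or; apply/andP; split.
  rewrite -(rmorph0 (real_complex R)) (inj_eq (@complexI R)) invr_eq0 gt_eqF//.
  by rewrite ltr_pwDl// sqr_ge0.
apply/eqP => /matrixP/(_ 0 1); rewrite !mxE /= mul0r addr0 mul1r.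
by move/(congr1 (@complex.Re R)) => /= t00; move: t0; rewrite t00 ltxx.
Qed.

Lemma mat2vw_le n : un (mat2v * mat2w n) <= 2 * half ^+ n.
Proof.
rewrite /mat2w -scalerAr mx2M; set t := half ^+ n.
have t0 : 0 < t by exact: half_gt0.
have t1 : t <= 1 by apply: exprn_ile1; lra.
rewrite unZ -/(cn _) cnR.
have c0 : cn (0 : C) = 0 by rewrite /cn normr0.
have k1 : `|(1 + t ^+ 2)^-1| <= 1.
  rewrite ger0_norm ?invr_ge0 ?addr_ge0 ?sqr_ge0// invf_le1 ?ler_wpDr ?sqr_ge0//.
  by rewrite ltr_pwDl// sqr_ge0.
apply: (@le_trans _ _ (entries (mx2 t%:C%C t%:C%C 0 0))); last first.
  by rewrite /entries !mxE /= !c0 !cnR !(ger0_norm (ltW t0)); lra.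
apply: le_trans (_ : 1 * un _ <= _); first by apply: ler_wpM2r => //; exact: un_ge0.
rewrite mul1r; apply: le_trans (mn_le_entries _) _.
rewrite /entries !mxE /= !mul0r !addr0 !mul1r !c0 !cnR.
rewrite !(ger0_norm (ltW t0)) ger0_norm ?sqr_ge0//.
move: t0 t1; clearbody t; nra.
Qed.

End Mat2.

(** * Algebras of bounded functions *)

(** The point [fa_pt] makes X nonempty, so that the supremum norm is a least upper bound. *)
Record funAlgebra (R : realType) (X : Type) (M : ucstarAlgType R) := FunAlgebra {
  fa_set :> set (X -> M);
  fa_pt : X;
  fa_bounded : forall f, fa_set f -> exists c, forall x, un (f x) <= c;
  fa0 : fa_set 0;
  faD : forall f g, fa_set f -> fa_set g -> fa_set (f + g);
  faZ : forall (k : R[i]) f, fa_set f -> fa_set (k *: f);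
  faM : forall f g, fa_set f -> fa_set g -> fa_set (fun x => f x * g x);
  fa_adj : forall f, fa_set f -> fa_set (fun x => adj (f x));
  fa_closed : forall f, (forall e : R, 0 < e ->
    exists2 g, fa_set g & forall x, un (f x - g x) <= e) -> fa_set f
}.

Section FunctionAlgebra.
Variables (R : realType) (X : Type) (M : ucstarAlgType R) (P : funAlgebra X M).
Local Notation half := (2^-1 : R).

Definition fa_pred : {pred X -> M} := fun f => `[< fa_set P f >].

Lemma fa_predP f : reflect (fa_set P f) (f \in fa_pred).
Proof. exact: asboolP. Qed.

Fact fa_submod_closed : submod_closed fa_pred.
Proof.
split; first exact/fa_predP/fa0.
move=> k f g /fa_predP Pf /fa_predP Pg; apply/fa_predP.
by apply: faD => //; exact: faZ.
Qed.

HB.instance Definition _ := GRing.isSubmodClosed.Build R[i] (X -> M) fa_pred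
  fa_submod_closed.

Definition funAlg : Type := {f : X -> M | f \in fa_pred}.

HB.instance Definition _ := SubChoice.on funAlg.
HB.instance Definition _ := [SubChoice_isSubLmodule of funAlg by <:].

Implicit Types (f g h : funAlg) (k : R[i]).

Definition ev (x : X) f : M := val f x.

Lemma funAlgP f : fa_set P (val f).
Proof. exact/fa_predP/(valP f). Qed.

Definition toFun (f : X -> M) (Pf : fa_set P f) : funAlg :=
  exist (fun g : X -> M => g \in fa_pred) f (introT (fa_predP f) Pf).

Lemma fun_eq f g : (forall x, ev x f = ev x g) -> f = g.
Proof. by move=> fg; apply: val_inj; apply/funext => x; exact: fg. Qed.

Lemma evD x f g : ev x (f + g) = ev x f + ev x g.
Proof. by rewrite /ev raddfD. Qed.

Lemma evZ x k f : ev x (k *: f) = k *: ev x f.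
Proof. by rewrite /ev linearZ. Qed.

Definition fnorm f : R := sup (range (fun x => un (ev x f))).

Lemma fnorm_has_sup f : has_sup (range (fun x => un (ev x f))).
Proof.
split; first by exists (un (ev (fa_pt P) f)), (fa_pt P).
by have [c hc] := fa_bounded (funAlgP f); exists c => _ [x _ <-]; exact: hc.
Qed.

Lemma ev_le x f : un (ev x f) <= fnorm f.
Proof. by apply: sup_ubound; [case: (fnorm_has_sup f)|exists x]. Qed.

Lemma fnorm_le f (c : R) : (forall x, un (ev x f) <= c) -> fnorm f <= c.
Proof.
move=> h; apply: sup_le_ub; first by case: (fnorm_has_sup f).
by move=> _ [x _ <-]; exact: h.
Qed.

Lemma fnorm_ge0 f : 0 <= fnorm f.
Proof. exact: le_trans (un_ge0 _) (ev_le (fa_pt P) f). Qed.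

Lemma fnormD f g : fnorm (f + g) <= fnorm f + fnorm g.
Proof.
apply: fnorm_le => x; rewrite evD (le_trans (unD _ _))//.
by rewrite lerD// ev_le.
Qed.

Lemma fnormZ k f : fnorm (k *: f) = complex.Re `|k| * fnorm f.
Proof.
rewrite -/(cn k); apply/eqP; rewrite eq_le; apply/andP; split.
  apply: fnorm_le => x; rewrite evZ unZ -/(cn k) ler_wpM2l ?cn_ge0//.
  exact: ev_le.
have [->|k0] := eqVneq k 0.
  by rewrite {1}/cn normr0 mul0r fnorm_ge0.
have ck : cn k != 0 by apply: contra_neq k0 => /cn_eq0.
have ck0 : 0 < cn k by rewrite lt_neqAle eq_sym ck cn_ge0.
rewrite -ler_pdivlMl//; apply: fnorm_le => x.
by rewrite ler_pdivlMl// -/(cn k) -unZ -evZ ev_le.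
Qed.

Fact funAlg_ler_normD f g :
  (fnorm (f + g))%:C%C <= (fnorm f)%:C%C + (fnorm g)%:C%C.
Proof. by rewrite -rmorphD lecR fnormD. Qed.

Fact funAlg_normrZ k f : (fnorm (k *: f))%:C%C = `|k| * (fnorm f)%:C%C.
Proof. by rewrite fnormZ rmorphM; congr (_ * _); apply/esym/ge0_ReE. Qed.

Fact funAlg_normr0_eq0 f : (fnorm f)%:C%C = 0 -> f = 0.
Proof.
move=> [f0]; apply: fun_eq => x; rewrite [RHS]/ev /=; apply: un0_eq0.
by apply/eqP; rewrite eq_le un_ge0 -f0 ev_le.
Qed.

HB.instance Definition _ := Lmodule_isNormed.Build R[i] funAlg
  funAlg_ler_normD funAlg_normrZ funAlg_normr0_eq0.

Lemma nr_fun f : nr f = fnorm f.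
Proof. by []. Qed.

Lemma evB x f g : ev x (f - g) = ev x f - ev x g.
Proof. by rewrite evD -scaleN1r evZ scaleN1r. Qed.

Fact funAlg_complete (F : set_system funAlg) :
  ProperFilter F -> cauchy F -> cvg F.
Proof.
apply: rapid_complete => u ru.
have hev x : exists l, forall n, un (l - ev x (u n)) <= 16 * half ^+ n.
  apply: un_complete => n; rewrite -evB.
  by apply: le_trans (ev_le _ _) _; exact: ru.
have [l hl] := choice hev.
have Pl : fa_set P l.
  apply: fa_closed => e e0; have [|n hn] := @half_lt R (e / 16).
    by rewrite divr_gt0.
  exists (val (u n)); first exact: funAlgP.
  by move=> x; apply: le_trans (hl x n) _; move: hn; lra.
(* The pointwise limits come with the constant 16, too large for [rapid_complete]; comparing with u
   (n + m) and letting m grow improves it to 2. *)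
have hu n m : nr (u (n + m)%N - u n) <= 2 * half ^+ n by exact: rapidP.
exists (toFun Pl) => n; rewrite nr_fun; apply: fnorm_le => x.
rewrite evB [ev x _]/=; apply/ler_addgt0Pr => e e0.
have [|m hm] := @half_lt R (e / 16); first by rewrite divr_gt0.
apply: le_trans (un_tri (ev x (u (n + m)%N)) _ _) _; rewrite -evB.
have := hl x (n + m)%N; have := hu n m; rewrite nr_fun.
have := ev_le x (u (n + m)%N - u n); have := half_ge0 R n.
have : half ^+ (n + m) <= half ^+ m.
  by rewrite exprD ler_piMl ?half_ge0// exprn_ile1//; lra.
move: hm; rewrite /ev /=; lra.
Qed.

HB.instance Definition _ := Uniform_isComplete.Build funAlg funAlg_complete.

Definition fmul f g : funAlg := toFun (faM (funAlgP f) (funAlgP g)).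
Definition fstar f : funAlg := toFun (fa_adj (funAlgP f)).

Fact fmulA : associative fmul.
Proof. by move=> f g h; apply: fun_eq => x; exact: mulrA. Qed.
Fact fmulDl : left_distributive fmul +%R.
Proof. by move=> f g h; apply: fun_eq => x; exact: mulrDl. Qed.
Fact fmulDr : right_distributive fmul +%R.
Proof. by move=> f g h; apply: fun_eq => x; exact: mulrDr. Qed.
Fact fmulZl k f g : fmul (k *: f) g = k *: fmul f g.
Proof. by apply: fun_eq => x; apply/esym/scalerAl. Qed.
Fact fmulZr k f g : fmul f (k *: g) = k *: fmul f g.
Proof. by apply: fun_eq => x; apply/esym/scalerAr. Qed.
Fact funAlg_ler_mul f g : `|fmul f g| <= `|f| * `|g|.
Proof.
rewrite !nrE -rmorphM lecR !nr_fun; apply: fnorm_le => x.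
by apply: le_trans (unM _ _) _; apply: ler_pM; rewrite ?un_ge0 ?ev_le.
Qed.
Fact fstarK : involutive fstar.
Proof. by move=> f; apply: fun_eq => x; exact: adjK. Qed.
Fact fstarD : {morph fstar : f g / f + g}.
Proof. by move=> f g; apply: fun_eq => x; exact: adjD. Qed.
Fact fstarZ k f : fstar (k *: f) = (k^*)%C *: fstar f.
Proof. by apply: fun_eq => x; exact: adjZ. Qed.
Fact fstarM f g : fstar (fmul f g) = fmul (fstar g) (fstar f).
Proof. by apply: fun_eq => x; exact: adjM. Qed.
Fact funAlg_normr_star f : `|fmul (fstar f) f| = `|f| ^+ 2.
Proof.
rewrite !nrE -rmorphXn; congr (_%:C)%C; rewrite !nr_fun.
apply/eqP; rewrite eq_le; apply/andP; split.
  apply: fnorm_le => x; rewrite /ev /= un_adjM.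
  by rewrite ler_sqr ?nnegrE ?un_ge0 ?fnorm_ge0// (ev_le x f).
rewrite -[leRHS]sqr_sqrtr ?fnorm_ge0// ler_sqr ?nnegrE ?fnorm_ge0 ?sqrtr_ge0//.
apply: fnorm_le => x; rewrite -(@ler_pXn2r _ 2) ?nnegrE ?un_ge0 ?sqrtr_ge0//.
rewrite [leRHS]sqr_sqrtr ?fnorm_ge0// -un_adjM.
exact: (ev_le x (fmul (fstar f) f)).
Qed.

HB.instance Definition _ :=
  CompleteNormedModule_isCStarAlgebra.Build R funAlg
    fmulA fmulDl fmulDr fmulZl fmulZr funAlg_ler_mul fstarK fstarD fstarZ
    fstarM funAlg_normr_star.

Lemma evM x f g : ev x (f ** g) = ev x f * ev x g.
Proof. by []. Qed.

Lemma ev_star x f : ev x f^† = adj (ev x f).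
Proof. by []. Qed.

Lemma ev0 x : ev x 0 = 0.
Proof. by []. Qed.

End FunctionAlgebra.

Section FdCriteria.
Variables (R : realType) (A : cstarAlgType R).

(** The point is closedness, which comes from the unitization, where finite-dimensional subspaces
    are closed. *)
Lemma fd_cstar (B : set A) : linset B -> (forall x y, B x -> B y -> B (x ** y)) ->
  (forall x, B x -> B x^†) -> (exists n, dimle n B) ->
  cstar_subalgebra B /\ finite_dim B.
Proof.
move=> lB BM BS [n dB].
have -> : B = @uembed R A @^-1` (@uembed R A @` B).
  by apply/seteqP; split=> [x Bx|x [y By [<-]]//]; exists x.
apply: fdalg_cstar; last by move=> _ [x _ <-]; exists x.
split; last first.
  by exists n; apply: dimle_image dB => k x y; rewrite uembedD uembedZ.
split; first split.
- by exists 0 => //; exact: lin0.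
- move=> _ _ [x Bx <-] [y By <-]; rewrite -uembedD.
  by exists (x + y) => //; exact: linD.
- by move=> k _ [x Bx <-]; rewrite -uembedZ; exists (k *: x) => //; exact: linZ.
- by move=> _ _ [x Bx <-] [y By <-]; rewrite -uembedM; exists (x ** y) => //; exact: BM.
- by move=> _ [x Bx <-]; rewrite -uembed_star; exists x^† => //; exact: BS.
Qed.

Lemma dense_nr (S : set A) :
  dense S <-> forall x (e : R), 0 < e -> exists2 y, S y & nr (x - y) < e.
Proof.
split=> [dS x e e0|h V [x Vx] oV].
  have [||y []] := dS (ball x (e%:C%C)).
  - by exists x; apply: ballxx; rewrite ltcR.
  - by apply: ball_open; rewrite ltcR.
  - by rewrite nr_ball => xy Sy; exists y.
have [e /= e0 sV] := (nbhs_ballP _ _).1 (open_nbhs_nbhs (conj oV Vx)).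
have eE := ge0_ReE (ltW e0).
have /(h x)[y Sy xy] : 0 < complex.Re e by rewrite -ltcR -eE.
by exists y; split => //; apply: sV; rewrite eE nr_ball.
Qed.

(** Subalgebras indexed by finite lists are directed through concatenation. *)
Lemma AF_of_seq (T : Type) (D : seq T -> set A) :
  (forall G, linset (D G)) ->
  (forall G x y, D G x -> D G y -> D G (x ** y)) ->
  (forall G x, D G x -> D G x^†) ->
  (forall G, exists n, dimle n (D G)) ->
  (forall G H, D G `<=` D (G ++ H) /\ D H `<=` D (G ++ H)) ->
  (forall x (e : R), 0 < e -> exists G, exists2 y, D G y & nr (x - y) < e) ->
  AF A.
Proof.
move=> lD DM DS dD DC hD; exists (range D); split.
- by move=> _ [G _ <-]; apply: fd_cstar => //; [exact: DM|exact: DS].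
- move=> _ _ [G _ <-] [H _ <-]; have [GH HG] := DC G H.
  by exists (D (G ++ H)); split => //; exists (G ++ H).
- apply/dense_nr => x e /(hD x)[G [y Dy xy]].
  by exists y => //; exists (D G) => //; exists G.
Qed.

End FdCriteria.

(** Induction on G: the kernel of e t in S is separated by the rest of G, and S is contained in the
    sum of this kernel and the span of lifts of a basis of e t (S). *)
Lemma dimle_separated (K : fieldType) (V W : lmodType K) (T : eqType) d
    (e : T -> V -> W) (G : seq T) (S : set V) :
  (forall t k x y, e t (k *: x + y) = k *: e t x + e t y) ->
  dimle d [set: W] -> linset S ->
  (forall x, S x -> (forall t, t \in G -> e t x = 0) -> x = 0) ->
  exists n, dimle n S.
Proof.
move=> eL dW; elim: G S => [|t G IH] S lS hS.
  exists 0%N => m b Sb ib; case: m b Sb ib => // m b Sb ib.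
  have h1 : \sum_i (1 : K) *: b i = 0 by rewrite big1// => i _; rewrite (hS (b i)) ?scaler0.
  by have /eqP := ib (fun=> 1) h1 ord0; rewrite oner_eq0.
have e0 t' : e t' 0 = 0.
  by have := eL t' (-1) 0 0; rewrite scaleN1r addNr scaleN1r addNr.
have eZ t' k x : e t' (k *: x) = k *: e t' x.
  by have := eL t' k x 0; rewrite addr0 e0 addr0.
have eD t' x y : e t' (x + y) = e t' x + e t' y.
  by have := eL t' 1 x y; rewrite !scale1r.
pose S' := [set x | S x /\ e t x = 0].
have lS' : linset S'.
  split=> [|x y [Sx x0] [Sy y0]|k x [Sx x0]].
  - by split; [exact: lin0|].
  - by split; [exact: linD|rewrite eD x0 y0 addr0].
  - by split; [exact: linZ|rewrite eZ x0 scaler0].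
have [|n dS'] := IH _ lS'.
  move=> x [Sx tx] Gx; apply: hS => // t'; rewrite inE => /orP[/eqP -> //|].
  exact: Gx.
have lI : linset (e t @` S).
  split=> [|_ _ [x Sx <-] [y Sy <-]|k _ [x Sx <-]].
  - by exists 0 => //; exact: lin0.
  - by exists (x + y); [exact: linD|exact: eD].
  - by exists (k *: x); [exact: linZ|exact: eZ].
have dI : dimle d (e t @` S) by apply: dimle_sub dW.
have [m [b [_ bE]]] := dimle_span lI dI.
have /choice[c hc] i : exists c, S c /\ e t c = b i.
  have : (e t @` S) (b i) by rewrite bE; exact: span_mem.
  by move=> [c Sc cE]; exists c.
have [k hk] := dimle_add lS' (span_linset c) dS' (@span_dimle _ _ _ c).
exists k; apply: dimle_sub hk => x Sx.
have [a ha] : span b (e t x) by rewrite -bE; exists x.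
have e_sum : e t (\sum_i a i *: c i) = e t x.
  rewrite (big_morph (e t) (eD t) (e0 t)) ha; apply: eq_bigr => i _.
  by rewrite eZ (hc i).2.
have Sc : S (\sum_i a i *: c i).
  by apply: lin_sum => // i _; apply: linZ => //; exact: (hc i).1.
exists (x - \sum_i a i *: c i), (\sum_i a i *: c i); split.
- split; first exact: linB.
  by rewrite eD -scaleN1r eZ e_sum scaleN1r subrr.
- by exists a.
- by rewrite subrK.
Qed.

Section VanishingAtInfinity.
Variable R : realType.

Definition c0 (T : Type) (g : T -> R) :=
  forall e : R, 0 < e -> finite_set [set t | e <= g t].

Lemma c0_near (T : Type) (g : T -> R) :
  (forall e : R, 0 < e -> exists2 h, c0 h & forall t, g t <= h t + e) -> c0 g.
Proof.
move=> hg e e0; have e2 : 0 < e / 2 by rewrite divr_gt0.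
have [h ch gh] := hg _ e2; apply: sub_finite_set (ch _ e2) => t /= et.
by have := gh t; lra.
Qed.

Lemma c0_le (T : Type) (h g : T -> R) : (forall t, g t <= h t) -> c0 h -> c0 g.
Proof.
move=> gh ch e e0; apply: sub_finite_set (ch _ e0) => t /= et.
exact: le_trans (gh t).
Qed.

Lemma c0D (T : Type) (g h : T -> R) : c0 g -> c0 h -> c0 (fun t => g t + h t).
Proof.
move=> cg ch e e0; have e2 : 0 < e / 2 by rewrite divr_gt0.
have : finite_set ([set t | e / 2 <= g t] `|` [set t | e / 2 <= h t]).
  by rewrite finite_setU; split; [exact: cg|exact: ch].
apply: sub_finite_set => t /= et.
by have [|] := leP (e / 2) (g t); [left|right; lra].
Qed.

Lemma c0Z (T : Type) (c : R) (g : T -> R) : (forall t, 0 <= g t) ->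
  c0 g -> c0 (fun t => c * g t).
Proof.
move=> g0 cg e e0; have c1 : 0 < `|c| + 1 by rewrite ltr_wpDl.
have ec : 0 < e / (`|c| + 1) by rewrite divr_gt0.
apply: sub_finite_set (cg _ ec) => t /= et; rewrite ler_pdivrMr//.
by have := g0 t; have := ler_norm c; nra.
Qed.

Lemma c0_0 (T : Type) : c0 (fun _ : T => 0).
Proof.
move=> e e0; apply: sub_finite_set (@finite_set0 T) => t /=.
by rewrite leNgt e0.
Qed.

(** If the product is at least e, each factor is at least e / (c^2 + 1), which leaves finitely many
    values for each coordinate. *)
Lemma c0_prod3 (T1 T2 T3 : Type) (c : R)
    (f : T1 -> R) (g : T2 -> R) (h : T3 -> R) :
  (forall t, 0 <= f t <= c) -> (forall t, 0 <= g t <= c) -> (forall t, 0 <= h t <= c) ->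
  c0 f -> c0 g -> c0 h -> c0 (fun t : T1 * T2 * T3 => f t.1.1 * g t.1.2 * h t.2).
Proof.
move=> fc gc hc cf cg ch e e0; pose d := e / (c ^+ 2 + 1).
have d0 : 0 < d by rewrite divr_gt0// ltr_wpDl ?sqr_ge0.
have := finite_setX (finite_setX (cf d d0) (cg d d0)) (ch d d0).
apply: sub_finite_set => -[[t1 t2] t3] /= et.
have c1 : 0 < c ^+ 2 + 1 by rewrite ltr_wpDl ?sqr_ge0.
have key (x y z : R) : 0 <= x -> 0 <= y <= c -> 0 <= z <= c ->
    e <= x * (y * z) -> d <= x.
  move=> x0 /andP[y0 yc] /andP[z0 zc] /le_trans h'.
  rewrite ler_pdivrMr//; apply: h'; rewrite ler_wpM2l//.
  have : y * z <= c * c by apply: ler_pM.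
  by rewrite expr2; lra.
have [f0 _] := andP (fc t1); have [g0 _] := andP (gc t2).
have [h0 _] := andP (hc t3).
split; first split => /=.
- by apply: (key _ (g t2) (h t3)) => //; rewrite mulrA.
- by apply: (key _ (f t1) (h t3)) => //; rewrite mulrCA mulrA.
- by apply: (key _ (f t1) (g t2)) => //; rewrite mulrC.
Qed.

End VanishingAtInfinity.

(** * A non-AF extension of AF algebras *)

Section Example.
Variables (R : realType) (M : ucstarAlgType R) (v : M) (w : nat -> M).
Variables (K1 K2 : choiceType) (k1 : K1).
Local Notation half := (2^-1 : R).
Local Notation S := (K1 * K2 * nat)%type.
Local Notation K := (K1 + K2)%type.
Local Notation X := (K + S)%type.
Hypotheses (pv : isproj v) (pw : forall n, isproj (w n)).
Hypothesis vw : c0 (fun n => un (v * w n)).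

Let v1 : un v <= 1. Proof. exact: isproj_le1. Qed.
Let w1 n : un (w n) <= 1. Proof. exact: isproj_le1. Qed.

Let scalars : set M := span (fun _ : 'I_1 => 1).

Let scalarE (x : M) : scalars x <-> exists z : R[i], x = z *: 1.
Proof.
split=> [[c ->]|[z ->]]; first by exists (c ord0); rewrite big_ord1.
by exists (fun=> z); rewrite big_ord1.
Qed.

Definition tail (h : K -> M) (s : S) : M :=
  h (inl s.1.1) * v + h (inr s.1.2) * w s.2.

Definition dev (f : X -> M) (s : S) : M := f (inr s) - tail (f \o inl) s.

(* The coefficients l and m are stored as the values, scalar multiples of 1, of f
   on K, so that a single supremum norm controls everything. *)
Record fiber (f : X -> M) : Prop := Fiber {
  fib_bounded : exists c, forall x, un (f x) <= c;
  fib_scalar : forall k, exists z : R[i], f (inl k) = z *: 1;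
  fib_c0 : c0 (fun k => un (f (inl k)));
  fib_dev : c0 (fun s => un (dev f s))
}.

Lemma tail_le (h : K -> M) s (c : R) : (forall k, un (h k) <= c) ->
  un (tail h s) <= 2 * c.
Proof.
move=> hc; apply: (le_trans (unD _ _)).
have c0' : 0 <= c := le_trans (un_ge0 _) (hc (inl k1)).
have e (x y : M) : un x <= c -> un y <= 1 -> un (x * y) <= c.
  move=> xc y1; rewrite -[leRHS]mulr1.
  by apply: le_trans (unM _ _) _; apply: ler_pM => //; exact: un_ge0.
have := e _ _ (hc (inl s.1.1)) v1; have := e _ _ (hc (inr s.1.2)) (w1 s.2); lra.
Qed.

Lemma devB f g s : dev (fun x => f x - g x) s = dev f s - dev g s.
Proof. by rewrite /dev /tail /=; ncring. Qed.

Fact fiber0 : fiber 0.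
Proof.
split.
- by exists 0 => x; rewrite un0.
- by move=> k; exists 0; rewrite scale0r.
- by apply: c0_le (@c0_0 R _) => k; rewrite un0.
- apply: c0_le (@c0_0 R _) => s; rewrite /dev /tail /= !mul0r addr0 subr0.
  by rewrite un0.
Qed.

Fact fiberD f g : fiber f -> fiber g -> fiber (f + g).
Proof.
move=> [[c hc] sf cf df] [[d hd] sg cg dg]; split.
- exists (c + d) => x; apply: le_trans (unD _ _) _.
  by apply: lerD; [exact: hc|exact: hd].
- move=> k; have [y yE] := sf k; have [z zE] := sg k.
  by exists (y + z); rewrite scalerDl -yE -zE.
- by apply: c0_le (c0D cf cg) => k; exact: unD.
- apply: c0_le (c0D df dg) => s; apply: le_trans _ (unD _ _).
  have -> // : dev (f + g) s = dev f s + dev g s.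
  rewrite /dev /tail /= -![(f + g) _]/(f _ + g _); ncring.
Qed.

Fact fiberZ (k : R[i]) f : fiber f -> fiber (k *: f).
Proof.
move=> [[c hc] sf cf df]; split.
- exists (cn k * c) => x; rewrite -[(k *: f) x]/(k *: f x) unZ -/(cn k).
  by rewrite ler_wpM2l ?cn_ge0.
- move=> x; have [y yE] := sf x; exists (k * y).
  by rewrite -[(k *: f) _]/(k *: f _) yE scalerA.
- have := @c0Z _ _ (cn k) _ _ cf; move=> /(_ (fun=> un_ge0 _)).
  by apply: c0_le => x; rewrite -[(k *: f) _]/(k *: f _) unZ.
- have := @c0Z _ _ (cn k) _ _ df; move=> /(_ (fun=> un_ge0 _)).
  apply: c0_le => s; rewrite -[_ * un _]unZ.
  have -> // : dev (k *: f) s = k *: dev f s.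
  rewrite /dev /tail /= -![(k *: f) _]/(k *: f _); ncring.
Qed.

Fact fiber_adj f : fiber f -> fiber (fun x => adj (f x)).
Proof.
move=> [[c hc] sf cf df]; split.
- by exists c => x; rewrite un_adj.
- by move=> k; have [y yE] := sf k; exists (y^*)%C; rewrite yE adjZ adj1.
- by apply: c0_le cf => k; rewrite un_adj.
- apply: c0_le df => s; rewrite -(un_adj (dev f s)).
  have -> // : dev (fun x => adj (f x)) s = adj (dev f s).
  rewrite /dev /tail /= adjB adjD !adjM.
  have [-> _] := pv; have [-> _] := pw s.2.
  have [y ->] := sf (inl s.1.1); have [z ->] := sf (inr s.1.2).
  by rewrite !adjZ adj1; ncring.
Qed.

(** As v and w n are projections, the product of two tails is the tail of the product up to
    multiples of v * w n and w n * v; by [c0_prod3] these vanish at infinity, because l, m and |v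
    w_n| do. *)
Fact fiberM f g : fiber f -> fiber g -> fiber (fun x => f x * g x).
Proof.
move=> [[c hc] sf cf df] [[d hd] sg cg dg].
have c0' : 0 <= c := le_trans (un_ge0 _) (hc (inl (inl k1))).
have d0' : 0 <= d := le_trans (un_ge0 _) (hd (inl (inl k1))).
split.
- exists (c * d) => x; apply: le_trans (unM _ _) _.
  by apply: ler_pM; rewrite ?un_ge0.
- move=> k; have [y yE] := sf k; have [z zE] := sg k.
  by exists (y * z); rewrite yE zE; ncring.
- have := @c0Z _ _ c _ _ cg; move=> /(_ (fun=> un_ge0 _)).
  apply: c0_le => k; apply: le_trans (unM _ _) _.
  by rewrite ler_wpM2r ?un_ge0.
pose m := c + d + 1.
have cfl : c0 (fun a => un (f (inl (inl a)))).
  move=> e e0; have := cf e e0; apply: finite_preimage => ? ? _ _.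
  by case.
have cfr : c0 (fun b => un (f (inl (inr b)))).
  move=> e e0; have := cf e e0; apply: finite_preimage => ? ? _ _.
  by case.
have cgl : c0 (fun a => un (g (inl (inl a)))).
  move=> e e0; have := cg e e0; apply: finite_preimage => ? ? _ _.
  by case.
have cgr : c0 (fun b => un (g (inl (inr b)))).
  move=> e e0; have := cg e e0; apply: finite_preimage => ? ? _ _.
  by case.
have vw1 n : 0 <= un (v * w n) <= m.
  rewrite un_ge0 /=; apply: le_trans (unM_le v1 (w1 n)) _.
  by rewrite mulr1 /m; lra.
have fm x : 0 <= un (f x) <= m by rewrite un_ge0 /=; have := hc x; rewrite /m; lra.
have gm x : 0 <= un (g x) <= m by rewrite un_ge0 /=; have := hd x; rewrite /m; lra.
have t1 := c0_prod3 (fun a => fm (inl (inl a))) (fun b => gm (inl (inr b))) vw1 cfl cgr vw.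
have t2 := c0_prod3 (fun a => gm (inl (inl a))) (fun b => fm (inl (inr b))) vw1 cgl cfr vw.
have t3 := c0Z d (fun=> un_ge0 _) df.
have t4 := c0Z (2 * c) (fun=> un_ge0 _) dg.
apply: c0_le (c0D (c0D t1 t2) (c0D t3 t4)) => -[[a b] n] /=.
set da := dev f _; set db := dev g _.
have [fa faE] := sf (inl a); have [fb fbE] := sf (inr b).
have [ga gaE] := sg (inl a); have [gb gbE] := sg (inr b).
have -> : dev (fun x => f x * g x) (a, b, n) =
    (fa * gb) *: (v * w n) + (fb * ga) *: (w n * v) +
    (tail (f \o inl) (a, b, n) * db + da * g (inr (a, b, n))).
  have [_ vv] := pv; have [_ ww] := pw n.
  rewrite /da /db /dev /tail /= faE fbE gaE gbE.
  transitivity (f (inr (a, b, n)) * g (inr (a, b, n)) - (fa * ga) *: (v * v)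
                - (fb * gb) *: (w n * w n)); last by ncring.
  by rewrite vv ww; ncring.
have unE (z : R[i]) : un (z *: 1 : M) = cn z by rewrite unZ un1 mulr1.
have wv : un (w n * v) = un (v * w n).
  by rewrite -un_adj adjM; have [-> _] := pv; have [-> _] := pw n.
apply: le_trans (unD _ _) _; apply: lerD.
  apply: le_trans (unD _ _) _; apply: lerD.
    by rewrite faE gbE !unE unZ -/(cn _) cnM.
  by rewrite gaE fbE !unE unZ -/(cn _) cnM [cn ga * _]mulrC wv.
apply: le_trans (unD _ _) _; rewrite addrC; apply: lerD.
  rewrite mulrC; apply: le_trans (unM _ _) _.
  by rewrite ler_wpM2l ?un_ge0// hd.
apply: le_trans (unM _ _) _; rewrite ler_wpM2r ?un_ge0//.
by apply: tail_le => k; exact: hc.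
Qed.

Fact fiber_closed f : (forall e : R, 0 < e ->
  exists2 g, fiber g & forall x, un (f x - g x) <= e) -> fiber f.
Proof.
move=> h; split.
- have [g [[c hc] _ _ _] fg] := h 1 ltr01; exists (c + 1) => x.
  have := unD (f x - g x) (g x); rewrite subrK.
  by have := hc x; have := fg x; lra.
- move=> k; apply/scalarE.
  apply: (dimle_uclosed (span_linset _) (@span_dimle _ _ _ _)) => e e0.
  have e2 : 0 < e / 2 by rewrite divr_gt0.
  have [g [_ sg _ _] fg] := h _ e2; exists (g (inl k)); first exact/scalarE.
  by apply: le_lt_trans (fg _) _; lra.
- apply: c0_near => e e0; have [g [_ _ cg _] fg] := h _ e0.
  exists (fun k => un (g (inl k))) => // k.
  have := unD (f (inl k) - g (inl k)) (g (inl k)); rewrite subrK.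
  by have := fg (inl k); lra.
(* The value contributes one third and the tail, by [tail_le], two thirds. *)
- apply: c0_near => e e0; have e3 : 0 < e / 3 by rewrite divr_gt0.
  have [g [_ _ _ dg] fg] := h _ e3; exists (fun s => un (dev g s)) => // s.
  have := unD (dev f s - dev g s) (dev g s); rewrite subrK -devB.
  have := tail_le s (fun k => fg (inl k)).
  have := unB (f (inr s) - g (inr s)) (tail (fun k => f (inl k) - g (inl k)) s).
  have := fg (inr s); rewrite -/(dev (fun x => f x - g x) s); lra.
Qed.

Definition fiberAlgebra : funAlgebra X M :=
  FunAlgebra (inl (inl k1)) fib_bounded fiber0 fiberD fiberZ fiberM fiber_adj
    fiber_closed.

End Example.

Section ExampleExtension.
Variables (R : realType) (M : ucstarAlgType R) (v : M) (w : nat -> M).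
Variables (K1 K2 : choiceType) (k1 : K1) (d : nat).
Local Notation S := (K1 * K2 * nat)%type.
Local Notation K := (K1 + K2)%type.
Local Notation X := (K + S)%type.
Hypotheses (pv : isproj v) (pw : forall n, isproj (w n)).
Hypothesis vw : c0 (fun n => un (v * w n)).
Hypothesis dM : dimle d [set: M].

Definition fiberAlg := funAlg (fiberAlgebra K2 k1 pv pw vw).
HB.instance Definition _ := CStarAlgebra.on fiberAlg.

Implicit Types (f g : fiberAlg).
Local Notation evx := (@ev R X M (fiberAlgebra K2 k1 pv pw vw)).

Lemma fiberAlgP f : fiber v w (val f).
Proof. exact (funAlgP f). Qed.

Definition zero_fiber : set fiberAlg := [set f | forall k, evx (inl k) f = 0].

Fact zero_fiber_closed : closed zero_fiber.
Proof.
apply/closedP_nr => f h k; apply: le0_un; apply/ler_addgt0Pr => e /h[g g0 fg].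
have := ev_le (inl k) (f - g); rewrite evB g0 subr0 add0r -nr_fun.
by move/le_trans; apply; exact: ltW.
Qed.

Definition fiberIdeal : closedIdeal fiberAlg.
Proof.
apply: (@ClosedIdeal _ fiberAlg zero_fiber) => [|f g f0 g0 k|z f f0 k|f g g0 k|f g g0 k|].
- by move=> k.
- by rewrite evD f0 g0 addr0.
- by rewrite evZ f0 scaler0.
- by rewrite evM g0 mulr0.
- by rewrite evM g0 mul0r.
- exact: zero_fiber_closed.
Defined.

(** On the ideal the tail is 0, so its elements vanish at infinity and are approximated by their
    restrictions to finite sets of points. *)
Lemma fiberIdeal_AF : AF (idealAlg fiberIdeal).
Proof.
pose D (G : seq S) : set (idealAlg fiberIdeal) :=
  [set x | forall s, s \notin G -> evx (inr s) (val x) = 0].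
have lD G : linset (D G).
  split=> [s _|x y Dx Dy s sG|z x Dx s sG]; first by rewrite ev0.
  - by rewrite [val _]/(val x + val y) evD Dx// Dy// addr0.
  - by rewrite [val _]/(z *: val x) evZ Dx// scaler0.
apply: (@AF_of_seq _ _ _ D) => //.
- move=> G x y Dx Dy s sG.
  by rewrite [val _]/(val x ** val y) evM Dx// mul0r.
- by move=> G x Dx s sG; rewrite [val _]/((val x)^†) ev_star Dx// adj0.
- move=> G; apply: (@dimle_separated _ _ M _ d (fun s x => evx (inr s) (val x)) G) => //.
  move=> x Dx xG; apply: val_inj; apply: fun_eq => -[k|s].
    by have := idealAlgP x k.
  by have [/xG|/Dx] := boolP (s \in G).
- move=> G H; split=> x Dx s; rewrite mem_cat negb_or => /andP[sG sH].
    exact: Dx.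
  exact: Dx.
- move=> x e e0; have e2 : 0 < e / 2 by rewrite divr_gt0.
  have [[c hc] _ _ df] := fiberAlgP (val x).
  have [G GE] := (finite_seqP _).1 (df _ e2).
  have xK k : evx (inl k) (val x) = 0 by exact: (idealAlgP x).
  have devx s : dev v w (val (val x)) s = evx (inr s) (val x).
    have x0 k : (val (val x)) (inl k) = 0 by exact: xK.
    by rewrite /dev /tail /= !x0 !mul0r addr0 subr0.
  pose y (t : X) : M := if t is inr s then if s \in G then (val (val x)) t else 0 else 0.
  have Py : fiber v w y.
    split.
    - exists `|c| => -[k|s] /=; first by rewrite un0.
      case: ifP => _; last by rewrite un0.
      by apply: le_trans (hc _) _; exact: ler_norm.
    - by move=> k; exists 0; rewrite scale0r.
    - by apply: c0_le (@c0_0 R _) => k; rewrite /= un0.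
    - move=> t t0; apply: sub_finite_set (finite_seq G) => s /=.
      rewrite /dev /tail /= !mul0r addr0 subr0.
      by case: ifP => // _; rewrite un0 leNgt t0.
  have Iy : ideal_set fiberIdeal (toFun (P := fiberAlgebra K2 k1 pv pw vw) Py) by move=> k.
  exists G, (toIdeal Iy); first by move=> s sG; rewrite /ev /= (negPf sG).
  apply: (@le_lt_trans _ _ (e / 2)); last by lra.
  rewrite -[nr _]/(nr (val x - toFun (P := fiberAlgebra K2 k1 pv pw vw) Py)).
  apply: fnorm_le => -[k|s]; rewrite evB /ev /=.
    by rewrite subr0 [val _ _]xK un0 ltW.
  case: ifP => sG; first by rewrite subrr un0 ltW.
  rewrite subr0 leNgt; apply/negP => es.
  have : [set` G] s by rewrite -GE /= devx ltW.
  by rewrite /= sG.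
Qed.

Lemma fiber_tail (h : K -> M) : (forall k, exists z : R[i], h k = z *: 1) ->
  c0 (fun k => un (h k)) -> (exists c, forall k, un (h k) <= c) ->
  fiber v w (fun x : X => match x with inl k => h k | inr s => tail v w h s end).
Proof.
move=> sh ch [c hc]; split => //.
- exists (2 * c) => -[k|s]; last exact: tail_le.
  by have := un_ge0 (h k); have := hc k; lra.
- by apply: c0_le (@c0_0 R _) => s; rewrite /dev /= subrr un0.
Qed.

(** A class is determined by its values on K, which any representative gives. Off a suitable finite
    set the values of f have norm at most e / 4, and [fiber_tail] lifts them with norm at most e /
    2. *)
Lemma fiber_quot_AF : AF (quotAlg fiberIdeal).
Proof.
pose pi := quot_pi fiberIdeal.
have evq k f : evx (inl k) (repr (pi f)) = evx (inl k) f.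
  have h : zero_fiber (repr (pi f) - f) by exact (@repr_quot_pi _ _ fiberIdeal f).
  by apply/eqP; rewrite -subr_eq0 -evB; apply/eqP.
have evqD k (p q : quotAlg fiberIdeal) : evx (inl k) (repr (p + q)) = evx (inl k) (repr p) + evx (inl k) (repr q).
  by elim/quot_ind: p => f; elim/quot_ind: q => g; rewrite -quot_piD !evq evD.
have evqZ k z (p : quotAlg fiberIdeal) : evx (inl k) (repr (z *: p)) = z *: evx (inl k) (repr p).
  by elim/quot_ind: p => f; rewrite -quot_piZE !evq evZ.
have evqM k (p q : quotAlg fiberIdeal) : evx (inl k) (repr (p ** q)) = evx (inl k) (repr p) * evx (inl k) (repr q).
  by elim/quot_ind: p => f; elim/quot_ind: q => g; rewrite -quot_piME !evq evM.
have evqS k (p : quotAlg fiberIdeal) : evx (inl k) (repr p^†) = adj (evx (inl k) (repr p)).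
  by elim/quot_ind: p => f; rewrite -[_^†]/(quot_star _) quot_pi_star !evq ev_star.
have evq_eq (p : quotAlg fiberIdeal) : (forall k, evx (inl k) (repr p) = 0) -> p = 0.
  elim/quot_ind: p => f f0; rewrite -(quot_pi0 fiberIdeal).
  by apply/quot_piP; rewrite subr0 => k; rewrite -evq f0.
have evq0 k : evx (inl k) (repr (0 : quotAlg fiberIdeal)) = 0.
  by rewrite -(quot_pi0 fiberIdeal) evq ev0.
pose D (G : seq K) : set (quotAlg fiberIdeal) :=
  [set q | forall k, k \notin G -> evx (inl k) (repr q) = 0].
have lD G : linset (D G).
  split=> [k _|p q Dp Dq k kG|z p Dp k kG]; first exact: evq0.
  + by rewrite evqD Dp// Dq// addr0.
  + by rewrite evqZ Dp// scaler0.
apply: (@AF_of_seq _ _ _ D) => //.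
- by move=> G p q Dp Dq k kG; rewrite evqM Dp// mul0r.
- by move=> G p Dp k kG; rewrite evqS Dp// adj0.
- move=> G; apply: (@dimle_separated _ _ M _ d (fun k (q : quotAlg fiberIdeal) => evx (inl k) (repr q)) G) => //.
  + by move=> k z p q; rewrite evqD evqZ.
  + move=> p Dp pG; apply: evq_eq => k.
    by have [/pG|/Dp] := boolP (k \in G).
- move=> G H; split=> x Dx s; rewrite mem_cat negb_or => /andP[sG sH].
    exact: Dx.
  exact: Dx.
- move=> q e e0; elim/quot_ind: q => f; have e4 : 0 < e / 4 by rewrite divr_gt0.
  have [[c hc] sf cf df] := fiberAlgP f.
  have [G GE] := (finite_seqP _).1 (cf _ e4).
  pose h k : M := if k \in G then 0 else val f (inl k).
  have h_le k : un (h k) <= un (val f (inl k)).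
    by rewrite /h; case: ifP => _; rewrite ?un0 ?un_ge0.
  have he k : un (h k) <= e / 4.
    rewrite /h; case: ifP => kG; first by rewrite un0 ltW.
    rewrite leNgt; apply/negP => ek.
    by have : [set` G] k; [rewrite -GE /= ltW|rewrite /= kG].
  have Ph : fiber v w (fun x : X => match x with inl k => h k | inr s => tail v w h s end).
    apply: fiber_tail; last by exists (e / 4).
    - move=> k; rewrite /h; case: ifP => _; last exact: sf.
      by exists 0; rewrite scale0r.
    - exact: c0_le cf.
  pose g : fiberAlg := toFun (P := fiberAlgebra K2 k1 pv pw vw) Ph.
  exists G, (pi (f - g)).
    by move=> k kG; rewrite evq evB {2}/ev /= /h (negPf kG) subrr.
  rewrite -quot_piB opprB addrC subrK.
  apply: le_lt_trans (quot_norm_le _ _) _.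
  apply: (@le_lt_trans _ _ (e / 2)); last by lra.
  apply: fnorm_le => -[k|s]; rewrite /ev /=; first by have := he k; lra.
  by apply: le_trans (tail_le k1 pv pw _ he) _; lra.
Qed.

End ExampleExtension.

(** * Failure of the AF property *)

Section NotAF.
Variables (R : realType) (M : ucstarAlgType R) (v : M) (w : nat -> M).
Variables (K1 K2 : choiceType) (k1 : K1).
Local Notation S := (K1 * K2 * nat)%type.
Local Notation K := (K1 + K2)%type.
Local Notation X := (K + S)%type.
Hypotheses (pv : isproj v) (pw : forall n, isproj (w n)).
Hypothesis vw : c0 (fun n => un (v * w n)).
Hypothesis vw_neq0 : forall n, v * w n != 0.
Hypothesis free_pair : forall (E : K1 -> nat -> set K2) (E' : K2 -> nat -> set K1),
  (forall a n, finite_set (E a n)) -> (forall b n, finite_set (E' b n)) ->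
  exists a b, forall n, ~ E a n b /\ ~ E' b n a.

Local Notation A := (@fiberAlg R M v w K1 K2 k1 pv pw vw).
Local Notation U := (unitization A).
Local Notation P := (fiberAlgebra K2 k1 pv pw vw).
Local Notation evx := (@ev R X M P).
Implicit Types (f g : A) (z : U).

(** Extends evaluation to the unitization, where 1 - q and the factors given by [spectral_cut]
    live. *)
Definition evU (x : X) z : M := evx x z.1 + z.2 *: 1.

Lemma evU_uembed x f : evU x (uembed f) = evx x f.
Proof. by rewrite /evU scale0r addr0. Qed.

Lemma evUB x z z' : evU x (z - z') = evU x z - evU x z'.
Proof.
by rewrite /evU /= evB scalerBl opprD addrACA.
Qed.

Lemma evUM x z z' : evU x (z * z') = evU x z * evU x z'.
Proof.
rewrite /evU /= !evD !evZ evM; ncring.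
Qed.

Lemma evU_adj x z : evU x (adj z) = adj (evU x z).
Proof. by rewrite /evU adjD adjZ adj1. Qed.

Lemma evU1 x : evU x 1 = 1.
Proof. by rewrite /evU /= ev0 add0r scale1r. Qed.

Lemma evU_le x z : un (evU x z) <= 3 * un z.
Proof.
apply: le_trans (unD _ _) _; rewrite unZ un1 mulr1 -/(cn _).
have := ev_le x z.1; rewrite -nr_fun; have := nr1_le z.
have : cn z.2 <= un z by rewrite -[leRHS]/(unrm _) le_max lexx.
by rewrite -[unrm z]/(un z); lra.
Qed.

Lemma evU_isproj x z : isproj z -> isproj (evU x z).
Proof. by move=> [zs zz]; split; rewrite -?evU_adj -?evUM ?zs ?zz. Qed.

Lemma isproj_lt1 (p : M) : isproj p -> un p < 1 -> p = 0.
Proof.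
move=> pp p1; apply: contrapT => p0; move: p1; apply/negP.
by rewrite -leNgt isproj_ge1.
Qed.

Definition indicator (k l : K) : M := (l == k)%:R *: 1.

Lemma indicator_fiber k : fiber v w (fun x : X =>
  match x with inl l => indicator k l | inr s => tail v w (indicator k) s end).
Proof.
have un_ind l : un (indicator k l) = (l == k)%:R.
  rewrite /indicator unZ un1 mulr1.
  by case: (l == k); rewrite ?normr1 ?normr0.
apply: fiber_tail => //.
- by move=> l; exists (l == k)%:R.
- move=> e e0; apply: sub_finite_set (finite_set1 k) => l /=.
  rewrite un_ind; case: eqP => // _.
  by rewrite leNgt e0.
- by exists 1 => l; rewrite un_ind; case: (l == k).
Qed.

(* A character of a projection is 0 or 1, so a projection close enough to the
   indicator has exactly the same values at all characters. *)
Lemma lift_indicator (B : set A) k f : cstar_subalgebra B -> finite_dim B ->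
  B f -> nr (toFun (P := P) (indicator_fiber k) - f) < 32^-1 ->
  exists2 g, B g & forall l, evx (inl l) g = indicator k l.
Proof.
move=> sB dB Bf; set i0 : A := toFun _ => i0f.
have fB : fdalg (@uembed R A @` B).
  by apply: cstar_fdalg => //; [exact: uembedD|exact: uembedZ|exact: uembedM|exact: uembed_star].
have [ssB _] := fB.
pose b := sadj (uembed f).
have Bb : (@uembed R A @` B) b by apply: sadj_mem => //; exists f.
have [q [c [d [pq [g Bg gq] [qc c2] [qd d2]]]]] := spectral_cut fB Bb (sadj_adj _).
exists g => // l; rewrite -evU_uembed gq.
have i0s : adj (uembed i0) = uembed i0.
  rewrite -uembed_star; congr uembed; apply: fun_eq => x; rewrite ev_star.
  case: x => [m|s]; rewrite /ev /= /indicator.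
    by rewrite adjZ adj1 conj_nat.
  rewrite /tail /indicator adjD !adjM; have [-> _] := pv; have [-> _] := pw s.2.
  by rewrite !adjZ adj1 !conj_nat; ncring.
have ib : un (uembed i0 - b) < 32^-1.
  by apply: le_lt_trans (sadj_near _ i0s) _; rewrite -uembedB un_uembed.
(* The values of c and d have norm at most 3 * 2 = 6 by [evU_le], and 6 * 3 / 32 < 1. *)
have bl : un (indicator k l - evU (inl l) b) <= 3 / 32.
  rewrite -[indicator k l]/(evx (inl l) i0) -evU_uembed -evUB.
  by apply: le_trans (evU_le _ _) _; lra.
have pl := evU_isproj (inl l) pq.
have cl := evU_le (inl l) c; have dl := evU_le (inl l) d.
move: bl; rewrite /indicator; case: eqP => [_|_] bl.
  rewrite scale1r; apply/esym/eqP; rewrite -subr_eq0; apply/eqP.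
  rewrite scale1r in bl.
  apply: isproj_lt1; first exact: isprojC.
  rewrite -(evU1 (inl l)) -evUB qd evUM evUB evU1.
  apply: le_lt_trans (unM _ _) _.
  have := un_ge0 (evU (inl l) d); have := un_ge0 (1 - evU (inl l) b); nra.
rewrite scale0r; rewrite scale0r sub0r unN in bl.
apply: isproj_lt1 => //; rewrite qc evUM; apply: le_lt_trans (unM _ _) _.
have := un_ge0 (evU (inl l) c); have := un_ge0 (evU (inl l) b); nra.
Qed.

Lemma fiberAlg_not_AF : ~ AF A.
Proof.
move=> [D [DP Ddir /dense_nr Dd]].
have lift k : exists Bf : set A * A, [/\ D Bf.1, Bf.1 Bf.2 &
    forall l, evx (inl l) Bf.2 = indicator k l].
  have [|f [B DB Bf] hf] := Dd (toFun (P := P) (indicator_fiber k)) 32^-1.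
    by rewrite invr_gt0.
  have [sB dB] := DP B DB.
  by have [g Bg hg] := lift_indicator sB dB Bf hf; exists (B, g).
have [BF hBF] := choice lift.
pose F k := (BF k).2.
(* The tolerance depends on n, so the exceptional sets are finite for each n separately. *)
pose ep n := un (v * w n) / 4.
have ep0 n : 0 < ep n.
  rewrite divr_gt0// lt_neqAle un_ge0 andbT eq_sym.
  by apply: contra_neq (vw_neq0 n) => /un0_eq0.
pose E a n : set K2 := [set b | ep n <= un (evx (inr (a, b, n)) (F (inl a)) - v)].
pose E' b n : set K1 := [set a | ep n <= un (evx (inr (a, b, n)) (F (inr b)) - w n)].
have indl a l : evx (inl l) (F (inl a)) = indicator (inl a) l by case: (hBF (inl a)).
have indr b l : evx (inl l) (F (inr b)) = indicator (inr b) l by case: (hBF (inr b)).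
have fE a n : finite_set (E a n).
  have [_ _ _ /(_ _ (ep0 n)) h] := fiberAlgP (F (inl a)).
  have : finite_set ((fun b : K2 => (a, b, n)) @^-1` [set s | ep n <= un (dev v w (val (F (inl a))) s)]).
    by apply: finite_preimage => // b b' _ _ [].
  apply: sub_finite_set => b /=.
  rewrite /dev /tail /= -!/(ev _ _) !indl /indicator eqxx /=.
  by rewrite scale1r scale0r mul1r mul0r addr0.
have fE' b n : finite_set (E' b n).
  have [_ _ _ /(_ _ (ep0 n)) h] := fiberAlgP (F (inr b)).
  have : finite_set ((fun a : K1 => (a, b, n)) @^-1` [set s | ep n <= un (dev v w (val (F (inr b))) s)]).
    by apply: finite_preimage => // a a' _ _ [].
  apply: sub_finite_set => a /=.
  rewrite /dev /tail /= -!/(ev _ _) !indr /indicator eqxx /=.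
  by rewrite scale1r scale0r mul1r mul0r add0r.
have [a [b hab]] := free_pair fE fE'.
pose f := F (inl a); pose g := F (inr b).
have [B [DB fB gB]] : exists B, [/\ D B, B f & B g].
  have [D1 F1 _] := hBF (inl a); have [D2 F2 _] := hBF (inr b).
  by have [B [DB s1 s2]] := Ddir _ _ D1 D2; exists B; split; [|exact: s1|exact: s2].
have [sB dB] := DP B DB.
(* f g is 0 on K, so it lies in the finite-dimensional C, whose unit r is 0 at some (a, b, n):
   otherwise the projections r (a, b, n) would have norm at least 1 for infinitely many n, whereas r
   vanishes at infinity. *)
pose C : set A := B `&` @zero_fiber R M v w K1 K2 k1 pv pw vw.
have Cfg : C (f ** g).
  split; first exact: (subalgM sB).
  move=> l; rewrite evM indl indr /indicator.
  case: eqP => [->|_]; last by rewrite scale0r mul0r.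
  by rewrite (_ : (inl a == inr b) = false)// scale0r mulr0.
have fC : fdalg (@uembed R A @` C).
  have [_ [n dBi]] : fdalg (@uembed R A @` B).
    by apply: cstar_fdalg => //; [exact: uembedD|exact: uembedZ|exact: uembedM|exact: uembed_star].
  split; last by exists n; apply: dimle_sub dBi => _ [x [Bx _] <-]; exists x.
  split; first split.
  - by exists 0 => //; split; [exact: (subalg0 sB)|move=> k; rewrite ev0].
  - move=> _ _ [x [Bx x0] <-] [y [By y0] <-]; rewrite -uembedD; exists (x + y) => //.
    by split; [exact: (subalgD sB)|move=> k; rewrite evD x0 y0 addr0].
  - move=> z _ [x [Bx x0] <-]; rewrite -uembedZ; exists (z *: x) => //.
    by split; [exact: (subalgZ sB)|move=> k; rewrite evZ x0 scaler0].
  - move=> _ _ [x [Bx x0] <-] [y [By y0] <-]; rewrite -uembedM; exists (x ** y) => //.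
    by split; [exact: (subalgM sB)|move=> k; rewrite evM x0 mul0r].
  - move=> _ [x [Bx x0] <-]; rewrite -uembed_star; exists x^† => //.
    by split; [exact: (subalg_star sB)|move=> k; rewrite ev_star x0 adj0].
have [r' [pr [r [_ r0] rE] hr]] := fdalg_unit fC.
rewrite -{}rE in pr hr.
have [n hn] : exists n, evx (inr (a, b, n)) r = 0.
  apply: contrapT => nr0.
  have [_ _ _ /(_ _ ltr01) h] := fiberAlgP r.
  have : finite_set ((fun n : nat => (a, b, n)) @^-1` [set s | 1 <= un (dev v w (val r) s)]).
    by apply: finite_preimage => // n n' _ _ [].
  apply: contra_not _ infinite_nat => //; apply: sub_finite_set => n _ /=.
  rewrite /dev /tail /= -!/(ev _ _) !r0 !mul0r addr0 subr0 -evU_uembed.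
  apply: isproj_ge1; first exact: evU_isproj.
  by rewrite evU_uembed => rn; apply: nr0; exists n.
have fg0 : evx (inr (a, b, n)) f * evx (inr (a, b, n)) g = 0.
  rewrite -evM -evU_uembed -(hr (uembed (f ** g))); last by exists (f ** g).
  have rn0 : evU (inr (a, b, n)) (uembed r) = 0 by rewrite evU_uembed; exact: hn.
  by rewrite evUM rn0 mul0r.
have [nE nE'] := hab n.
set x := evx _ f in fg0; set y := evx _ g in fg0.
have xv : un (x - v) < ep n by rewrite ltNge; apply/negP.
have yw : un (y - w n) < ep n by rewrite ltNge; apply/negP.
have v1 := isproj_le1 pv; have w1 := isproj_le1 (pw n).
have en : un (v * w n) = 4 * ep n by rewrite /ep; lra.
have en1 : un (v * w n) <= 1 by rewrite -[leRHS]mulr1; exact: unM_le.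
(* As f g is 0 at this point, |v w_n| would be at most 2 ep + ep^2, less than 4 ep since ep <=
   1/4. *)
have E1 : v * w n = - ((x - v) * w n + v * (y - w n) + (x - v) * (y - w n)).
  by rewrite -[LHS]addr0 -oppr0 -fg0; ncring.
have E2 := congr1 un E1; rewrite unN en in E2.
have := unM_le (ltW xv) w1; have := unM_le v1 (ltW yw).
have := unM_le (ltW xv) (ltW yw).
have := unD ((x - v) * w n + v * (y - w n)) ((x - v) * (y - w n)).
have := unD ((x - v) * w n) (v * (y - w n)).
have := ep0 n; rewrite -E2; rewrite en in en1.
move: en1; clear; move: (ep n) (un _) (un _) (un _) (un _) => *; nra.
Qed.

End NotAF.

(* Each finite set being enumerated by a sequence, this is Cantor's diagonal. *)
Lemma diagonal_avoid (T : Type) (F : T -> set (T * nat -> bool)) :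
  (forall t, finite_set (F t)) -> exists b, forall t, ~ F t b.
Proof.
move=> fF; have /choice[s hs] t : exists s : seq (T * nat -> bool), F t = [set` s].
  exact/finite_seqP.
exists (fun ti => ~~ nth (fun=> false) (s ti.1) ti.2 ti) => t.
rewrite hs => /= /(nthP (fun=> false))[i _].
by move=> /(congr1 (@^~ (t, i))) /=; case: (nth _ _ _ _).
Qed.

(** Instances of T * nat -> bool in [diagonal_avoid]: for [index1], T is the set of n; for [index2],
    it is the set of pairs of an element of [index1] and an n. *)
Definition index1 : Type := nat * nat -> bool.
Definition index2 : Type := index1 * nat * nat -> bool.
HB.instance Definition _ := Choice.on index1.
HB.instance Definition _ := Choice.on index2.

(** b is chosen first, against every a and n at once, which takes the larger set; then a has to
    avoid only the countably many sets E' b n. *)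
Lemma diagonal_pair (E : index1 -> nat -> set index2) (E' : index2 -> nat -> set index1) :
  (forall a n, finite_set (E a n)) -> (forall b n, finite_set (E' b n)) ->
  exists a b, forall n, ~ E a n b /\ ~ E' b n a.
Proof.
move=> fE fE'.
have [b hb] := @diagonal_avoid (index1 * nat)%type (fun an => E an.1 an.2) (fun an => fE _ _).
have [a ha] := @diagonal_avoid nat (E' b) (fE' b).
by exists a, b => n; split; [exact: (hb (a, n))|exact: ha].
Qed.

Theorem theorem1p13 (R : realType) :
  (exists (A : cstarAlgType R) (I : closedIdeal A),
     [/\ AF (idealAlg I), AF (quotAlg I) & ~ AF A]) /\
  (forall (A : cstarAlgType R) (I : closedIdeal A),
     LF (idealAlg I) -> LF (quotAlg I) -> LF A).
Proof.
split; last by move=> A I LI LQ; exact: LF_extension LI LQ.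
have pv := mat2v_isproj R; have pw := @mat2w_isproj R.
have vw : c0 (fun n => un (mat2v R * mat2w R n)).
  move=> e e0; have [|N hN] := @half_lt R (e / 2); first by rewrite divr_gt0.
  apply: sub_finite_set (finite_II N) => n /= en.
  rewrite ltnNge; apply/negP => Nn.
  have : (2^-1 : R) ^+ n <= 2^-1 ^+ N by apply: ler_wiXn2l => //; lra.
  by have := mat2vw_le R n; lra.
pose k1 : index1 := fun=> false.
exists (@fiberAlg R (mat2 R) _ _ index1 index2 k1 pv pw vw), (fiberIdeal index2 k1 pv pw vw).
split.
- exact (fiberIdeal_AF index2 k1 pv pw vw (@mat2_dimle R)).
- exact (fiber_quot_AF index2 k1 pv pw vw (@mat2_dimle R)).
- by apply: fiberAlg_not_AF; [exact: mat2vw_neq0|exact: diagonal_pair].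
Qed.
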